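(* Let $x_1,\dots,x_n$, $a_1,\dots,a_n$, and $c_1,\dots,c_{n+1}$ be indeterminates. For each $j=1,\dots,n$, let $P_j$ be an $A_{j-1}$ theta function of norm $-(c_1\cdots c_{n+1}a_{j+1}\cdots a_n)^{-1}$. Then $$\det_{1\leq i,j\leq n}\left(x_i^{-n}\prod_{k=1}^{n+1}\theta(c_kx_i)\,P_j(x_i)\prod_{k=j+1}^n\theta(a_kx_i)-x_i^{n+1}\prod_{k=1}^{n+1}\theta(c_kx_i^{-1})\,P_j(x_i^{-1})\prod_{k=j+1}^n\theta(a_kx_i^{-1})\right)$$ $$=\frac{a_1\cdots a_n}{\theta(-c_1\cdots c_{n+1}a_1\cdots a_n)}\prod_{i=1}^nP_i(1/a_i)\prod_{i=1}^{n+1}\theta(-c_i)\prod_{1\leq i<j\leq n+1}\theta(c_ic_j)\prod_{i=1}^n\bigl(\theta(x_i)\theta(px_i^2;p^2)\bigr)\prod_{1\le i<j\le n}a_jx_i^{-1}\,\theta(x_ix_j^{\pm}).$$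
   Context: Fix $p\in\mathbb C$ with $0<|p|<1$. Put $(a;q)_\infty=\prod_{j\ge0}(1-aq^j)$, $\theta(x;q)=(x;q)_\infty(q/x;q)_\infty$ for $x\ne0$, $\theta(x)=\theta(x;p)$, and $\theta(xy^{\pm})=\theta(xy)\theta(x/y)$. A function $f$ holomorphic on $\mathbb C\setminus\{0\}$ is called an $A_{m-1}$ theta function of norm $s$ (with $m\ge1$ and $s\in\mathbb C\setminus\{0\}$) if $f(px)=\frac{(-1)^m}{s x^m}f(x)$ for all $x\neq0$. ''Indeterminates'' are understood as nonzero complex numbers, assumed generic so that no denominators vanish. *)

(* Defs.v *)
From mathcomp Require Import all_boot all_order all_algebra.
From mathcomp Require Import all_classical all_reals all_analysis.
From mathcomp Require Export complex.
Import Order.TTheory GRing.Theory Num.Theory.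
Import numFieldNormedType.Exports.

Set Implicit Arguments.
Unset Strict Implicit.
Unset Printing Implicit Defensive.

Local Open Scope classical_set_scope.
Local Open Scope ring_scope.

(* Everything is stated over an arbitrary numFieldType K, which carries the
   topology of its norm; it is used with K := R[i] for R : realType, because
   the libraries do not attach a topology to the type R[i] itself. *)

Section ThetaFunctions.
Variable K : numFieldType.
Implicit Types (a p q s x : K) (m : nat) (f : K -> K).

(* (a; q)_oo; the partial products converge for `|q| < 1. *)
Definition qpochhammer a q : K :=
  lim ((\prod_(0 <= j < N) (1 - a * q ^+ j)) @[N --> \oo]).

Definition theta x q : K := qpochhammer x q * qpochhammer (q / x) q.

(* Differentiability in the direction 1 of the K-normed module K^o, i.e.
   convergence of h^-1 * (f (h + x) - f x) as the scalar h in K tends to 0: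
   for K = R[i], this is complex differentiability. *)
Definition holomorphic_punctured f : Prop :=
  forall x, x != 0 -> derivable (f : K^o -> K^o) x 1.

(* f is an A_{m-1} theta function of norm s (m >= 1, s != 0) for the nome p.
   The value f 0 is irrelevant. *)
Definition A_theta_function p m s f : Prop :=
  holomorphic_punctured f /\
  forall x, x != 0 -> f (p * x) = (-1) ^+ m / (s * x ^+ m) * f x.

End ThetaFunctions.

(* Main.v *)
Require Import Defs.
From mathcomp Require Import all_boot all_order all_algebra.
From mathcomp Require Import all_classical all_reals all_analysis.
From mathcomp Require Import complex ring lra zify.
Import Order.TTheory GRing.Theory Num.Theory.
Import numFieldNormedType.Exports.
Import ComplexField.Normc.

(** Write [C] for the product of the [c k], and [t] for [- C^-1].

    A function [f], holomorphic on the punctured plane, with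
    [f (p * x) = u * x ^- m * f x] is determined by [m] consecutive Laurent
    coefficients, because the equation links coefficients whose indices differ by
    [m] ([qper_coef_inj]). These functions therefore form a space of dimension at
    most [m], and one that vanishes at [m] points which are generic for its norm
    is zero ([qper_zeros]). All product formulas below come from this uniqueness:
    two functions of one variable in the same space, with enough common values,
    are equal.

    The functions [f_j x = P_j x * prod_(k > j) theta (a_k * x)] are all A_(n-1)
    theta functions of norm [t]. Their determinant is an explicit product
    ([detA]): as a function of the last variable it vanishes at the other
    variables, and at the inverse of the last [a] it reduces to the determinant of
    size one less.

    With [F_j x = x ^- n * prod_k theta (c_k * x) * f_j x], the entries of the
    determinant in question are [g_j x_i] for [g_j x = F_j x - x * F_j x^-1]. They
    satisfy [g (p * x) = p ^- n * x ^- (2n+1) * g x] and [g x^-1 = - x^-1 * g x].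
    Such a function vanishes at [1] and, with every zero, at its inverse, so [n]
    generic zeros force it to be zero ([odd_theta_zeros]). Hence the determinant
    equals the part of the right-hand side that depends on [x] up to a factor
    independent of [x] ([detC_exchange]). At [x_i = c_i^-1] the term
    [F_j x_i] vanishes and the determinant becomes the A-type one at the points
    [c_i] ([detC_at_inv]); comparing products gives the factor ([weylC_at_inv]).

    Both arguments divide by values of [theta], hence need generic parameters. The
    general case is the limit along a curve [x_i * z ^+ i.+1],
    [c_k * z ^+ (n + k).+1], with the last [c] chosen so that [C], and with it the
    admissible [P_j], stay fixed ([detC]); near [z = 1] such a curve avoids
    the zeros of [theta] ([theta_curve_neq0]).

    The analysis behind this is the theory of Laurent coefficients. Goursat's
    theorem in the coordinate [log x] shows that the mean of a holomorphic function
    over a circle centred at [0] does not depend on the circle ([mean_pholo]), and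
    Cauchy's kernel shows that a function all of whose Laurent coefficients vanish
    is zero ([coef_eq0]). *)

Set Implicit Arguments.
Unset Strict Implicit.
Unset Printing Implicit Defensive.

Local Open Scope classical_set_scope.
Local Open Scope ring_scope.
Local Open Scope complex_scope.

(** * The modulus, continuity and differentiability of complex functions *)

Section Modulus.
Variable R : realType.
Implicit Types (z w : R[i]) (r : R).

(** The norm of [R[i]] has values in [R[i]]; linear arithmetic needs them in [R]. *)
Definition cmod z : R := normc z.

Lemma cmodE z : `|z| = (cmod z)%:C. Proof. by []. Qed.
Lemma cmodM z w : cmod (z * w) = cmod z * cmod w.
Proof. exact: normcM. Qed.
Lemma cmodD z w : cmod (z + w) <= cmod z + cmod w.
Proof. exact: le_normcD. Qed.
Lemma cmodN z : cmod (- z) = cmod z.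
Proof. exact: normcN. Qed.
Lemma cmodV z : cmod z^-1 = (cmod z)^-1.
Proof. exact: normcV. Qed.
Lemma cmod0 : cmod 0 = 0. Proof. exact: normc0. Qed.
Lemma cmod1 : cmod 1 = 1. Proof. exact: normc1. Qed.
Lemma cmod_ge0 z : 0 <= cmod z.
Proof. by case: z => a b; exact: sqrtr_ge0. Qed.
Lemma cmod_eq0 z : (cmod z == 0) = (z == 0).
Proof.
by apply/eqP/eqP => [/(@eq0_normc R)|->]; rewrite ?cmod0.
Qed.
Lemma cmod_gt0 z : (0 < cmod z) = (z != 0).
Proof. by rewrite lt_def cmod_ge0 cmod_eq0 andbT. Qed.
Lemma cmodB z w : cmod (z - w) <= cmod z + cmod w.
Proof. by rewrite (le_trans (cmodD _ _))// cmodN. Qed.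
Lemma cmodBC z w : cmod (z - w) = cmod (w - z).
Proof. by rewrite -cmodN opprB. Qed.
Lemma cmod_triangle u z w : cmod (z - w) <= cmod (z - u) + cmod (u - w).
Proof. by rewrite -[z - w](subrKA u) cmodD. Qed.
Lemma cmodX z k : cmod (z ^+ k) = cmod z ^+ k.
Proof. by elim: k => [|k IH]; rewrite ?cmod1// !exprS cmodM IH. Qed.
Lemma cmodXz z (k : int) : cmod (z ^ k) = cmod z ^ k.
Proof. by case: k => k; rewrite ?NegzE -?exprnN -?exprnP ?cmodV cmodX. Qed.
Lemma cmodr r : cmod r%:C = `|r|.
Proof. by rewrite /cmod /= expr0n addr0 sqrtr_sqr. Qed.

Lemma abs_Re_le z : `|complex.Re z| <= cmod z.
Proof.
case: z => a b; rewrite /cmod /= -sqrtr_sqr ler_sqrt ?lerDl ?sqr_ge0//.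
by rewrite addr_ge0 ?sqr_ge0.
Qed.
Lemma abs_Im_le z : `|complex.Im z| <= cmod z.
Proof.
case: z => a b; rewrite /cmod /= -sqrtr_sqr ler_sqrt ?lerDr ?sqr_ge0//.
by rewrite addr_ge0 ?sqr_ge0.
Qed.
Lemma cmod_le_ReIm z : cmod z <= `|complex.Re z| + `|complex.Im z|.
Proof.
rewrite {1}(complexE z) (le_trans (cmodD _ _))// cmodM !cmodr.
by rewrite [X in X * _](_ : _ = 1) ?mul1r// /cmod /= expr0n expr1n add0r sqrtr1.
Qed.

Lemma ReD z w : complex.Re (z + w) = complex.Re z + complex.Re w.
Proof. by case: z; case: w. Qed.
Lemma ImD z w : complex.Im (z + w) = complex.Im z + complex.Im w.
Proof. by case: z; case: w. Qed.
Lemma ReB z w : complex.Re (z - w) = complex.Re z - complex.Re w.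
Proof. by case: z; case: w. Qed.
Lemma ImB z w : complex.Im (z - w) = complex.Im z - complex.Im w.
Proof. by case: z; case: w. Qed.

Lemma eq0_cmod_le z : (forall e, 0 < e -> cmod z <= e) -> z = 0.
Proof.
move=> h; apply/eqP; rewrite -cmod_eq0; apply/negP => /negP nz.
have z0 : 0 < cmod z by rewrite lt_def nz cmod_ge0.
have := h (cmod z / 2); rewrite divr_gt0// => /(_ isT); lra.
Qed.
End Modulus.

Section ContinuityAndDifferentiability.
Variable R : realType.
Implicit Types (f g h : R[i] -> R[i]) (z w : R[i]).

Definition ccont f z := forall e : R, 0 < e -> exists2 d : R, 0 < d &
  forall w, cmod (w - z) < d -> cmod (f w - f z) < e.

Lemma ccont_cst (k : R[i]) z : ccont (fun=> k) z.
Proof. by move=> e e0; exists 1 => // w _; rewrite subrr cmod0. Qed.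

Lemma ccont_id z : ccont id z.
Proof. by move=> e e0; exists e. Qed.

Lemma ccont_comp f g z : ccont g z -> ccont f (g z) -> ccont (f \o g) z.
Proof.
move=> cg cf e e0; have [d d0 fd] := cf e e0; have [c c0 gc] := cg d d0.
by exists c => // w /gc /fd.
Qed.

Lemma ccont_ext f g z : (forall w, f w = g w) -> ccont f z -> ccont g z.
Proof. by move=> /funext ->. Qed.

Lemma ccont_local f g z (r : R) : 0 < r ->
  (forall w, cmod (w - z) < r -> f w = g w) -> ccont f z -> ccont g z.
Proof.
move=> r0 fg cf e e0; have [d d0 fd] := cf e e0.
exists (Num.min d r) => [|w]; first by rewrite lt_min d0.
by rewrite lt_min => /andP[wd wr]; rewrite -!fg ?subrr ?cmod0//; exact: fd.
Qed.

Lemma ccontD f g z : ccont f z -> ccont g z -> ccont (fun w => f w + g w) z.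
Proof.
move=> cf cg e e0; have e20 : 0 < e / 2 by rewrite divr_gt0.
have [d d0 fd] := cf _ e20; have [c c0 gc] := cg _ e20.
exists (Num.min d c) => [|w]; first by rewrite lt_min d0.
rewrite lt_min => /andP[/fd fw /gc gw].
rewrite opprD addrACA (le_lt_trans (cmodD _ _))//; lra.
Qed.

Lemma ccont_bounded f z : ccont f z -> exists2 d : R, 0 < d &
  forall w, cmod (w - z) < d -> cmod (f w) <= cmod (f z) + 1.
Proof.
move=> /(_ 1 ltr01)[d d0 fd]; exists d => // w /fd.
have := cmodD (f w - f z) (f z); rewrite subrK; lra.
Qed.

Lemma ccontM f g z : ccont f z -> ccont g z -> ccont (fun w => f w * g w) z.
Proof.
move=> cf cg e e0.
have [c c0 gc] := ccont_bounded cg.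
set A := cmod (g z) + 1; set B := cmod (f z) + 1.
have A0 : 0 < A by rewrite /A ltr_wpDl ?cmod_ge0.
have B0 : 0 < B by rewrite /B ltr_wpDl ?cmod_ge0.
have [d d0 fd] := cf (e / 2 / A) ltac:(by rewrite !divr_gt0).
have [d' d'0 gd] := cg (e / 2 / B) ltac:(by rewrite !divr_gt0).
exists (Num.min c (Num.min d d')) => [|w]; first by rewrite !lt_min c0 d0.
rewrite !lt_min => /and3P[/gc gA /fd fw /gd gw].
have -> : f w * g w - f z * g z = (f w - f z) * g w + f z * (g w - g z) by ring.
rewrite (le_lt_trans (cmodD _ _))// !cmodM.
have h1 : cmod (f w - f z) * cmod (g w) < e / 2.
  rewrite -[ltRHS](divfK (lt0r_neq0 A0)).
  have [->|gw0] := eqVneq (cmod (g w)) 0; first by rewrite mulr0 mulr_gt0 ?divr_gt0.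
  apply: (@lt_le_trans _ _ (e / 2 / A * cmod (g w))).
    by rewrite ltr_pM2r// lt_def gw0 cmod_ge0.
  by rewrite ler_pM2l// !divr_gt0.
have h2 : cmod (f z) * cmod (g w - g z) <= e / 2.
  rewrite -[leRHS](divfK (lt0r_neq0 B0)) mulrC ler_pM ?cmod_ge0 ?(ltW gw)//.
  by rewrite /B lerDl.
lra.
Qed.

Lemma ccontN f z : ccont f z -> ccont (fun w => - f w) z.
Proof.
move=> cf; apply: ccont_ext (ccontM (ccont_cst (-1) z) cf) => w.
by rewrite mulN1r.
Qed.

Lemma ccontB f g z : ccont f z -> ccont g z -> ccont (fun w => f w - g w) z.
Proof. by move=> cf /ccontN; exact: ccontD. Qed.

Lemma ccontV z : z != 0 -> ccont GRing.inv z.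
Proof.
move=> z0 e e0; have Z0 : 0 < cmod z by rewrite cmod_gt0.
exists (Num.min (cmod z / 2) (e * cmod z ^+ 2 / 2)) => [|w].
  by rewrite lt_min !divr_gt0 ?mulr_gt0 ?exprn_gt0.
rewrite lt_min => /andP[w1 w2].
have wz : cmod z / 2 < cmod w.
  by have := cmodD (z - w) w; rewrite subrK cmodBC; lra.
have W0 : 0 < cmod w by lra.
have w0 : w != 0 by rewrite -cmod_gt0.
have -> : w^-1 - z^-1 = (z - w) / (w * z) by field; rewrite w0 z0.
rewrite cmodM cmodV cmodM ltr_pdivrMr ?mulr_gt0// cmodBC.
apply: (lt_le_trans w2); rewrite expr2 -!mulrA ler_pM2l//.
rewrite mulrCA [leRHS]mulrC ler_pM2l//; lra.
Qed.

Lemma ccont_inv f z : ccont f z -> f z != 0 -> ccont (fun w => (f w)^-1) z.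
Proof. by move=> cf fz; apply: (ccont_comp cf); exact: ccontV. Qed.

Lemma ccontX f z k : ccont f z -> ccont (fun w => f w ^+ k) z.
Proof.
move=> cf; elim: k => [|k IH].
  by apply: ccont_ext (ccont_cst 1 z) => w; rewrite expr0.
by apply: ccont_ext (ccontM cf IH) => w; rewrite exprS.
Qed.

Lemma ccont_sum (I : Type) (s : seq I) (Q : pred I) (F : I -> R[i] -> R[i]) z :
  (forall i, Q i -> ccont (F i) z) ->
  ccont (fun w => \sum_(i <- s | Q i) F i w) z.
Proof.
move=> cF; elim: s => [|i s IH].
  by apply: ccont_ext (ccont_cst 0 z) => w; rewrite big_nil.
case: (boolP (Q i)) => Qi.
  by apply: ccont_ext (ccontD (cF _ Qi) IH) => w; rewrite big_cons Qi.
by apply: ccont_ext IH => w; rewrite big_cons (negbTE Qi).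
Qed.

Lemma ccont_prod (I : Type) (s : seq I) (Q : pred I) (F : I -> R[i] -> R[i]) z :
  (forall i, Q i -> ccont (F i) z) ->
  ccont (fun w => \prod_(i <- s | Q i) F i w) z.
Proof.
move=> cF; elim: s => [|i s IH].
  by apply: ccont_ext (ccont_cst 1 z) => w; rewrite big_nil.
case: (boolP (Q i)) => Qi.
  by apply: ccont_ext (ccontM (cF _ Qi) IH) => w; rewrite big_cons Qi.
by apply: ccont_ext IH => w; rewrite big_cons (negbTE Qi).
Qed.

Lemma ccont_det n (F : R[i] -> 'M[R[i]]_n) z :
  (forall i j, ccont (fun w => F w i j) z) -> ccont (fun w => \det (F w)) z.
Proof.
move=> cF; apply: ccont_sum => s _; apply: ccontM; first exact: ccont_cst.
by apply: ccont_prod => i _; exact: cF.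
Qed.

(** Caratheodory's form of complex differentiability: the sum, product and chain
    rules reduce to the continuity of [phi], and [phi] extends the difference
    quotient continuously to [z]. *)
Definition cdiff f z := exists2 phi, ccont phi z &
  forall w, f w - f z = phi w * (w - z).

Lemma cdiff_ccont f z : cdiff f z -> ccont f z.
Proof.
move=> [phi cphi E].
apply: ccont_ext (ccontD (ccontM cphi (ccontB (ccont_id z) (ccont_cst z z)))
  (ccont_cst (f z) z)) => w.
by rewrite -E subrK.
Qed.

Lemma cdiff_ext f g z : (forall w, f w = g w) -> cdiff f z -> cdiff g z.
Proof. by move=> /funext ->. Qed.

Lemma cdiff_cst (k : R[i]) z : cdiff (fun=> k) z.
Proof.
by exists (fun=> 0) => [|w]; [exact: ccont_cst|rewrite subrr mul0r].
Qed.

Lemma cdiff_id z : cdiff id z.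
Proof. by exists (fun=> 1) => [|w]; [exact: ccont_cst|rewrite mul1r]. Qed.

Lemma cdiffD f g z : cdiff f z -> cdiff g z -> cdiff (fun w => f w + g w) z.
Proof.
move=> [F cF EF] [G cG EG]; exists (fun w => F w + G w); first exact: ccontD.
by move=> w; rewrite mulrDl -EF -EG; ring.
Qed.

Lemma cdiffM f g z : cdiff f z -> cdiff g z -> cdiff (fun w => f w * g w) z.
Proof.
move=> df dg; have cg := cdiff_ccont dg; case: df dg => [F cF EF] [G cG EG].
exists (fun w => F w * g w + f z * G w).
  by apply: ccontD; apply: ccontM => //; exact: ccont_cst.
by move=> w; rewrite mulrDl mulrAC -EF -mulrA -EG; ring.
Qed.

Lemma cdiff_comp f g z : cdiff g z -> cdiff f (g z) -> cdiff (f \o g) z.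
Proof.
move=> dg [F cF EF]; have cg := cdiff_ccont dg; case: dg => [G cG EG].
exists (fun w => F (g w) * G w).
  by apply: ccontM => //; exact: (ccont_comp cg).
by move=> w /=; rewrite EF EG mulrA.
Qed.

Lemma cdiffV z : z != 0 -> cdiff GRing.inv z.
Proof.
move=> z0; exists (fun w => if w == 0 then z^-1 ^+ 2 else - (w * z)^-1).
  apply: (@ccont_local (fun w => - (w * z)^-1) _ _ (cmod z)).
  - by rewrite cmod_gt0.
  - by move=> w; case: eqP => // ->; rewrite sub0r cmodN ltxx.
  - apply: ccontN; apply: ccont_inv; last by rewrite mulf_neq0.
    by apply: ccontM; [exact: ccont_id|exact: ccont_cst].
move=> w; case: eqP => [->|/eqP w0]; first by rewrite invr0; field.
by field; rewrite w0 z0.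
Qed.

Lemma cdiff_inv f z : cdiff f z -> f z != 0 -> cdiff (fun w => (f w)^-1) z.
Proof. by move=> cf fz; apply: (cdiff_comp cf); exact: cdiffV. Qed.

Lemma cdiffN f z : cdiff f z -> cdiff (fun w => - f w) z.
Proof.
move=> cf; apply: cdiff_ext (cdiffM (cdiff_cst (-1) z) cf) => w.
by rewrite mulN1r.
Qed.

Lemma cdiffB f g z : cdiff f z -> cdiff g z -> cdiff (fun w => f w - g w) z.
Proof. by move=> cf /cdiffN; exact: cdiffD. Qed.

Lemma cdiffX f z k : cdiff f z -> cdiff (fun w => f w ^+ k) z.
Proof.
move=> cf; elim: k => [|k IH].
  by apply: cdiff_ext (cdiff_cst 1 z) => w; rewrite expr0.
by apply: cdiff_ext (cdiffM cf IH) => w; rewrite exprS.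
Qed.

Lemma cdiffXz f z (k : int) : cdiff f z -> f z != 0 ->
  cdiff (fun w => f w ^ k) z.
Proof.
move=> cf fz; case: k => k; first exact: cdiffX.
by apply: cdiff_inv; [exact: cdiffX|rewrite expf_neq0].
Qed.

Lemma cdiff_sum (I : Type) (s : seq I) (Q : pred I) (F : I -> R[i] -> R[i]) z :
  (forall i, Q i -> cdiff (F i) z) ->
  cdiff (fun w => \sum_(i <- s | Q i) F i w) z.
Proof.
move=> cF; elim: s => [|i s IH].
  by apply: cdiff_ext (cdiff_cst 0 z) => w; rewrite big_nil.
case: (boolP (Q i)) => Qi.
  by apply: cdiff_ext (cdiffD (cF _ Qi) IH) => w; rewrite big_cons Qi.
by apply: cdiff_ext IH => w; rewrite big_cons (negbTE Qi).
Qed.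

Lemma cdiff_prod (I : Type) (s : seq I) (Q : pred I) (F : I -> R[i] -> R[i]) z :
  (forall i, Q i -> cdiff (F i) z) ->
  cdiff (fun w => \prod_(i <- s | Q i) F i w) z.
Proof.
move=> cF; elim: s => [|i s IH].
  by apply: cdiff_ext (cdiff_cst 1 z) => w; rewrite big_nil.
case: (boolP (Q i)) => Qi.
  by apply: cdiff_ext (cdiffM (cF _ Qi) IH) => w; rewrite big_cons Qi.
by apply: cdiff_ext IH => w; rewrite big_cons (negbTE Qi).
Qed.

(** With [d] the derivative, this is the difference quotient with its removable
    singularity removed. *)
Definition slope f z (d : R[i]) w := if w == z then d else (f w - f z) / (w - z).

Lemma slopeE f z d w : f w - f z = slope f z d w * (w - z).
Proof.
rewrite /slope; case: eqP => [->|/eqP wz]; first by rewrite !subrr mulr0.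
by rewrite mulfVK// subr_eq0.
Qed.

Lemma cdiff_slope f z : cdiff f z -> exists d, ccont (slope f z d) z.
Proof.
move=> [phi cphi E]; exists (phi z); apply: ccont_ext cphi => w.
rewrite /slope; case: eqP => [->//|/eqP wz].
by rewrite E mulfK// subr_eq0.
Qed.

(** A quadratic bound with a uniform constant is the form in which
    differentiability survives the passage from partial products to their limit. *)
Lemma cdiff_quadratic f z d (C r : R) : 0 < r ->
  (forall w, cmod (w - z) < r ->
     cmod (f w - f z - d * (w - z)) <= C * cmod (w - z) ^+ 2) ->
  cdiff f z.
Proof.
move=> r0 H; exists (slope f z d); last by move=> w; exact: slopeE.
move=> e e0; pose B := `|C| + 1.
have B0 : 0 < B by rewrite ltr_wpDl.
exists (Num.min r (e / B)) => [|w]; first by rewrite lt_min r0 divr_gt0.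
rewrite lt_min => /andP[wr wB]; have -> : slope f z d z = d by rewrite /slope eqxx.
rewrite /slope; case: eqP => [_|/eqP wz]; first by rewrite subrr cmod0.
have w0 : 0 < cmod (w - z) by rewrite cmod_gt0 subr_eq0.
have wz0 : w - z != 0 by rewrite subr_eq0.
have -> : (f w - f z) / (w - z) - d = (f w - f z - d * (w - z)) / (w - z).
  by field.
rewrite cmodM cmodV ltr_pdivrMr//; apply: (le_lt_trans (H _ wr)).
rewrite expr2 mulrA ltr_pM2r//.
apply: (@le_lt_trans _ _ (`|C| * cmod (w - z))).
  by rewrite ler_pM2r// ler_norm.
move: wB; rewrite ltr_pdivlMr// mulrC; apply: le_lt_trans.
by rewrite ler_pM2r// /B lerDl.
Qed.
End ContinuityAndDifferentiability.

(** * Integrals of complex-valued functions on an interval *)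

Section ComplexIntegral.
Variable R : realType.
Implicit Types (h g : R -> R[i]) (a b c : R).
Local Notation mu := (@lebesgue_measure R).

Definition rcont h := forall t (e : R), 0 < e -> exists2 d : R, 0 < d &
  forall u, `|u - t| < d -> cmod (h u - h t) < e.

Lemma rcont_ccont (F : R[i] -> R[i]) :
  (forall t : R, ccont F t%:C) -> rcont (fun t => F t%:C).
Proof.
move=> cF t e e0; have [d d0 Fd] := cF t e e0; exists d => // u ut.
by apply: Fd; rewrite -rmorphB cmodr.
Qed.

Lemma rcont_Re h : rcont h -> continuous (fun t => complex.Re (h t) : R).
Proof.
move=> ch t; apply/cvgrPdist_lt => e e0; have [d d0 hd] := ch t e e0.
near=> u; rewrite -ReB (le_lt_trans (abs_Re_le _))// cmodBC; apply: hd.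
near: u; exists d => //= u /=; by rewrite distrC.
Unshelve. all: by end_near. Qed.

Lemma rcont_Im h : rcont h -> continuous (fun t => complex.Im (h t) : R).
Proof.
move=> ch t; apply/cvgrPdist_lt => e e0; have [d d0 hd] := ch t e e0.
near=> u; rewrite -ImB (le_lt_trans (abs_Im_le _))// cmodBC; apply: hd.
near: u; exists d => //= u /=; by rewrite distrC.
Unshelve. all: by end_near. Qed.

Lemma rcont_cmod h : rcont h -> continuous (fun t => cmod (h t)).
Proof.
move=> ch t; apply/cvgrPdist_lt => e e0; have [d d0 hd] := ch t e e0.
near=> u; apply: (@le_lt_trans _ _ (cmod (h u - h t))).
  have := cmodD (h t - h u) (h u); have := cmodD (h u - h t) (h t).
  by rewrite !subrK [cmod (h t - h u)]cmodBC ler_norml; lra.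
apply: hd; near: u; exists d => //= u /=; by rewrite distrC.
Unshelve. all: by end_near. Qed.

Lemma rcontD h g : rcont h -> rcont g -> rcont (fun t => h t + g t).
Proof.
move=> ch cg t e e0; have e20 : 0 < e / 2 by rewrite divr_gt0.
have [d d0 hd] := ch t _ e20; have [c c0 gc] := cg t _ e20.
exists (Num.min d c) => [|u]; first by rewrite lt_min d0.
rewrite lt_min => /andP[/hd hu /gc gu].
rewrite opprD addrACA (le_lt_trans (cmodD _ _))//; lra.
Qed.

Lemma rcontZ (k : R[i]) h : rcont h -> rcont (fun t => k * h t).
Proof.
move=> ch t e e0; have k0 : 0 < cmod k + 1 by rewrite ltr_wpDl ?cmod_ge0.
have [d d0 hd] := ch t (e / (cmod k + 1)) (divr_gt0 e0 k0).
exists d => // u /hd; rewrite -mulrBr cmodM ltr_pdivlMr// mulrC.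
by apply: le_lt_trans; rewrite ler_wpM2r ?cmod_ge0// lerDl.
Qed.

Lemma rcont_cst (k : R[i]) : rcont (fun=> k).
Proof. by move=> t e e0; exists 1 => // u _; rewrite subrr cmod0. Qed.

Lemma rcontB h g : rcont h -> rcont g -> rcont (fun t => h t - g t).
Proof.
move=> ch cg; rewrite (_ : (fun t => _) = (fun t => h t + (-1) * g t)).
  by apply: rcontD => //; exact: rcontZ.
by apply/funext => t; rewrite mulN1r.
Qed.

Definition cint a b h : R[i] :=
  (\int[mu]_(t in `[a, b]) (complex.Re (h t) : R))
    +i* (\int[mu]_(t in `[a, b]) (complex.Im (h t) : R)).

Lemma continuous_itv_integrable (f : R -> R) a b : continuous f ->
  mu.-integrable `[a, b] (EFin \o f).
Proof.
move=> cf; apply: continuous_compact_integrable; first exact: segment_compact.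
by apply: continuous_subspaceT => x; exact: cf.
Qed.

Lemma Rintegral_cat (f : R -> R) a b c : continuous f -> a <= b -> b <= c ->
  \int[mu]_(t in `[a, c]) f t =
  \int[mu]_(t in `[a, b]) f t + \int[mu]_(t in `[b, c]) f t.
Proof.
move=> cf ab bc; apply/eqP; rewrite addrC -subr_eq; apply/eqP.
rewrite Rintegral_itvB ?bnd_simp//; last exact: continuous_itv_integrable.
rewrite Rintegral_itv_obnd_cbnd//.
by apply: integrableS (continuous_itv_integrable b c cf) => //; exact: subset_itv_oc_cc.
Qed.

Lemma cint_cat h a b c : rcont h -> a <= b -> b <= c ->
  cint a c h = cint a b h + cint b c h.
Proof.
move=> ch ab bc; rewrite /cint (Rintegral_cat (rcont_Re ch) ab bc).
by rewrite (Rintegral_cat (rcont_Im ch) ab bc); simpc.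
Qed.

Lemma eq_cint h g a b : (forall t, a <= t <= b -> h t = g t) ->
  cint a b h = cint a b g.
Proof.
by move=> hg; congr (_ +i* _); apply: eq_Rintegral => t;
  rewrite inE /= in_itv /= => /hg ->.
Qed.

Lemma cintD h g a b : rcont h -> rcont g ->
  cint a b (fun t => h t + g t) = cint a b h + cint a b g.
Proof.
move=> ch cg; rewrite /cint; simpc; congr (_ +i* _).
  rewrite -RintegralD//; try apply: continuous_itv_integrable;
    [|exact: rcont_Re|exact: rcont_Re].
  by apply: eq_Rintegral => t _; rewrite ReD.
rewrite -RintegralD//; try apply: continuous_itv_integrable;
  [|exact: rcont_Im|exact: rcont_Im].
by apply: eq_Rintegral => t _; rewrite ImD.
Qed.

Lemma cintZ (k : R[i]) h a b : rcont h ->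
  cint a b (fun t => k * h t) = k * cint a b h.
Proof.
move=> ch; have iR := continuous_itv_integrable a b (rcont_Re ch).
have iI := continuous_itv_integrable a b (rcont_Im ch).
rewrite /cint; case: k => k l; simpc.
have cZ (f : R -> R) (m : R) : continuous f -> continuous (fun t => m * f t).
  by move=> cf t; apply: cvgM; [exact: cvg_cst|exact: cf].
have iZ (f : R -> R) (m : R) : continuous f ->
    mu.-integrable `[a, b] (EFin \o (fun t => m * f t)).
  by move=> cf; apply: continuous_itv_integrable; exact: cZ.
congr (_ +i* _).
  rewrite -(RintegralZl _ _ iR)// -(RintegralZl _ _ iI)//.
  rewrite -RintegralB//; try (by apply: iZ; exact: rcont_Re); try (by apply: iZ; exact: rcont_Im).
  by apply: eq_Rintegral => t _; case: (h t).
rewrite -(RintegralZl _ _ iR)// -(RintegralZl _ _ iI)//.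
rewrite -RintegralD//; try (by apply: iZ; exact: rcont_Re); try (by apply: iZ; exact: rcont_Im).
by apply: eq_Rintegral => t _; case: (h t) => x y /=; rewrite addrC.
Qed.

Lemma cintB h g a b : rcont h -> rcont g ->
  cint a b (fun t => h t - g t) = cint a b h - cint a b g.
Proof.
move=> ch cg; rewrite -[- cint a b g]mulN1r -cintZ// -cintD//; last exact: rcontZ.
by apply: eq_cint => t _; rewrite mulN1r.
Qed.

Lemma Rintegral_cst_itv (k a b : R) : a <= b ->
  \int[mu]_(t in `[a, b]) k = k * (b - a).
Proof.
move=> ab; rewrite Rintegral_cst//= lebesgue_measure_itv /= lte_fin.
by case: ltrgtP ab => // -> _; rewrite ?subrr.
Qed.

Lemma cint_cst (k : R[i]) a b : a <= b -> cint a b (fun=> k) = k * (b - a)%:C.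
Proof.
move=> ab; rewrite /cint !Rintegral_cst_itv//.
by case: k => k l; simpc.
Qed.

Lemma Rintegral_abs_le (f : R -> R) a b M : continuous f -> a <= b ->
  (forall t, a <= t <= b -> `|f t| <= M) ->
  `|\int[mu]_(t in `[a, b]) f t| <= M * (b - a).
Proof.
move=> cf ab fM; have i1 := continuous_itv_integrable a b cf.
have cn : continuous (fun t => `|f t|).
  by move=> t; apply: cvg_norm; exact: cf.
have i2 := continuous_itv_integrable a b cn.
have i3 : mu.-integrable `[a, b] (EFin \o (fun=> M)).
  by apply: (@continuous_itv_integrable (fun=> M)) => t; exact: cvg_cst.
rewrite (le_trans (le_normr_Rintegral _ i1))// -Rintegral_cst_itv//.
by apply: le_Rintegral => // t; rewrite /= in_itv => /fM.
Qed.

(** The factor [2] pays for bounding the real and imaginary parts separately. *)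
Lemma cint_bound h a b M : rcont h -> a <= b ->
  (forall t, a <= t <= b -> cmod (h t) <= M) ->
  cmod (cint a b h) <= 2 * M * (b - a).
Proof.
move=> ch ab hM; rewrite (le_trans (cmod_le_ReIm _))//=.
have h1 : `|\int[mu]_(t in `[a, b]) (complex.Re (h t) : R)| <= M * (b - a).
  apply: Rintegral_abs_le => // [|t /hM]; first exact: rcont_Re.
  exact/le_trans/abs_Re_le.
have h2 : `|\int[mu]_(t in `[a, b]) (complex.Im (h t) : R)| <= M * (b - a).
  apply: Rintegral_abs_le => // [|t /hM]; first exact: rcont_Im.
  exact/le_trans/abs_Im_le.
lra.
Qed.
End ComplexIntegral.

(** * Goursat's theorem for parallelograms *)

Section Goursat.
Variable R : realType.

Lemma nested_intervals (a l : nat -> R) :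
  (forall n, a n <= a n.+1) -> (forall n, a n.+1 + l n.+1 <= a n + l n) ->
  (forall n, 0 <= l n) -> exists s, forall n, a n <= s <= a n + l n.
Proof.
move=> a_nd al_ni l0.
have aD n k : a n <= a (n + k)%N.
  by elim: k => [|k IH]; rewrite ?addn0// addnS (le_trans IH).
have alD n k : a (n + k)%N + l (n + k)%N <= a n + l n.
  by elim: k => [|k IH]; rewrite ?addn0// addnS (le_trans _ IH).
have aub n m : a m <= a n + l n.
  have [nm|mn] := leqP n m.
    rewrite -(subnKC nm); apply: le_trans (alD n (m - n)%N).
    by rewrite lerDl.
  rewrite -(subnKC (ltnW mn)); apply: (le_trans (aD m (n - m)%N)).
  by rewrite lerDl.
pose S := [set a n | n in setT].
have S0 : S !=set0 by exists (a 0%N); exists 0%N.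
have Sub n : ubound S (a n + l n) by move=> _ [m _ <-].
exists (sup S) => n; apply/andP; split; last exact: ge_sup.
by apply: ub_le_sup; [exists (a 0%N + l 0%N); exact: Sub|exists n].
Qed.

Section Bisection.
Variables (G : R -> R -> R -> R -> R[i]) (a0 c0 w v : R).
Hypothesis G_splitl : forall a m b c d, a <= m -> m <= b ->
  G a b c d = G a m c d + G m b c d.
Hypothesis G_splitr : forall a b c m d, c <= m -> m <= d ->
  G a b c d = G a b c m + G a b m d.
Hypotheses (w0 : 0 <= w) (v0 : 0 <= v).

Let W n := w / 2 ^+ n.
Let V n := v / 2 ^+ n.
Let cell n (x : R * R) := cmod (G x.1 (x.1 + W n) x.2 (x.2 + V n)).
Let E := cell 0 (a0, c0).

Let W0 n : 0 <= W n. Proof. by rewrite divr_ge0 ?exprn_ge0. Qed.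
Let V0 n : 0 <= V n. Proof. by rewrite divr_ge0 ?exprn_ge0. Qed.
Let WS n : W n = W n.+1 + W n.+1.
Proof. by rewrite /W exprS; field. Qed.
Let VS n : V n = V n.+1 + V n.+1.
Proof. by rewrite /V exprS; field. Qed.

(* the lower left corner of a quarter that keeps a fourth of the modulus *)
Let next n (x : R * R) : R * R :=
  let big y := E / 4 ^+ n.+1 <= cell n.+1 y in
  if big (x.1, x.2) then (x.1, x.2)
  else if big (x.1 + W n.+1, x.2) then (x.1 + W n.+1, x.2)
  else if big (x.1, x.2 + V n.+1) then (x.1, x.2 + V n.+1)
  else (x.1 + W n.+1, x.2 + V n.+1).

Let x := fix x n := if n is m.+1 then next m (x m) else (a0, c0).

Let x_big n : E / 4 ^+ n <= cell n (x n).
Proof.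
elim: n => [|n IH]; first by rewrite expr0 divr1.
rewrite -[x n.+1]/(next n (x n)) /next.
case: ifPn => // /negP b1; case: ifPn => // /negP b2.
case: ifPn => // /negP b3; apply: contrapT => /negP b4.
move: IH b1 b2 b3 b4 => + /negP + /negP + /negP.
rewrite -!ltNge /cell /=; set a := (x n).1; set c := (x n).2.
have := W0 n.+1; have := V0 n.+1 => ? ?.
rewrite (@G_splitl a (a + W n.+1) (a + W n)); [|lra|rewrite (WS n); lra].
rewrite (@G_splitr a _ c (c + V n.+1) (c + V n)); [|lra|rewrite (VS n); lra].
rewrite (@G_splitr _ _ c (c + V n.+1) (c + V n)); [|lra|rewrite (VS n); lra].
rewrite (WS n) (VS n) [a + (_ + _)]addrA [c + (_ + _)]addrA.
have -> : E / 4 ^+ n = 4 * (E / 4 ^+ n.+1) by rewrite exprS; field.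
set e1 := G a (a + W n.+1) c (c + V n.+1).
set e3 := G a _ (c + V n.+1) _; set e2 := G _ _ c _; set e4 := G _ _ _ _.
have := cmodD (e1 + e3) (e2 + e4); have := cmodD e1 e3; have := cmodD e2 e4.
by move=> ? ? ? ? ? ? ? ?; lra.
Qed.

Let x1 n : (x n).1 <= (x n.+1).1 /\ (x n.+1).1 + W n.+1 <= (x n).1 + W n.
Proof.
have := W0 n.+1; rewrite (WS n) -[x n.+1]/(next n (x n)) /next => ?.
by do 3?[case: ifP => _ /=]; split; lra.
Qed.

Let x2 n : (x n).2 <= (x n.+1).2 /\ (x n.+1).2 + V n.+1 <= (x n).2 + V n.
Proof.
have := V0 n.+1; rewrite (VS n) -[x n.+1]/(next n (x n)) /next => ?.
by do 3?[case: ifP => _ /=]; split; lra.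
Qed.

(** A rectangle function that is additive under subdivision keeps, up to the
    factor [4 ^+ n] of the area, its modulus on some shrinking sequence of
    quarters. *)
Lemma quadrisection : exists s t : R,
  [/\ a0 <= s <= a0 + w, c0 <= t <= c0 + v & forall n, exists a c : R,
    [/\ a <= s <= a + w / 2 ^+ n, c <= t <= c + v / 2 ^+ n &
      cmod (G a0 (a0 + w) c0 (c0 + v)) / 4 ^+ n <=
      cmod (G a (a + w / 2 ^+ n) c (c + v / 2 ^+ n))]].
Proof.
have [s Hs] := nested_intervals (fun n => (x1 n).1) (fun n => (x1 n).2) W0.
have [t Ht] := nested_intervals (fun n => (x2 n).1) (fun n => (x2 n).2) V0.
exists s, t; split.
- by have := Hs 0%N; rewrite /W expr0 divr1.
- by have := Ht 0%N; rewrite /V expr0 divr1.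
- move=> n; exists (x n).1, (x n).2; split; [exact: Hs|exact: Ht|].
  by have := x_big n; rewrite /E /cell /= /W /V expr0 !divr1.
Qed.
End Bisection.

Variables (al be : R[i]) (F : R[i] -> R[i]).
Hypothesis cF : forall z, ccont F z.

(** The parallelogram with sides along [al] and [be] is the image of a rectangle,
    so that subdivision takes place on real intervals. *)
Definition grid (s t : R) : R[i] := s%:C * al + t%:C * be.

Lemma rcont_gridl (t : R) : rcont (fun s => F (grid s t)).
Proof.
apply: (@rcont_ccont _ (fun s => F (s * al + t%:C * be))) => s.
apply: (@ccont_comp _ F (fun s => s * al + t%:C * be)); last exact: cF.
by apply: ccontD; [apply: ccontM; [exact: ccont_id|]|]; exact: ccont_cst.
Qed.

Lemma rcont_gridr (s : R) : rcont (fun t => F (grid s t)).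
Proof.
apply: (@rcont_ccont _ (fun t => F (s%:C * al + t * be))) => t.
apply: (@ccont_comp _ F (fun t => s%:C * al + t * be)); last exact: cF.
by apply: ccontD; [|apply: ccontM; [exact: ccont_id|]]; exact: ccont_cst.
Qed.
Hint Resolve rcont_gridl rcont_gridr : core.

(** The integral of [F] along the boundary of the parallelogram, counterclockwise
    when [(al, be)] is positively oriented. *)
Definition edge (a b c d : R) : R[i] :=
  al * cint a b (fun s => F (grid s c) - F (grid s d)) +
  be * cint c d (fun t => F (grid b t) - F (grid a t)).

Lemma edge_splitl a m b c d : a <= m -> m <= b ->
  edge a b c d = edge a m c d + edge m b c d.
Proof.
move=> am mb; rewrite /edge (cint_cat _ am mb); last exact: rcontB.
have -> : cint c d (fun t => F (grid b t) - F (grid a t)) =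
    cint c d (fun t => F (grid m t) - F (grid a t)) +
    cint c d (fun t => F (grid b t) - F (grid m t)).
  rewrite -cintD; try exact: rcontB.
  by apply: eq_cint => t _; rewrite [RHS]addrC subrKA.
by rewrite !mulrDr addrACA.
Qed.

Lemma edge_splitr a b c m d : c <= m -> m <= d ->
  edge a b c d = edge a b c m + edge a b m d.
Proof.
move=> cm md; rewrite /edge (cint_cat _ cm md); last exact: rcontB.
have -> : cint a b (fun s => F (grid s c) - F (grid s d)) =
    cint a b (fun s => F (grid s c) - F (grid s m)) +
    cint a b (fun s => F (grid s m) - F (grid s d)).
  rewrite -cintD; try exact: rcontB.
  by apply: eq_cint => s _; rewrite subrKA.
by rewrite !mulrDr addrACA.
Qed.

(** The boundary integral of an affine function vanishes, so only the
    deviation from it counts. *)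
Lemma edge_bound a b c d (K D : R[i]) (M : R) : a <= b -> c <= d ->
  (forall s t, a <= s <= b -> c <= t <= d ->
    cmod (F (grid s t) - (K + D * grid s t)) <= M) ->
  cmod (edge a b c d) <= 4 * M * (cmod al * (b - a) + cmod be * (d - c)).
Proof.
move=> ab cd H.
have Hl h (k : R[i]) (x y : R) : x <= y -> rcont h ->
    (forall u, x <= u <= y -> cmod (h u - k) <= 2 * M) ->
    cmod (cint x y h - k * (y - x)%:C) <= 4 * M * (y - x).
  move=> xy ch hk; rewrite -cint_cst// -cintB//; last exact: rcont_cst.
  apply: le_trans (cint_bound _ xy hk) _; last lra.
  by apply: rcontB => //; exact: rcont_cst.
have h1 := Hl (fun s => F (grid s c) - F (grid s d)) (D * (c - d)%:C * be) a b ab.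
have h2 := Hl (fun t => F (grid b t) - F (grid a t)) (D * (b - a)%:C * al) c d cd.
have -> : edge a b c d =
  al * (cint a b (fun s => F (grid s c) - F (grid s d))
        - D * (c - d)%:C * be * (b - a)%:C) +
  be * (cint c d (fun t => F (grid b t) - F (grid a t))
        - D * (b - a)%:C * al * (d - c)%:C).
  by rewrite /edge !rmorphB; ring.
have Hd u v : cmod u <= M -> cmod v <= M -> cmod (u - v) <= 2 * M.
  by move=> uM vM; apply: le_trans (cmodB _ _) _; lra.
have {}h1 := h1 ltac:(exact: rcontB).
have {}h2 := h2 ltac:(exact: rcontB).
have aa : a <= a <= b by rewrite lexx.
have bb : a <= b <= b by rewrite lexx ab.
have cc : c <= c <= d by rewrite lexx.
have dd : c <= d <= d by rewrite lexx cd.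
apply: le_trans (cmodD _ _) _; rewrite !cmodM mulrDr.
rewrite ![4 * M * (cmod _ * _)]mulrCA lerD// ler_wpM2l ?cmod_ge0//.
  apply: h1 => s sab; have := Hd _ _ (H s c sab cc) (H s d sab dd).
  by congr (cmod _ <= _); rewrite /grid rmorphB; ring.
apply: h2 => t tcd; have := Hd _ _ (H b t bb tcd) (H a t aa tcd).
by congr (cmod _ <= _); rewrite /grid rmorphB; ring.
Qed.

Lemma goursat_corner (a0 c0 w v : R) : 0 <= w -> 0 <= v ->
  (forall s t, a0 <= s <= a0 + w -> c0 <= t <= c0 + v -> cdiff F (grid s t)) ->
  edge a0 (a0 + w) c0 (c0 + v) = 0.
Proof.
move=> w0 v0 dF; apply/eqP; rewrite -cmod_eq0; apply/negP => /negP E0.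
have [s [t [Hs Ht H]]] :=
  @quadrisection edge a0 c0 w v edge_splitl edge_splitr w0 v0.
move: E0 H; set E := cmod (edge _ _ _ _) => E0 H.
have {}E0 : 0 < E by rewrite lt_def E0 cmod_ge0.
pose W n := w / 2 ^+ n; pose V n := v / 2 ^+ n.
have W0 n : 0 <= W n by rewrite divr_ge0 ?exprn_ge0.
have V0 n : 0 <= V n by rewrite divr_ge0 ?exprn_ge0.
have [phi cphi Ephi] : cdiff F (grid s t) by exact: dF.
pose kap := cmod al * w + cmod be * v.
have kap0 : 0 <= kap by rewrite addr_ge0// mulr_ge0 ?cmod_ge0.
pose e := E / (4 * kap ^+ 2 + 1).
have den0 : 0 < 4 * kap ^+ 2 + 1 by rewrite ltr_wpDl// mulr_ge0// exprn_ge0.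
have e0 : 0 < e by rewrite divr_gt0.
have [d d0 Hd] := cphi e e0.
have [n Hn] : exists n, kap / 2 ^+ n < d.
  have [n Hn] : exists n : nat, kap / d < n%:R.
    by exists (Num.bound (kap / d)); exact: (archi_boundP (divr_ge0 kap0 (ltW d0))).
  exists n; rewrite ltr_pdivrMr ?exprn_gt0// mulrC -ltr_pdivrMr//.
  by rewrite (lt_trans Hn)// -natrX ltr_nat ltn_expl.
have [a [c [an cn big_n]]] := H n.
rewrite -/(W n) in an big_n; rewrite -/(V n) in cn big_n.
pose u0 := grid s t.
have close s' t' : a <= s' <= a + W n -> c <= t' <= c + V n ->
    cmod (grid s' t' - u0) <= kap / 2 ^+ n.
  move=> as' ct'.
  have -> : grid s' t' - u0 = (s' - s)%:C * al + (t' - t)%:C * be.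
    by rewrite /u0 /grid !rmorphB; ring.
  apply: le_trans (cmodD _ _) _; rewrite !cmodM !cmodr /kap mulrDl.
  rewrite -!mulrA -/(W n) -/(V n) lerD// mulrC ler_wpM2l ?cmod_ge0// ler_norml.
    by move: an as'; lra.
  by move: cn ct'; lra.
have := @edge_bound a (a + W n) c (c + V n) (F u0 - phi u0 * u0) (phi u0)
  (e * (kap / 2 ^+ n)).
rewrite !lerDl W0 V0 => /(_ isT isT) small.
have {}small : cmod (edge a (a + W n) c (c + V n)) <= 4 * e * kap ^+ 2 / 4 ^+ n.
  apply: (@le_trans _ _ (4 * (e * (kap / 2 ^+ n)) *
      (cmod al * (a + W n - a) + cmod be * (c + V n - c)))).
    apply: small => s' t' as' ct'; have cl := close _ _ as' ct'.
    have -> : F (grid s' t') - (F u0 - phi u0 * u0 + phi u0 * grid s' t') =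
      (phi (grid s' t') - phi u0) * (grid s' t' - u0).
      by rewrite mulrBl -Ephi -/u0; ring.
    rewrite cmodM ler_pM ?cmod_ge0//; apply/ltW/Hd.
    by rewrite (le_lt_trans cl).
  rewrite (_ : 4 = 2 ^+ 2 :> R); last by rewrite expr2; lra.
  rewrite exprAC (_ : _ * _ = 2 ^+ 2 * e * kap ^+ 2 / (2 ^+ n) ^+ 2)//.
  by rewrite /kap /W /V; field.
have := le_trans big_n small.
rewrite ler_pM2r ?invr_gt0 ?exprn_gt0// leNgt => /negP; apply.
rewrite /e -[ltRHS](divfK (lt0r_neq0 den0)).
have -> : 4 * (E / (4 * kap ^+ 2 + 1)) * kap ^+ 2 =
  E / (4 * kap ^+ 2 + 1) * (4 * kap ^+ 2) by ring.
by rewrite ltr_pM2l ?divr_gt0//; lra.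
Qed.


(** Goursat: complex differentiability, without continuity of the
    derivative, makes boundary integrals vanish; a boundary integral that does
    not vanish would survive infinitely many quadrisections. *)
Lemma goursat a b c d : a <= b -> c <= d ->
  (forall s t, a <= s <= b -> c <= t <= d -> cdiff F (grid s t)) ->
  edge a b c d = 0.
Proof.
move=> ab cd dF; have := @goursat_corner a c (b - a) (d - c).
by rewrite !subr_ge0 !subrKC; exact.
Qed.
End Goursat.

(** * The complex exponential *)

Section ComplexExponential.
Variable R : realType.
Implicit Types (z w : R[i]).

Lemma is_derive0_increment (f : R -> R) (l : R) : is_derive (0 : R) (1 : R) f l ->
  forall e : R, 0 < e -> exists2 d : R, 0 < d &
    forall h, `|h| < d -> `|f h - f 0 - l * h| <= e * `|h|.
Proof.
move=> [df dfE] e e0.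
have := df; rewrite /derivable => /cvg_ex[l' Hl'].
have ll' : l = l' by rewrite -dfE; apply: cvg_lim.
move: Hl'; rewrite -ll' => /cvgrPdist_lt /(_ e e0).
rewrite /nbhs /= /dnbhs /within /= => -[d d0 Hd]; exists d => // h hd.
have [->|h0] := eqVneq h 0; first by rewrite mulr0 subr0 subrr normr0 mulr0.
have := Hd h; rewrite /= sub0r normrN => /(_ hd h0) /=.
rewrite addr0 /GRing.scale /= mulr1 => /ltW.
have -> : l - h^-1 * (f h - f 0) = - (f h - f 0 - l * h) / h by field.
by rewrite normrM normfV normrN ler_pdivrMr ?normr_gt0.
Qed.

(* The lock prevents unification from taking the exponential for a product. *)
Fact cexp_key : unit. Proof. exact: tt. Qed.
Definition cexp : R[i] -> R[i] := locked_with cexp_key (fun z =>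
  (expR (complex.Re z))%:C * (cos (complex.Im z) +i* sin (complex.Im z))).

Lemma cexpE z : cexp z =
  (expR (complex.Re z))%:C * (cos (complex.Im z) +i* sin (complex.Im z)).
Proof. by rewrite /cexp unlock. Qed.

Lemma cexp0 : cexp 0 = 1.
Proof. by rewrite !cexpE /= expR0 cos0 sin0 mul1r. Qed.

Lemma cexpD z w : cexp (z + w) = cexp z * cexp w.
Proof.
rewrite !cexpE ReD ImD expRD rmorphM /= cosD sinD mulrACA; congr (_ * _).
by simpc; congr (_ +i* _); rewrite addrC.
Qed.

Lemma cexp_neq0 z : cexp z != 0.
Proof.
apply/negP => /eqP E; have := cexpD z (- z).
rewrite subrr cexp0 E mul0r => /eqP; by rewrite oner_eq0.
Qed.

Lemma cmod_cis (t : R) : cmod (cos t +i* sin t) = 1.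
Proof. by rewrite /cmod /= cos2Dsin2 sqrtr1. Qed.

Lemma cmod_cexp z : cmod (cexp z) = expR (complex.Re z).
Proof. by rewrite cexpE cmodM cmodr cmod_cis mulr1 gtr0_norm// expR_gt0. Qed.

(** Polar coordinates: the angle is [acos] of the real part of [z / cmod z], up to
    the sign that the imaginary part prescribes. *)
Lemma cexp_surj z : z != 0 -> exists w, cexp w = z.
Proof.
move=> z0; have r0 : 0 < cmod z by rewrite cmod_gt0.
have [x xE] := expR_total r0.
pose u := z / (cmod z)%:C.
have rC : (cmod z)%:C != 0 :> R[i] by rewrite -cmod_gt0 cmodr normr_gt0 lt0r_neq0.
have u1 : (complex.Re u) ^+ 2 + (complex.Im u) ^+ 2 = 1.
  have : cmod u = 1.
    by rewrite cmodM cmodV cmodr gtr0_norm// divff// lt0r_neq0.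
  case: (u) => a b; rewrite /cmod /= => h.
  have : Num.sqrt (a ^+ 2 + b ^+ 2) ^+ 2 = 1 by rewrite h expr1n.
  by rewrite sqr_sqrtr// addr_ge0 ?sqr_ge0.
have Rb : -1 <= complex.Re u <= 1.
  by rewrite -ler_norml -(@ler_pXn2r _ 2)// ?nnegrE// expr1n -normrX ger0_norm
    ?sqr_ge0// -u1 lerDl sqr_ge0.
have [t [tc ts]] : exists t, cos t = complex.Re u /\ sin t = complex.Im u.
  have cK : cos (acos (complex.Re u)) = complex.Re u.
    by apply: acosK; rewrite in_itv.
  have : sin (acos (complex.Re u)) ^+ 2 = complex.Im u ^+ 2.
    by rewrite sin2cos2 cK -u1; ring.
  move=> /eqP; rewrite eqf_sqr => /orP[/eqP sE|/eqP sE].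
    by exists (acos (complex.Re u)).
  by exists (- acos (complex.Re u)); rewrite cosN sinN sE opprK.
exists (x +i* t); rewrite !cexpE /= xE tc ts.
have -> : complex.Re u +i* complex.Im u = u by case: (u).
by rewrite mulrC divfK.
Qed.

Lemma cexp_ln (r : R) : 0 < r -> cexp (ln r)%:C = r%:C.
Proof. by move=> r0; rewrite !cexpE /= cos0 sin0 lnK ?posrE// mulr1. Qed.

Lemma cexp_increment0 (e : R) : 0 < e -> exists2 d : R, 0 < d &
  forall z, cmod z < d -> cmod (cexp z - 1 - z) <= e * cmod z.
Proof.
move=> e0; have [e' [e'0 e'1 e'e]] : exists e' : R, [/\ 0 < e', e' <= 1 & e' * 6 <= e].
  exists (Num.min 1 (e / 6)); split; first by rewrite lt_min ltr01 divr_gt0.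
    by rewrite ge_min lexx.
  by rewrite -ler_pdivlMr// ge_min lexx orbT.
have [d1 d10 H1] := is_derive0_increment (is_derive_expR 0) e'0.
have [d2 d20 H2] := is_derive0_increment (is_derive_cos 0) e'0.
have [d3 d30 H3] := is_derive0_increment (is_derive_sin 0) e'0.
rewrite cos0 sin0 expR0 in H1 H2 H3.
exists (Num.min 1 (Num.min e' (Num.min d1 (Num.min d2 d3)))) => [|[a b] zd].
  by rewrite !lt_min ltr01 e'0 d10 d20 d30.
move: zd; rewrite !lt_min => /andP[z1 /andP[ze /and3P[zd1 zd2 zd3]]].
set m := cmod _ in z1 ze zd1 zd2 zd3 *.
have az : `|a| <= m := abs_Re_le (a +i* b).
have bz : `|b| <= m := abs_Im_le (a +i* b).
have m0 : 0 <= m := cmod_ge0 _.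
have {}H1 := H1 a (le_lt_trans az zd1).
have {}H2 := H2 b (le_lt_trans bz zd2).
have {}H3 := H3 b (le_lt_trans bz zd3).
have le_e (x : R) : `|x| <= m -> e' * `|x| <= e' * m by move=> ?; rewrite ler_wpM2l// ltW.
have {}H1 : `|expR a - 1 - 1 * a| <= e' * m by exact: le_trans H1 (le_e _ az).
have {}H2 : `|cos b - 1 - - 0 * b| <= e' * m by exact: le_trans H2 (le_e _ bz).
have {}H3 : `|sin b - 0 - 1 * b| <= e' * m by exact: le_trans H3 (le_e _ bz).
pose s : R[i] := cos b +i* sin b.
have -> : cexp (a +i* b) - 1 - (a +i* b) =
    (expR a - 1 - a)%:C * s + a%:C * (s - 1) + (s - 1 - (0 +i* b)).
  rewrite !cexpE /= -/s !rmorphB rmorph1.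
  have -> : a +i* b = a%:C + (0 +i* b) by simpc.
  by ring.
have hs : cmod (s - 1 - (0 +i* b)) <= 2 * (e' * m).
  apply: le_trans (cmod_le_ReIm _) _; rewrite /=.
  have -> : cos b - 1 - 0 = cos b - 1 - - 0 * b by ring.
  have -> : sin b - 0 - b = sin b - 0 - 1 * b by ring.
  by lra.
have hs1 : cmod (s - 1) <= 3 * e'.
  have := cmodD (s - 1 - (0 +i* b)) (0 +i* b); rewrite subrK.
  have -> : cmod (0 +i* b) = `|b| by rewrite /cmod /= expr0n add0r sqrtr_sqr.
  have h : e' * m <= e' * 1 by rewrite ler_wpM2l// ltW.
  lra.
apply: le_trans (cmodD _ _) _; apply: le_trans (lerD (cmodD _ _) (lexx _)) _.
rewrite !cmodM !cmodr cmod_cis mulr1; rewrite mul1r in H1.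
have : `|a| * cmod (s - 1) <= m * (3 * e') by rewrite ler_pM ?cmod_ge0.
have : e' * 6 * m <= e * m by rewrite ler_wpM2r.
lra.
Qed.

Lemma cexp_cdiff z : cdiff cexp z.
Proof.
exists (slope cexp z (cexp z)); last by move=> w; exact: slopeE.
move=> e e0; have Z0 : 0 < cmod (cexp z) by rewrite cmod_gt0 cexp_neq0.
have [d d0 Hd] := cexp_increment0 (divr_gt0 (divr_gt0 e0 (ltr0Sn _ 1)) Z0).
exists d => // w wd.
have -> : slope cexp z (cexp z) z = cexp z by rewrite /slope eqxx.
rewrite /slope; case: eqP => [_|/eqP wz]; first by rewrite subrr cmod0.
have w0 : 0 < cmod (w - z) by rewrite cmod_gt0 subr_eq0.
have wz0 : w - z != 0 by rewrite subr_eq0.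
have -> : (cexp w - cexp z) / (w - z) - cexp z =
  cexp z * (cexp (w - z) - 1 - (w - z)) / (w - z).
  have -> : cexp w = cexp (w - z) * cexp z by rewrite -cexpD subrK.
  by field.
rewrite cmodM cmodV (cmodM (cexp z)) ltr_pdivrMr//.
apply: (@le_lt_trans _ _ (e / 2 * cmod (w - z))); last by rewrite ltr_pM2r//; lra.
have := Hd _ wd; rewrite mulrAC ler_pdivlMr// => h.
by rewrite [X in X <= _]mulrC.
Qed.

Definition per : R[i] := 0 +i* (pi *+ 2).

Lemma cexp_per : cexp per = 1.
Proof. by rewrite !cexpE /= expR0 cos2pi sin2pi mul1r. Qed.

Lemma per_neq0 : per != 0.
Proof.
apply/eqP => -[/eqP]; rewrite mulrn_eq0 /=; apply/negP.
by rewrite lt0r_neq0// pi_gt0.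
Qed.

(** The unit circle with period [1], so that integrals over [[0, 1]] are means. *)
Definition circ (t : R) : R[i] := cexp (t%:C * per).

Lemma cmod_circ t : cmod (circ t) = 1.
Proof. by rewrite cmod_cexp /= mulr0 mul0r subr0 expR0. Qed.

Lemma circ_neq0 t : circ t != 0. Proof. exact: cexp_neq0. Qed.

End ComplexExponential.

(** * Means over circles *)

Section CircleMeans.
Variable R : realType.
Implicit Types (f g : R[i] -> R[i]) (z w : R[i]).
Local Notation per := (per R).

Lemma cdiff_local f g z (r : R) : 0 < r ->
  (forall w, cmod (w - z) < r -> f w = g w) -> cdiff f z -> cdiff g z.
Proof.
move=> r0 fg /cdiff_slope[d cd]; exists (slope g z d); last first.
  by move=> w; exact: slopeE.
apply: (ccont_local r0) cd => w wr; rewrite /slope.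
by rewrite !fg// subrr cmod0.
Qed.

Definition pcont f := forall w, w != 0 -> ccont f w.
Definition pholo f := forall w, w != 0 -> cdiff f w.

Lemma pholo_pcont f : pholo f -> pcont f.
Proof. by move=> hf w /hf /cdiff_ccont. Qed.

Lemma rcont_circ : rcont (@circ R).
Proof.
apply: (@rcont_ccont _ (fun t => cexp (t * per))) => t.
apply: (@ccont_comp _ (@cexp R) (fun t => t * per)).
  by apply: ccontM; [exact: ccont_id|exact: ccont_cst].
exact/cdiff_ccont/cexp_cdiff.
Qed.

Lemma rcont_on_circ f z : z != 0 -> pcont f -> rcont (fun t => f (z * circ t)).
Proof.
move=> z0 cf; apply: (@rcont_ccont _ (fun t => f (z * cexp (t * per)))) => t.
apply: (@ccont_comp _ f (fun t => z * cexp (t * per))); last first.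
  by apply: cf; rewrite mulf_neq0 ?cexp_neq0.
apply: ccontM; first exact: ccont_cst.
apply: (@ccont_comp _ (@cexp R) (fun t => t * per)).
  by apply: ccontM; [exact: ccont_id|exact: ccont_cst].
exact/cdiff_ccont/cexp_cdiff.
Qed.

(** The mean of [f] over the circle through [z] centred at [0]. *)
Definition mean f z : R[i] := cint 0 1 (fun t => f (z * circ t)).

Lemma eq_mean f g z : z != 0 -> (forall w, w != 0 -> f w = g w) ->
  mean f z = mean g z.
Proof.
by move=> z0 fg; apply: eq_cint => t _; rewrite fg// mulf_neq0// circ_neq0.
Qed.

Lemma meanB f g z : z != 0 -> pcont f -> pcont g ->
  mean (fun w => f w - g w) z = mean f z - mean g z.
Proof. by move=> z0 cf cg; rewrite /mean cintB//; exact: rcont_on_circ. Qed.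

Lemma meanD f g z : z != 0 -> pcont f -> pcont g ->
  mean (fun w => f w + g w) z = mean f z + mean g z.
Proof. by move=> z0 cf cg; rewrite /mean cintD//; exact: rcont_on_circ. Qed.

Lemma meanZ (k : R[i]) f z : z != 0 -> pcont f ->
  mean (fun w => k * f w) z = k * mean f z.
Proof. by move=> z0 cf; rewrite /mean cintZ//; exact: rcont_on_circ. Qed.

Lemma mean_cst (k : R[i]) z : mean (fun=> k) z = k.
Proof. by rewrite /mean cint_cst// subr0 mulr1. Qed.

Lemma mean_bound f z (M : R) : z != 0 -> pcont f ->
  (forall t, 0 <= t <= 1 -> cmod (f (z * circ t)) <= M) ->
  cmod (mean f z) <= 2 * M.
Proof.
move=> z0 cf fM.
by have := cint_bound (rcont_on_circ z0 cf) ler01 fM; rewrite subr0 mulr1.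
Qed.

Lemma circ_bounded f z : z != 0 -> pcont f ->
  exists M : R, forall t, 0 <= t <= 1 -> cmod (f (z * circ t)) <= M.
Proof.
move=> z0 cf; have c := rcont_cmod (rcont_on_circ z0 cf).
have cw : {within `[0, 1], continuous (fun t => cmod (f (z * circ t)))}.
  by apply: continuous_subspaceT => t; exact: c.
have [t0 _ Ht] := EVT_max ler01 cw.
by exists (cmod (f (z * circ t0))) => t t01; apply: Ht; rewrite in_itv.
Qed.

(** Goursat in the coordinate [log w]: the two edges of the period strip cancel
    and the other two are the means over the extreme circles. *)
Lemma mean_path f (al : R[i]) (a b : R) : a <= b -> pcont f ->
  (forall s t, a <= s <= b -> cdiff f (cexp (s%:C * al) * circ t)) ->
  mean f (cexp (a%:C * al)) = mean f (cexp (b%:C * al)).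
Proof.
move=> ab cf df; pose F := f \o @cexp R.
have cF z : ccont F z.
  apply: ccont_comp; first exact/cdiff_ccont/cexp_cdiff.
  by apply: cf; exact: cexp_neq0.
have gE s t : F (grid al per s t) = f (cexp (s%:C * al) * circ t).
  by rewrite /F /= /grid cexpD.
have := @goursat R al per F cF a b 0 1 ab ler01.
have dF s t : a <= s <= b -> 0 <= t <= 1 -> cdiff F (grid al per s t).
  move=> sab _; apply: cdiff_comp; first exact: cexp_cdiff.
  by rewrite /grid cexpD; exact: df.
move=> /(_ dF); rewrite /edge.
have -> : cint a b (fun s => F (grid al per s 0) - F (grid al per s 1)) = 0.
  rewrite (eq_cint (g := fun=> 0)) ?cint_cst ?mul0r// => s _.
  by rewrite !gE /circ mul0r cexp0 mul1r cexp_per subrr.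
rewrite mulr0 add0r => /eqP; rewrite mulf_eq0 (negbTE (per_neq0 R)) /= => /eqP.
have cm s : rcont (fun t => F (grid al per s t)) by exact: rcont_gridr.
rewrite cintB// => /eqP; rewrite subr_eq0 => /eqP E; apply/esym.
rewrite /mean (eq_cint (g := fun t => F (grid al per b t)))//.
by rewrite E; apply: eq_cint => t _; rewrite gE.
Qed.

(** The means are constant along the path [s |-> cexp (s * log z)]. For [z] a
    positive real this is Cauchy's theorem for an annulus; for [z] the nome it
    turns quasi-periodicity into a relation between Laurent coefficients. *)
Lemma mean_pholo f z : z != 0 -> pholo f -> mean f z = mean f 1.
Proof.
move=> z0 hf; have [al alE] := cexp_surj z0.
have := @mean_path f al 0 1 ler01 (pholo_pcont hf).
rewrite mul0r cexp0 mul1r alE => -> // s t _.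
by apply: hf; rewrite mulf_neq0 ?cexp_neq0 ?circ_neq0.
Qed.

Lemma mean_radial f (r1 r2 : R) : 0 < r1 -> r1 <= r2 -> pcont f ->
  (forall w, r1 <= cmod w <= r2 -> cdiff f w) ->
  mean f r1%:C = mean f r2%:C.
Proof.
move=> r10 r12 cf df; have r20 : 0 < r2 by apply: lt_le_trans r12.
have lE (r : R) : 0 < r -> cexp ((ln r)%:C * 1) = r%:C by rewrite mulr1; exact: cexp_ln.
rewrite -(lE _ r10) -(lE _ r20); apply: mean_path => //.
  by rewrite ler_ln ?posrE.
move=> s t /andP[sl sr]; apply: df; rewrite cmodM cmod_circ mulr1 cmod_cexp.
rewrite /= mulr1 mul0r subr0 -[r1]lnK ?posrE// -[r2]lnK ?posrE//.
by rewrite !ler_expR sl sr.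
Qed.

(** By compactness of the circle, [f (r * w)] is close to [f w] uniformly in [w]. *)
Lemma mean_continuous1 f (e : R) : pcont f -> 0 < e ->
  exists2 d : R, 0 < d &
    forall r : R, 0 < r -> `|r - 1| < d -> cmod (mean f r%:C - mean f 1) <= e.
Proof.
move=> cf e0; have e40 : 0 < e / 4 by rewrite divr_gt0.
pose P (r t : R) := cmod (f (r%:C * circ t) - f (1 * circ t)) < e / 2.
have K : \forall r \near (1 : R), `[0, 1]%classic `<=` P r.
  have /compact_near_coveringP H := @segment_compact R 0 1.
  apply: (H R (nbhs (1 : R)) P) => t _.
  have [d d0 Hd] := cf _ (circ_neq0 t) _ e40.
  have d20 : 0 < d / 2 by rewrite divr_gt0.
  have [c c0 Hc] := rcont_circ t d20.
  exists ([set u | `|u - t| < c], [set r | `|r - 1| < d / 2]).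
    by split=> /=; [exists c|exists (d / 2)] => //= u /=; rewrite distrC.
  move=> [u r] [/= uc rd]; rewrite /P mul1r.
  have hu := Hc _ uc.
  have h1 : cmod (f (circ u) - f (circ t)) < e / 4 by apply: Hd; lra.
  have h2 : cmod (f (r%:C * circ u) - f (circ t)) < e / 4.
    apply: Hd.
    have -> : r%:C * circ u - circ t = (r - 1)%:C * circ u + (circ u - circ t).
      by rewrite rmorphB rmorph1; ring.
    by rewrite (le_lt_trans (cmodD _ _))// cmodM cmod_circ cmodr; lra.
  have := cmod_triangle (f (circ t)) (f (r%:C * circ u)) (f (circ u)).
  rewrite [cmod (f (circ t) - _)]cmodBC; lra.
case: K => d d0 Hd; exists d => // r r0 rd.
have rC : r%:C != 0 :> R[i] by rewrite -cmod_gt0 cmodr normr_gt0 lt0r_neq0.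
have {}Hd := Hd r; rewrite /= distrC in Hd; have {}Hd := Hd rd.
rewrite /mean -cintB; try (by apply: rcont_on_circ; rewrite ?oner_neq0).
have := @cint_bound R (fun t => f (r%:C * circ t) - f (1 * circ t)) 0 1 (e / 2).
rewrite subr0 mulr1 (_ : 2 * (e / 2) = e); last by field.
apply => //.
  by apply: rcontB; apply: rcont_on_circ => //; exact: oner_neq0.
by move=> t t01; apply/ltW/Hd; rewrite /= in_itv.
Qed.

(** The means are constant on both sides of the unit circle and continuous across
    it, so a singularity at [1] at which [f] stays continuous does no harm. *)
Lemma mean_punctured f (r1 r2 : R) : 0 < r1 -> r1 < 1 -> 1 < r2 -> pcont f ->
  (forall w, w != 0 -> w != 1 -> cdiff f w) ->
  mean f r1%:C = mean f r2%:C.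
Proof.
move=> r10 r11 r21 cf df.
have dfr (w : R[i]) (r : R) : 0 < r -> r <= cmod w -> cmod w != 1 -> cdiff f w.
  move=> r0 rw w1; apply: df.
    by rewrite -cmod_gt0 (lt_le_trans r0).
  by apply: contraNneq w1 => ->; rewrite cmod1.
have mean_1 (a : R) : (forall d : R, 0 < d -> exists r : R,
    [/\ 0 < r, `|r - 1| < d & mean f r%:C = mean f a%:C]) ->
  mean f a%:C = mean f 1.
  move=> H; apply/eqP; rewrite -subr_eq0; apply/eqP/eq0_cmod_le => e e0.
  have [d d0 Hd] := mean_continuous1 cf e0.
  by have [r [r0 rd <-]] := H d d0; exact: Hd.
transitivity (mean f 1); last apply/esym; apply: mean_1 => d d0.
- have [r [m1 m2 m3]] : exists r : R, [/\ r1 <= r, r < 1 & 1 - d / 2 <= r].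
    exists (Num.max r1 (1 - d / 2)); rewrite gt_max r11 !le_max !lexx orbT.
    by split=> //; lra.
  exists r; split; [lra|by rewrite ltr_norml; lra|].
  apply/esym/mean_radial => // w /andP[w1 w2]; apply: dfr w1 _ => //.
  by rewrite lt_eqF// (le_lt_trans w2).
- have [r [m1 m2 m3]] : exists r : R, [/\ r <= r2, 1 < r & r <= 1 + d / 2].
    exists (Num.min r2 (1 + d / 2)); rewrite lt_min r21 !ge_min !lexx orbT.
    by split=> //; lra.
  exists r; split; [lra|by rewrite ltr_norml; lra|].
  have r0 : 0 < r by lra.
  apply: mean_radial => //.
  move=> w /andP[w1 w2]; apply: (dfr _ _ _ w1) => //.
  by rewrite gt_eqF// (lt_le_trans m2).
Qed.

End CircleMeans.

(** * Laurent coefficients *)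

Section LaurentCoefficients.
Variable R : realType.
Implicit Types (f g : R[i] -> R[i]) (z w : R[i]) (k : int).

Lemma pholoM f g : pholo f -> pholo g -> pholo (fun w => f w * g w).
Proof. by move=> hf hg w w0; apply: cdiffM; [exact: hf|exact: hg]. Qed.

Lemma pholo_cst (c : R[i]) : pholo (fun=> c).
Proof. by move=> w _; exact: cdiff_cst. Qed.

Lemma pholoB f g : pholo f -> pholo g -> pholo (fun w => f w - g w).
Proof. by move=> hf hg w w0; apply: cdiffB; [exact: hf|exact: hg]. Qed.

Lemma pholo_scale f (c : R[i]) : c != 0 -> pholo f -> pholo (fun w => f (c * w)).
Proof.
move=> c0 hf w w0; apply: (@cdiff_comp _ f (fun w => c * w)).
  by apply: cdiffM; [exact: cdiff_cst|exact: cdiff_id].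
by apply: hf; rewrite mulf_neq0.
Qed.

Lemma pholo_inv f : pholo f -> pholo (fun w => f w^-1).
Proof.
move=> hf w w0; apply: (@cdiff_comp _ f GRing.inv); first exact: cdiffV.
by apply: hf; rewrite invr_neq0.
Qed.

Lemma pholo_expz k : pholo (fun w : R[i] => w ^ k).
Proof. by move=> w w0; apply: cdiffXz => //; exact: cdiff_id. Qed.

Lemma pholo_sum (I : Type) (s : seq I) (Q : pred I) (F : I -> R[i] -> R[i]) :
  (forall i, Q i -> pholo (F i)) -> pholo (fun w => \sum_(i <- s | Q i) F i w).
Proof. by move=> hF w w0; apply: cdiff_sum => i Qi; exact: hF. Qed.

(** The coefficient of [w ^ (- k)] in the Laurent expansion of [f]. *)
Definition coef f k : R[i] := mean (fun w => f w * w ^ k) 1.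

(** Substituting [c * w] for [w] replaces the unit circle by the circle through
    [c], over which the mean is the same. *)
Lemma coef_dilate f (c : R[i]) k : c != 0 -> pholo f ->
  coef (fun w => f (c * w)) k = c ^ (- k) * coef f k.
Proof.
move=> c0 hf; have h : pholo (fun w => f w * w ^ k).
  by apply: pholoM => //; exact: pholo_expz.
rewrite /coef -(mean_pholo c0 h) -meanZ//; last exact: pholo_pcont.
apply: eq_cint => t _; rewrite mul1r expfzMl.
have : c ^ (- k) * c ^ k = 1 by rewrite -expfzDr// addNr expr0z.
by move=> uv; rewrite [f _ * (c ^ k * _)]mulrCA [RHS]mulrA uv mul1r.
Qed.

(** By the dilation rule with factor [2], the coefficient is [2 ^ (- k)] times
    itself. *)
Lemma coef_cst1 k : k != 0 -> coef (fun=> 1) k = 0.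
Proof.
move=> k0.
have := @coef_dilate (fun=> 1) 2 k; rewrite pnatr_eq0 => /(_ isT (pholo_cst 1)).
move=> /eqP; rewrite -subr_eq0 -{1}[coef _ _]mul1r -mulrBl mulf_eq0.
move=> /orP[|/eqP//]; rewrite subr_eq0 => /eqP E; exfalso.
have c2 : cmod (2 : R[i]) = 2.
  by rewrite -(rmorph_nat (real_complex R) 2) cmodr ger0_norm.
have H : (2 : R) ^ (- k) = 2 ^ 0.
  by rewrite expr0z -[RHS](cmod1 R) [in RHS]E cmodXz c2.
have : - k = 0.
  by apply: (@ieexprIz R 2 _ _ _ _ H); [exact: ltr0n|rewrite gt_eqF// ltr1n].
move/eqP.
by rewrite oppr_eq0 (negbTE k0).
Qed.

(** A sequence that is constant on either side of a single jump and decays in both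
    directions vanishes, so the jump is zero. *)
Lemma jump_eq0 (m : int -> R[i]) (a : R[i]) (A B : R) :
  (forall k, k != 0 -> m (k + 1) = m k) -> a = m 0 - m 1 ->
  (forall n : nat, cmod (m n.+1) <= A / 2 ^+ n) ->
  (forall n : nat, cmod (m (- n%:Z)) <= B / 2 ^+ n) -> a = 0.
Proof.
move=> mS -> mA mB.
have bound_dec (x : R[i]) (C : R) : (forall n : nat, cmod x <= C / 2 ^+ n) -> x = 0.
  move=> H; apply: eq0_cmod_le => e e0.
  have C0 : 0 <= C.
    by have := H 0%N; rewrite expr0 divr1; exact/le_trans/cmod_ge0.
  have [n Hn] : exists n : nat, C / e < n%:R.
    by exists (Num.bound (C / e)); exact: (archi_boundP (divr_ge0 C0 (ltW e0))).
  apply: le_trans (H n) _; rewrite ler_pdivrMr ?exprn_gt0// mulrC -ler_pdivrMr//.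
  by rewrite (le_trans (ltW Hn))// -natrX ler_nat ltnW// ltn_expl.
have mp (n : nat) : m n.+1 = m 1.
  elim: n => // n <-; rewrite -(mS n.+1)//.
  by congr m; rewrite -[n.+2]addn1 PoszD.
have mn (n : nat) : m (- n%:Z) = m 0.
  elim: n => // n <-; rewrite -(mS (- n.+1%:Z))//.
  by congr m; rewrite -[n.+1]addn1 PoszD; ring.
have m1 : m 1 = 0 by apply: (bound_dec _ A) => n; rewrite -(mp n).
have m0 : m 0 = 0 by apply: (bound_dec _ B) => n; rewrite -(mn n).
by rewrite m0 m1 subrr.
Qed.

(** The Cauchy kernel argument: the means of
    [(f w - f 1) / (w - 1) * w ^ k] over any circle do not depend on the
    circle; in [k] they jump by [- f 1] at [k = 0] only, and they decay for
    [k] tending to plus or minus infinity on a small or a large circle. *)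
Lemma coef_eq0_at1 f : pholo f -> (forall k, coef f k = 0) -> f 1 = 0.
Proof.
move=> hf cf0; have [d cd] := cdiff_slope (hf 1 (oner_neq0 _)).
pose M k w := slope f 1 d w * w ^ k.
have dM k w : w != 0 -> w != 1 -> cdiff (M k) w.
  move=> w0 w1; apply: cdiffM; last exact: pholo_expz.
  apply: (@cdiff_local _ (fun u => (f u - f 1) / (u - 1)) _ _ (cmod (w - 1))).
  - by rewrite cmod_gt0 subr_eq0.
  - move=> u uw; rewrite /slope; case: eqP => // u1.
    by move: uw; rewrite u1 cmodBC ltxx.
  - apply: cdiffM; first by apply: cdiffB; [exact: hf|exact: cdiff_cst].
    apply: cdiff_inv; last by rewrite subr_eq0.
    by apply: cdiffB; [exact: cdiff_id|exact: cdiff_cst].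
have cM k : pcont (M k).
  move=> w w0; have [->|w1] := eqVneq w 1; last exact/cdiff_ccont/dM.
  by apply: ccontM => //; exact/cdiff_ccont/pholo_expz/oner_neq0.
have [r1 [r2 [r10 r11 r21 r1h r2h]]] : exists r1 r2 : R,
    [/\ 0 < r1, r1 < 1, 1 < r2, r1 <= 2^-1 & 2 <= r2].
  by exists 2^-1, 2; split=> //; lra.
have r20 : 0 < r2 by apply: lt_trans r21.
have realn0 (r : R) : 0 < r -> r%:C != 0 :> R[i].
  by move=> r0; rewrite -cmod_gt0 cmodr normr_gt0 lt0r_neq0.
have n1 := realn0 _ r10; have n2 := realn0 _ r20.
pose m k := mean (M k) r1%:C.
have mE k : m k = mean (M k) r2%:C.
  by apply: mean_punctured => // w; exact: dM.
have h1 k : pholo (fun w => 1 * w ^ k).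
  by apply: pholoM; [exact: pholo_cst|exact: pholo_expz].
have hfk k : pholo (fun w => f w * w ^ k).
  by apply: pholoM => //; exact: pholo_expz.
have mS k : m (k + 1) - m k = - (f 1 * coef (fun=> 1) k).
  rewrite /m -meanB//.
  rewrite (eq_mean (g := fun w => f w * w ^ k - f 1 * (1 * w ^ k)))//.
    rewrite meanB//; first 1 last.
    - exact: pholo_pcont.
    - by apply: pholo_pcont; apply: pholoM; [exact: pholo_cst|exact: h1].
    rewrite (meanZ _ n1); last exact: pholo_pcont.
    rewrite (mean_pholo n1 (hfk k)) (mean_pholo n1 (h1 k)).
    by rewrite -/(coef f k) cf0 sub0r.
  move=> w w0; rewrite /M expfzDr// expr1z mul1r -mulrBl (slopeE f 1 d w); ring.
have [A HA] := circ_bounded n1 (cM 0).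
have [B HB] := circ_bounded n2 (cM 0).
have MzE k w : cmod (M k w) = cmod (M 0 w) * cmod w ^ k.
  by rewrite /M expr0z mulr1 cmodM cmodXz.
have mA n : cmod (m n.+1) <= 2 * A / 2 ^+ n.
  rewrite -mulrA; apply: mean_bound => // t t01.
  rewrite MzE cmodM cmod_circ mulr1 cmodr (gtr0_norm r10).
  have r1n : 0 <= r1 ^+ n.+1 by rewrite exprn_ge0// ltW.
  apply: ler_pM; [exact: cmod_ge0|exact: r1n|exact: HA|].
  rewrite -exprnP exprS -exprVn; apply: (@le_trans _ _ (r1 ^+ n)).
    by rewrite ler_piMl ?exprn_ge0// ltW.
  by rewrite lerXn2r// nnegrE ?invr_ge0// ltW.
have mB n : cmod (m (- n%:Z)) <= 2 * B / 2 ^+ n.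
  rewrite mE -mulrA; apply: mean_bound => // t t01.
  rewrite MzE cmodM cmod_circ mulr1 cmodr (gtr0_norm r20).
  have r2n : 0 <= (r2 ^+ n)^-1 by rewrite invr_ge0 exprn_ge0// ltW.
  rewrite -exprnN; apply: ler_pM; [exact: cmod_ge0|exact: r2n|exact: HB|].
  by rewrite lef_pV2 ?posrE ?exprn_gt0// lerXn2r// nnegrE ltW.
apply: (jump_eq0 _ _ mA mB) => [k k0|].
  by apply/eqP; rewrite -subr_eq0 mS coef_cst1// mulr0 oppr0.
have := mS 0; rewrite add0r => E; rewrite -[LHS]opprK -opprB opprK E opprK.
rewrite /coef (eq_mean (g := fun=> 1)) ?mean_cst ?mulr1 ?oner_neq0//.
by move=> w w0; rewrite expr0z mul1r.
Qed.

Lemma coef_eq0 f : pholo f -> (forall k, coef f k = 0) ->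
  forall z, z != 0 -> f z = 0.
Proof.
move=> hf cf0 z z0; have := @coef_eq0_at1 (fun w => f (z * w)).
rewrite mulr1; apply; first exact: pholo_scale.
by move=> k; rewrite coef_dilate// cf0 mulr0.
Qed.

End LaurentCoefficients.

(** * Functions with a multiplier *)

Section QuasiPeriodic.
Variables (R : realType) (p : R[i]).
Hypothesis p0 : p != 0.
Implicit Types (f g : R[i] -> R[i]) (m : nat) (u : R[i]).

(** An A_(m-1) theta function of norm [s] has multiplier [(-1) ^+ m / s]; the
    multiplier, unlike the norm, is multiplicative. *)
Definition qper m u f :=
  pholo f /\ forall x, x != 0 -> f (p * x) = u * x ^- m * f x.

Lemma qper_cst (c : R[i]) : qper 0 1 (fun=> c).
Proof. by split=> [|x x0]; [exact: pholo_cst|rewrite invr1 !mul1r]. Qed.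

Lemma qperM m1 m2 u1 u2 f g : qper m1 u1 f -> qper m2 u2 g ->
  qper (m1 + m2) (u1 * u2) (fun x => f x * g x).
Proof.
move=> [hf Ef] [hg Eg]; split=> [|x x0]; first exact: pholoM.
by rewrite Ef// Eg// exprD invfM; ring.
Qed.

Lemma qperZ m u (c : R[i]) f : qper m u f -> qper m u (fun x => c * f x).
Proof. by move=> h; have := qperM (qper_cst c) h; rewrite mul1r. Qed.

Lemma qperB m u f g : qper m u f -> qper m u g -> qper m u (fun x => f x - g x).
Proof.
move=> [hf Ef] [hg Eg]; split=> [|x x0]; first exact: pholoB.
by rewrite Ef// Eg// mulrBr.
Qed.

Lemma qper_sum m u (I : Type) (r : seq I) (F : I -> R[i] -> R[i]) :
  (forall i, qper m u (F i)) -> qper m u (fun x => \sum_(i <- r) F i x).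
Proof.
move=> hF; split=> [|x x0]; first by apply: pholo_sum => i _; exact: (hF i).1.
by rewrite mulr_sumr; apply: eq_bigr => i _; exact: (hF i).2.
Qed.

Lemma qper_prod (I : Type) (r : seq I) (Q : pred I) (m : I -> nat)
    (u : I -> R[i]) (F : I -> R[i] -> R[i]) :
  (forall i, Q i -> qper (m i) (u i) (F i)) ->
  qper (\sum_(i <- r | Q i) m i) (\prod_(i <- r | Q i) u i)
    (fun x => \prod_(i <- r | Q i) F i x).
Proof.
move=> hF; elim: r => [|i r IH].
  rewrite !big_nil (_ : (fun=> _) = fun=> 1); first exact: qper_cst.
  by apply/funext => x; rewrite big_nil.
rewrite !big_cons; case: (boolP (Q i)) => Qi.
  rewrite (_ : (fun x => _) = fun x => F i x * \prod_(j <- r | Q j) F j x).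
    by apply: qperM => //; exact: hF.
  by apply/funext => x; rewrite big_cons Qi.
rewrite (_ : (fun x => _) = fun x => \prod_(j <- r | Q j) F j x)//.
by apply/funext => x; rewrite big_cons (negbTE Qi).
Qed.

Lemma qper_ext m u f g : (forall x, f x = g x) -> qper m u f -> qper m u g.
Proof. by move=> /funext ->. Qed.

Lemma coef_sum (I : Type) (r : seq I) (F : I -> R[i] -> R[i]) k :
  (forall i, pholo (F i)) ->
  coef (fun x => \sum_(i <- r) F i x) k = \sum_(i <- r) coef (F i) k.
Proof.
move=> hF; elim: r => [|i r IH].
  rewrite big_nil /coef (_ : (fun w => _) = fun=> 0) ?mean_cst//.
  by apply/funext => x; rewrite big_nil mul0r.
have hk g : pholo g -> pcont (fun w => g w * w ^ k).
  by move=> hg; apply/pholo_pcont/pholoM => //; exact: pholo_expz.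
rewrite big_cons -IH /coef -meanD ?oner_neq0//; try (apply: hk => //; exact: pholo_sum).
by congr mean; apply/funext => x; rewrite big_cons mulrDl.
Qed.

Lemma coefZ (c : R[i]) f k : pholo f -> coef (fun x => c * f x) k = c * coef f k.
Proof.
move=> hf; rewrite /coef -meanZ ?oner_neq0//.
  by congr mean; apply/funext => x; rewrite mulrA.
by apply/pholo_pcont/pholoM => //; exact: pholo_expz.
Qed.

Lemma qper_coef m u f (k : int) : qper m u f ->
  p ^ (- k) * coef f k = u * coef f (k - m%:Z).
Proof.
move=> [hf Ef]; rewrite -(coef_dilate k p0 hf) /coef -meanZ ?oner_neq0//.
  apply: eq_mean => [|w w0]; first exact: oner_neq0.
  by rewrite Ef// expfzDr// -exprnN; ring.
by apply/pholo_pcont/pholoM => //; exact: pholo_expz.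
Qed.

(** Comparing Laurent coefficients in the functional equation links the
    coefficients at [k] and [k - m]. *)
Lemma qper_coef_inj m u f : (0 < m)%N -> u != 0 -> qper m u f ->
  (forall k : 'I_m, coef f (k : nat)%:Z = 0) -> forall z, z != 0 -> f z = 0.
Proof.
move=> m0 u0 hf c0; apply: coef_eq0; first exact: hf.1.
have step k : (coef f k == 0) = (coef f (k - m%:Z) == 0).
  have := qper_coef k hf; move=> E; apply/idP/idP => /eqP Z.
    by move: E; rewrite Z mulr0 => /esym/eqP; rewrite mulf_eq0 (negbTE u0).
  move: E; rewrite Z mulr0 => /eqP; rewrite mulf_eq0 expfz_eq0 (negbTE p0).
  by rewrite andbF.
have stepn k (n : nat) : (coef f k == 0) = (coef f (k - n%:Z * m%:Z) == 0).
  elim: n => [|n IH]; first by rewrite mul0r subr0.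
  rewrite IH step; congr (coef f _ == 0); rewrite -addn1 PoszD; ring.
move=> k; apply/eqP.
have m0' : (m%:Z != 0) by rewrite eqz_nat -lt0n.
have kr : exists r : 'I_m, (k %% m)%Z = (r : nat)%:Z.
  have := ltz_pmod k (m0 : 0 < m%:Z); have := modz_ge0 k m0'.
  by case: (k %% m)%Z => // r _ rm; exists (Ordinal (rm : (r < m)%N)).
have [r rE] := kr; have := divz_eq k m; rewrite rE; case: (k %/ m)%Z => n ->.
  by rewrite (stepn _ n) addrAC subrr add0r c0.
rewrite NegzE; have := stepn (r : nat)%:Z n.+1; rewrite c0 eqxx => /esym.
by congr (coef f _ == 0); ring.
Qed.

(** Evaluation at [m] points separates the multiplier space as soon as it
    separates [m] of its elements, because the space has dimension at most
    [m]. *)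
Lemma qper_eval_inj m u (e : 'I_m -> R[i] -> R[i]) (y : 'I_m -> R[i]) f :
  (0 < m)%N -> u != 0 -> (forall i, y i != 0) -> (forall i, qper m u (e i)) ->
  (forall i j, i != j -> e i (y j) = 0) -> (forall i, e i (y i) != 0) ->
  qper m u f -> (forall i, f (y i) = 0) -> forall z, z != 0 -> f z = 0.
Proof.
move=> m0 u0 y0 he e_off e_diag hf fy.
have comb (v : 'I_m -> R[i]) : qper m u (fun x => \sum_i v i * e i x).
  by apply: qper_sum => i; apply: qperZ.
have comb_y (v : 'I_m -> R[i]) j : \sum_i v i * e i (y j) = v j * e j (y j).
  by rewrite (bigD1 j)//= big1 ?addr0// => i ij; rewrite e_off ?mulr0.
have comb_coef (v : 'I_m -> R[i]) k :
    coef (fun x => \sum_i v i * e i x) k = \sum_i v i * coef (e i) k.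
  rewrite coef_sum => [|i]; last by apply: (qperZ _ (he i)).1.
  by apply: eq_bigr => i _; rewrite coefZ//; exact: (he i).1.
pose M := \matrix_(i < m, k < m) coef (e i) (k : nat)%:Z.
have Mu : M \in unitmx.
  rewrite unitmxE unitfE; apply/det0P => -[v v0 vM]; move/eqP: v0; apply.
  apply/rowP => j; rewrite mxE; apply/eqP.
  have := @qper_coef_inj m u _ m0 u0 (comb (v 0)).
  move=> /(_ _ (y j) (y0 j)); rewrite comb_y => H.
  have /eqP : v 0 j * e j (y j) = 0.
    apply: H => k; rewrite comb_coef; have := congr1 (fun A : 'rV_m => A 0 k) vM.
    by rewrite !mxE => E; rewrite -[RHS]E; apply: eq_bigr => i _; rewrite mxE.
  by rewrite mulf_eq0 (negbTE (e_diag j)) orbF.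
pose v := (\row_k coef f (k : nat)%:Z) *m invmx M.
have hg : qper m u (fun x => f x - \sum_i v 0 i * e i x) by exact: qperB.
have gz z : z != 0 -> f z = \sum_i v 0 i * e i z.
  move=> z0; apply/eqP; rewrite -subr_eq0; apply/eqP.
  apply: (qper_coef_inj m0 u0 hg) => // k.
  have hc g : qper m u g -> pcont (fun w => g w * w ^ (k : nat)%:Z).
    by move=> hg'; apply/pholo_pcont/pholoM; [exact: hg'.1|exact: pholo_expz].
  have -> : coef (fun x => f x - \sum_i v 0 i * e i x) (k : nat)%:Z =
      coef f (k : nat)%:Z - coef (fun x => \sum_i v 0 i * e i x) (k : nat)%:Z.
    rewrite /coef -meanB ?oner_neq0//; try exact: hc.
    by congr mean; apply/funext => x; rewrite mulrBl.
  rewrite comb_coef; have := mulmxKV Mu (\row_k coef f (k : nat)%:Z).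
  move=> /(congr1 (fun A : 'rV_m => A 0 k)); rewrite -/v !mxE => <-.
  by apply/eqP; rewrite subr_eq0; apply/eqP/eq_bigr => i _; rewrite !mxE.
have v0 i : v 0 i = 0.
  have := gz _ (y0 i); rewrite fy comb_y => /esym/eqP.
  by rewrite mulf_eq0 (negbTE (e_diag i)) orbF => /eqP.
by move=> z z0; rewrite gz// big1// => i _; rewrite v0 mul0r.
Qed.

Section WithTheta.
Variable th : R[i] -> R[i].
Hypothesis th_holo : pholo th.
Hypothesis th_p : forall x, x != 0 -> th (p * x) = - x^-1 * th x.
Hypothesis th_1 : th 1 = 0.

Lemma qper_th (a : R[i]) : a != 0 -> qper 1 (- a^-1) (fun x => th (a * x)).
Proof.
move=> a0; split=> [|x x0]; first exact: pholo_scale.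
by rewrite mulrCA th_p ?mulf_neq0// invfM expr1; ring.
Qed.

(** The [m] points are separated by products of [m] theta factors, one for each
    of the other points and one more that adjusts the norm; the latter does not
    vanish at the remaining point because the norm is generic. *)
Lemma qper_zeros m (s : R[i]) (y : 'I_m -> R[i]) f :
  (0 < m)%N -> s != 0 -> (forall i, y i != 0) ->
  th (s * \prod_i y i) != 0 -> (forall i j, i != j -> th (y i / y j) != 0) ->
  qper m ((-1) ^+ m / s) f -> (forall i, f (y i) = 0) ->
  forall z, z != 0 -> f z = 0.
Proof.
move=> m0 s0 y0 thY thy hf fy.
pose Y := \prod_i y i.
have Y0 : Y != 0 by apply/prodf_neq0 => i _; exact: y0.
pose e i x := th (s * Y / y i * x) * \prod_(k | k != i) th ((y k)^-1 * x).
apply: (@qper_eval_inj m ((-1) ^+ m / s) e y) => //.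
- by rewrite mulf_neq0 ?invr_neq0// signr_eq0.
- move=> i; have c0 : s * Y / y i != 0 by rewrite !mulf_neq0 ?invr_neq0.
  have := qperM (qper_th c0) (@qper_prod _ (index_enum 'I_m) (fun k => k != i)
    (fun=> 1%N) (fun k => - (y k)) (fun k x => th ((y k)^-1 * x)) _).
  rewrite sum1_card cardC1 card_ord add1n prednK//.
  rewrite prodrN cardC1 card_ord (_ : _ * _ = (-1) ^+ m / s).
    by apply=> k _; rewrite -[in X in - X](invrK (y k)); apply: qper_th; rewrite invr_neq0.
  rewrite /Y (bigD1 i)//= -[in RHS](prednK m0) exprS.
  have Z0 : \prod_(k | k != i) y k != 0 by apply/prodf_neq0 => k _; exact: y0.
  by have := y0 i => yi0; field; rewrite Z0 yi0 s0.
- move=> i j ij; rewrite /e (bigD1 j) 1?eq_sym//= mulVf ?y0// th_1.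
  by rewrite mul0r mulr0.
- move=> i; rewrite /e mulf_neq0// ?divfK//.
  by apply/prodf_neq0 => k ki; rewrite mulrC; apply: thy; rewrite eq_sym.
Qed.
End WithTheta.
End QuasiPeriodic.

(** * Limits of complex sequences and the q-Pochhammer symbol *)

(** Over an abstract field the norm topology is found by inference; the complex
    numbers receive it by instantiation. *)
Definition seq_lim (K : numFieldType) (v : nat -> K) : K := lim (v n @[n --> \oo]).

Lemma lim_unique_dist (K : numFieldType) (v : nat -> K) (l : K) :
  (forall e : K, 0 < e -> exists N, forall n, (N <= n)%N -> `|l - v n| < e) ->
  seq_lim v = l.
Proof.
move=> H; apply: cvg_lim; first exact: norm_hausdorff.
apply/cvgrPdist_lt => e e0; have [N HN] := H e e0.
by exists N => // n /= Nn; exact: HN.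
Qed.

Section Limits.
Variable R : realType.
Implicit Types (v w : nat -> R[i]) (l : R[i]).

Definition clim v l := forall e : R, 0 < e ->
  exists N, forall n, (N <= n)%N -> cmod (v n - l) < e.

Lemma clim_lim v l : clim v l -> seq_lim v = l.
Proof.
move=> H; apply: lim_unique_dist => e e0.
have := e0; rewrite ltcE => /andP[/eqP /= Ie Re].
have [N HN] := H _ Re; exists N => n /HN.
rewrite cmodBC cmodE -ltcR; congr (_ < _).
by case: (e) Ie => a b /= ->.
Qed.

Lemma clim_unique v l l' : clim v l -> clim v l' -> l = l'.
Proof. by move=> /clim_lim <- /clim_lim. Qed.

Lemma climM v w l l' : clim v l -> clim w l' -> clim (fun n => v n * w n) (l * l').
Proof.
move=> cv cw e e0.
set A := cmod l + 1; set B := cmod l' + 1.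
have A0 : 0 < A by rewrite ltr_wpDl ?cmod_ge0.
have B0 : 0 < B by rewrite ltr_wpDl ?cmod_ge0.
have [N1 H1] := cv (e / 2 / B) ltac:(by rewrite !divr_gt0).
have [N2 H2] := cw (e / 2 / A) ltac:(by rewrite !divr_gt0).
have [N3 H3] := cv 1 ltr01.
exists (maxn N1 (maxn N2 N3)) => n; rewrite !geq_max => /and3P[n1 n2 n3].
have -> : v n * w n - l * l' = (v n - l) * l' + v n * (w n - l') by ring.
have vA : cmod (v n) <= A.
  by have := cmodD (v n - l) l; rewrite subrK; have := H3 n n3; rewrite /A; lra.
rewrite (le_lt_trans (cmodD _ _))// !cmodM.
have := H1 n n1; rewrite ltr_pdivlMr// => h1.
have := H2 n n2; rewrite ltr_pdivlMr// => h2.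
have : cmod (v n - l) * cmod l' <= cmod (v n - l) * B.
  by rewrite ler_wpM2l ?cmod_ge0// lerDl.
have : cmod (v n) * cmod (w n - l') <= A * cmod (w n - l').
  by rewrite ler_wpM2r ?cmod_ge0.
rewrite [A * _]mulrC; lra.
Qed.

Lemma clim_cst l : clim (fun=> l) l.
Proof. by move=> e e0; exists 0%N => n _; rewrite subrr cmod0. Qed.

Lemma clim_comp v l (f : nat -> nat) : (forall n, (n <= f n)%N) ->
  clim v l -> clim (v \o f) l.
Proof.
move=> hf cv e e0; have [N HN] := cv e e0; exists N => n Nn.
by apply: HN; exact: leq_trans (hf n).
Qed.

Lemma clim_ext v w l : (forall n, v n = w n) -> clim v l -> clim w l.
Proof. by move=> /funext ->. Qed.

Lemma clim_shift v l : clim (fun n => v n.+1) l -> clim v l.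
Proof.
move=> cv e e0; have [N HN] := cv e e0; exists N.+1 => -[//|n] Nn.
exact: HN.
Qed.

Lemma climB v w l l' : clim v l -> clim w l' -> clim (fun n => v n - w n) (l - l').
Proof.
move=> cv cw e e0; have e20 : 0 < e / 2 by rewrite divr_gt0.
have [N1 H1] := cv _ e20; have [N2 H2] := cw _ e20.
exists (maxn N1 N2) => n; rewrite geq_max => /andP[/H1 h1 /H2 h2].
rewrite opprD addrACA -opprD (le_lt_trans (cmodB _ _))//; lra.
Qed.

Lemma clim_bound v l (M : R) : clim v l -> (forall n, cmod (v n) <= M) ->
  cmod l <= M.
Proof.
move=> cv vM; apply/ler_addgt0Pr => e e0; have [N HN] := cv e e0.
have := HN N (leqnn N); have := vM N; rewrite cmodBC.
have := cmodD (l - v N) (v N); rewrite subrK; lra.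
Qed.

(** Subtracting and adding a geometric tail makes the sequence monotone, so the
    intervals between the two are nested. *)
Lemma geometric_cvg (x : nat -> R) (C q : R) : 0 <= q -> q < 1 ->
  (forall n, `|x n.+1 - x n| <= C * q ^+ n) ->
  exists s, forall n, `|x n - s| <= C / (1 - q) * q ^+ n.
Proof.
move=> q0 q1 H; set D := C / (1 - q).
have q1' : 0 < 1 - q by rewrite subr_gt0.
have C0 : 0 <= C by have := H 0%N; rewrite expr0 mulr1; exact/le_trans/normr_ge0.
have DS n : D * q ^+ n = C * q ^+ n + D * q ^+ n.+1.
  by rewrite /D exprS; field; rewrite gt_eqF.
have D0 n : 0 <= D * q ^+ n by rewrite mulr_ge0 ?divr_ge0 ?exprn_ge0// ltW.
have [||| s Hs] := @nested_intervals R (fun n => x n - D * q ^+ n)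
  (fun n => 2 * (D * q ^+ n)).
- by move=> n; have := H n; rewrite (DS n) ler_norml; lra.
- by move=> n; have := H n; rewrite (DS n) ler_norml; lra.
- by move=> n; rewrite mulr_ge0.
by exists s => n; have := Hs n; rewrite ler_norml; lra.
Qed.

Lemma geometric_clim v (C q : R) : 0 <= q -> q < 1 ->
  (forall n, cmod (v n.+1 - v n) <= C * q ^+ n) -> exists l, clim v l.
Proof.
move=> q0 q1 H.
have [s Hs] := @geometric_cvg (fun n => complex.Re (v n)) C q q0 q1
  (fun n => ltac:(rewrite -ReB; exact: le_trans (abs_Re_le _) (H n))).
have [t Ht] := @geometric_cvg (fun n => complex.Im (v n)) C q q0 q1
  (fun n => ltac:(rewrite -ImB; exact: le_trans (abs_Im_le _) (H n))).
have q1' : 0 < 1 - q by rewrite subr_gt0.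
have C0 : 0 <= C by have := H 0%N; rewrite expr0 mulr1; exact/le_trans/cmod_ge0.
set D := C / (1 - q) in Hs Ht; have D0 : 0 <= D by rewrite divr_ge0// ltW.
have bound n : cmod (v n - (s +i* t)) <= 2 * D * q ^+ n.
  apply: le_trans (cmod_le_ReIm _) _; rewrite ReB ImB /=.
  have := Hs n; have := Ht n; lra.
exists (s +i* t) => e e0.
have : (fun n => q ^+ n) @ \oo --> 0 by apply: cvg_expr; rewrite ger0_norm.
have D1 : 0 < 2 * D + 1 by rewrite ltr_wpDl// mulr_ge0.
move=> /cvgrPdist_lt /(_ (e / (2 * D + 1)) (divr_gt0 e0 D1)) [N _ HN].
exists N => n Nn; apply: le_lt_trans (bound n) _.
have := HN n Nn; rewrite sub0r normrN ger0_norm ?exprn_ge0// ltr_pdivlMr// mulrC.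
by apply: le_lt_trans; rewrite ler_wpM2r ?exprn_ge0// lerDl.
Qed.
End Limits.

Section QPochhammer.
Variables (R : realType) (q : R[i]).
Hypothesis q1 : cmod q < 1.
Implicit Types z w x : R[i].

Definition poch n x : R[i] := \prod_(0 <= j < n) (1 - x * q ^+ j).

Lemma poch0 x : poch 0 x = 1. Proof. by rewrite /poch big_geq. Qed.
Lemma pochS n x : poch n.+1 x = poch n x * (1 - x * q ^+ n).
Proof. by rewrite /poch big_nat_recr. Qed.

Let r := cmod q.
Let r0 : 0 <= r. Proof. exact: cmod_ge0. Qed.

(** On the disc of radius [rho], [majo n] bounds [poch n], [majo n * sig n] bounds
    its difference quotients, and [majo n * sig n ^+ 2] those of second order. *)
Let majo (rho : R) n := \prod_(0 <= j < n) (1 + rho * r ^+ j).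
Let sig n := \sum_(0 <= j < n) r ^+ j.

Let majoS rho n : majo rho n.+1 = majo rho n * (1 + rho * r ^+ n).
Proof. by rewrite /majo big_nat_recr. Qed.
Let sigS n : sig n.+1 = sig n + r ^+ n.
Proof. by rewrite /sig big_nat_recr. Qed.

Let sig_ge0 n : 0 <= sig n.
Proof. by apply: sumr_ge0 => j _; rewrite exprn_ge0. Qed.

Let sig_le n : sig n <= (1 - r)^-1.
Proof.
have r1 : 0 < 1 - r by rewrite subr_gt0.
rewrite -[leRHS]mul1r ler_pdivlMr//.
suff -> : sig n * (1 - r) = 1 - r ^+ n by rewrite gerBl exprn_ge0.
elim: n => [|n IH]; first by rewrite /sig big_geq// mul0r expr0 subrr.
by rewrite sigS mulrDl IH exprS; ring.
Qed.

Let majo_ge1 rho n : 0 <= rho -> 1 <= majo rho n.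
Proof.
move=> h; elim: n => [|n IH]; first by rewrite /majo big_geq.
have : 0 <= rho * r ^+ n by rewrite mulr_ge0 ?exprn_ge0.
move=> h0; rewrite majoS; apply: (le_trans IH).
by rewrite ler_peMr ?lerDl// (le_trans ler01).
Qed.

Let majo_le rho n : 0 <= rho -> majo rho n <= expR (rho / (1 - r)).
Proof.
move=> h; apply: (@le_trans _ _ (expR (rho * sig n))).
  elim: n => [|n IH]; first by rewrite /majo /sig !big_geq// mulr0 expR0.
  rewrite majoS sigS [rho * (_ + _)]mulrDr expRD ler_pM ?expR_ge1Dx//.
    by rewrite (le_trans ler01) ?majo_ge1.
  by rewrite addr_ge0// mulr_ge0 ?exprn_ge0.
by rewrite ler_expR ler_wpM2l.
Qed.

Let cmod_factor rho x n : cmod x <= rho -> cmod (1 - x * q ^+ n) <= 1 + rho * r ^+ n.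
Proof.
move=> xr; apply: le_trans (cmodB _ _) _; rewrite cmod1 lerD2l cmodM cmodX.
by rewrite ler_wpM2r ?exprn_ge0.
Qed.

Let poch_le rho x n : cmod x <= rho -> cmod (poch n x) <= majo rho n.
Proof.
move=> xr; elim: n => [|n IH]; first by rewrite poch0 cmod1 /majo big_geq.
by rewrite pochS majoS cmodM ler_pM ?cmod_ge0// cmod_factor.
Qed.

Lemma poch_cvg x : exists l, clim (poch^~ x) l.
Proof.
pose rho := cmod x; have rho0 : 0 <= rho := cmod_ge0 x.
apply: (@geometric_clim _ _ (expR (rho / (1 - r)) * rho) r) => // n.
have -> : poch n.+1 x - poch n x = - (poch n x * (x * q ^+ n)).
  by rewrite pochS; ring.
rewrite cmodN !cmodM cmodX -/r -/rho mulrA ler_wpM2r ?exprn_ge0//.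
rewrite ler_wpM2r//; exact: le_trans (poch_le _ (lexx _)) (majo_le _ _).
Qed.

Lemma poch_clim x : clim (poch^~ x) (qpochhammer x q).
Proof. have [l hl] := poch_cvg x.
by rewrite (_ : qpochhammer x q = l)//; exact: clim_lim hl. Qed.

Lemma qpochhammer_rec x : qpochhammer x q = (1 - x) * qpochhammer (q * x) q.
Proof.
apply: clim_unique (poch_clim x) _; apply: clim_shift.
apply: clim_ext (climM (clim_cst (1 - x)) (poch_clim (q * x))) => n.
rewrite /poch big_nat_recl// expr0 mulr1; congr (_ * _).
by apply: eq_bigr => j _; rewrite exprS; congr (1 - _); ring.
Qed.

Lemma qpochhammer0 : qpochhammer 0 q = 1.
Proof.
apply: clim_unique (poch_clim 0) _; apply: clim_ext (clim_cst 1) => n.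
by rewrite /poch big1// => j _; rewrite mul0r subr0.
Qed.

(* The derivatives of the partial products, by the product rule. *)
Let dpoch z := fix d n :=
  if n is m.+1 then d m * (1 - z * q ^+ m) - q ^+ m * poch m z else 0.

Let dpoch0 z : dpoch z 0 = 0. Proof. by []. Qed.
Let dpochS z n :
  dpoch z n.+1 = dpoch z n * (1 - z * q ^+ n) - q ^+ n * poch n z.
Proof. by []. Qed.

(** The remainders of the first-order expansions of the partial products are
    quadratic with a constant that does not depend on the number of factors. *)
Lemma qpochhammer_cdiff z : cdiff (fun x : R[i] => qpochhammer x q) z.
Proof.
pose rho := cmod z + 1; have rho0 : 0 <= rho by rewrite addr_ge0 ?cmod_ge0.
have zr : cmod z <= rho by rewrite lerDl.
set B := expR (rho / (1 - r)); set S := (1 - r)^-1.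
have mB n : majo rho n <= B by exact: majo_le.
have m0 n : 0 <= majo rho n by rewrite (le_trans ler01) ?majo_ge1.
have mS n : majo rho n <= majo rho n.+1.
  by rewrite majoS ler_peMr// lerDl mulr_ge0 ?exprn_ge0.
have S0 : 0 <= S by rewrite invr_ge0 subr_ge0 ltW.
have B0 : 0 <= B by exact: expR_ge0.
have step n (x y : R[i]) (a b : R) : 0 <= a -> 0 <= b ->
    cmod x <= a * majo rho n -> cmod y <= b * majo rho n ->
    cmod (x * (1 - z * q ^+ n) - q ^+ n * y) <= (a + b * r ^+ n) * majo rho n.+1.
  move=> a0 b0 xa yb; apply: le_trans (cmodB _ _) _; rewrite mulrDl.
  apply: lerD; first by rewrite cmodM majoS mulrA ler_pM ?cmod_ge0 ?cmod_factor.
  rewrite cmodM cmodX -/r mulrC mulrAC ler_wpM2r ?exprn_ge0//.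
  by apply: le_trans yb _; rewrite ler_wpM2l.
have d_le n : cmod (dpoch z n) <= sig n * majo rho n.
  elim: n => [|n IH]; first by rewrite dpoch0 cmod0 mulr_ge0.
  by rewrite dpochS sigS -[r ^+ n]mul1r; apply: step => //; rewrite mul1r poch_le.
have [d cd] : exists d, clim (dpoch z) d.
  apply: (@geometric_clim _ _ (S * B * rho + B) r) => // n.
  have -> : dpoch z n.+1 - dpoch z n = - (q ^+ n * (dpoch z n * z + poch n z)).
    by rewrite dpochS; ring.
  rewrite cmodN cmodM cmodX -/r mulrC ler_wpM2r ?exprn_ge0//.
  apply: le_trans (cmodD _ _) _; rewrite cmodM lerD//; last first.
    exact: le_trans (poch_le _ zr) (mB n).
  rewrite ler_pM ?cmod_ge0//; apply: le_trans (d_le n) _.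
  by rewrite ler_pM// sig_le.
apply: (@cdiff_quadratic _ _ _ d (S ^+ 2 * B) 1) => // w wz.
set h := w - z in wz *; have h0 : 0 <= cmod h := cmod_ge0 h.
have wr : cmod w <= rho.
  by rewrite -(subrK z w) addrC (le_trans (cmodD _ _))// lerD2l ltW.
have D_le n : cmod (poch n w - poch n z) <= cmod h * sig n * majo rho n.
  elim: n => [|n IH]; first by rewrite !poch0 subrr cmod0 !mulr_ge0.
  have -> : poch n.+1 w - poch n.+1 z =
      (poch n w - poch n z) * (1 - z * q ^+ n) - q ^+ n * (h * poch n w).
    by rewrite !pochS /h; ring.
  rewrite sigS [cmod h * (_ + _)]mulrDr; apply: step => //; first by rewrite mulr_ge0.
  by rewrite cmodM ler_wpM2l// poch_le.
have R_le n : cmod (poch n w - poch n z - dpoch z n * h) <=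
    cmod h ^+ 2 * sig n ^+ 2 * majo rho n.
  elim: n => [|n IH].
    by rewrite !poch0 subrr dpoch0 mul0r subr0 cmod0 !mulr_ge0 ?exprn_ge0.
  have -> : poch n.+1 w - poch n.+1 z - dpoch z n.+1 * h =
      (poch n w - poch n z - dpoch z n * h) * (1 - z * q ^+ n)
      - q ^+ n * (h * (poch n w - poch n z)).
    by rewrite !pochS dpochS /h; ring.
  have hs0 : 0 <= cmod h ^+ 2 * sig n by rewrite mulr_ge0 ?exprn_ge0.
  have := @step n _ (h * (poch n w - poch n z)) _ (cmod h ^+ 2 * sig n) _ hs0 IH _.
  move=> H; apply: le_trans (H _ _) _.
  - by rewrite mulr_ge0 ?exprn_ge0.
  - by rewrite cmodM expr2 -!mulrA ler_wpM2l// mulrA.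
  rewrite ler_wpM2r// sigS sqrrD -mulrA -mulrDr ler_wpM2l ?exprn_ge0//.
  have : 0 <= sig n * r ^+ n by rewrite mulr_ge0 ?exprn_ge0.
  have : 0 <= (r ^+ n) ^+ 2 by rewrite !exprn_ge0.
  by lra.
apply: clim_bound (climB (climB (poch_clim w) (poch_clim z))
  (climM cd (clim_cst h))) _ => n.
apply: le_trans (R_le n) _.
rewrite [leRHS](_ : _ = cmod h ^+ 2 * S ^+ 2 * B); last by ring.
apply: ler_pM => //; first by rewrite mulr_ge0 ?exprn_ge0.
by rewrite ler_wpM2l ?exprn_ge0// lerXn2r ?nnegrE// sig_le.
Qed.

(** After finitely many nonzero factors the remaining product is close to its
    value [1] at [0]. *)
Lemma qpochhammer_neq0 x : (forall j : nat, x * q ^+ j != 1) ->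
  qpochhammer x q != 0.
Proof.
move=> H.
have recN n : qpochhammer x q = poch n x * qpochhammer (x * q ^+ n) q.
  elim: n => [|n IH]; first by rewrite poch0 mul1r expr0 mulr1.
  have e : q * (x * q ^+ n) = x * q ^+ n.+1 by rewrite exprS mulrCA.
  by rewrite IH pochS (qpochhammer_rec (x * q ^+ n)) e mulrA.
have pn n : poch n x != 0.
  elim: n => [|n IH]; first by rewrite poch0 oner_neq0.
  by rewrite pochS mulf_neq0// subr_eq0 eq_sym.
have [d d0 Hd] := cdiff_ccont (qpochhammer_cdiff 0) ltr01.
have : (fun n => r ^+ n) @ \oo --> 0 by apply: cvg_expr; rewrite ger0_norm.
have X1 : 0 < cmod x + 1 by rewrite ltr_wpDl ?cmod_ge0.
move=> /cvgrPdist_lt /(_ (d / (cmod x + 1)) (divr_gt0 d0 X1)) [N _ HN].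
rewrite (recN N) mulf_neq0//; apply/negP => /eqP E.
have := Hd (x * q ^+ N); rewrite subr0 E qpochhammer0 sub0r cmodN cmod1 ltxx.
move=> /(_ _)/negP; apply=> //; rewrite cmodM cmodX -/r.
have := HN N (leqnn N); rewrite sub0r normrN ger0_norm ?exprn_ge0//.
rewrite ltr_pdivlMr// mulrC; apply: le_lt_trans.
by rewrite ler_wpM2r ?exprn_ge0// lerDl.
Qed.
End QPochhammer.

(** * The theta function *)

Lemma derivable_quotient (K : numFieldType) (f : K -> K) (x : K) :
  derivable (f : K^o -> K^o) x 1 ->
  exists d : K, forall e : K, 0 < e -> exists2 c : K, 0 < c &
    forall h, h != 0 -> `|h| < c -> `|h^-1 * (f (h + x) - f x) - d| < e.
Proof.
rewrite /derivable => /cvg_ex[d /cvgrPdist_lt Hd]; exists d => e e0.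
have := Hd e e0; rewrite /nbhs /= /dnbhs /within /= => -[c c0 Hc].
exists c => // h h0 hc; have := Hc h; rewrite /= sub0r normrN => /(_ hc h0) /=.
by rewrite distrC /GRing.scale /= mulr1.
Qed.

Section Theta.
Variables (R : realType).
Implicit Types (p q x z : R[i]).

Lemma holomorphic_pholo (f : R[i] -> R[i]) : holomorphic_punctured f -> pholo f.
Proof.
move=> hf z z0; have [d Hd] := derivable_quotient (hf z z0).
exists (slope f z d); last by move=> w; exact: slopeE.
move=> e e0; have [|c c0 Hc] := Hd e%:C; first by rewrite (ltcR 0).
have := c0; rewrite ltcE => /andP[/eqP /= Ic Rc].
exists (complex.Re c) => // w wc.
rewrite [slope f z d z](_ : _ = d); last by rewrite /slope eqxx.
rewrite /slope; case: eqP => [_|/eqP wz]; first by rewrite subrr cmod0.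
have := Hc (w - z); rewrite subr_eq0 subrK => /(_ wz).
rewrite mulrC cmodE [`|_ - d|]cmodE ltcR; apply.
by rewrite ltcE /= Ic eqxx.
Qed.

Lemma theta_inv p x : cmod p < 1 -> x != 0 ->
  theta x^-1 p = - x^-1 * theta x p.
Proof.
move=> p1 x0; rewrite /theta invrK (qpochhammer_rec p1 x^-1).
rewrite (qpochhammer_rec p1 x).
by move: (qpochhammer _ p) (qpochhammer _ p) => u v; field.
Qed.

Lemma theta_mulp p x : cmod p < 1 -> p != 0 -> x != 0 ->
  theta (p * x) p = - x^-1 * theta x p.
Proof.
move=> p1 p0 x0; rewrite -(theta_inv p1 x0).
have e1 : p / (p * x) = x^-1 by rewrite invfM mulrA divff// mul1r.
have e2 : p / x^-1 = p * x by rewrite invrK.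
by rewrite /theta e1 e2; exact: mulrC.
Qed.

Lemma theta_sym p x : p != 0 -> x != 0 -> theta (p / x) p = theta x p.
Proof.
move=> p0 x0; have e : p / (p / x) = x by rewrite invfM invrK mulrA divff// mul1r.
by rewrite /theta e; exact: mulrC.
Qed.

Lemma theta_1 p : cmod p < 1 -> theta 1 p = 0.
Proof. by move=> p1; rewrite /theta (qpochhammer_rec p1) subrr !mul0r. Qed.

Lemma pholo_theta p : cmod p < 1 -> p != 0 -> pholo (fun x => theta x p).
Proof.
move=> p1 p0; apply: pholoM => x x0; first exact: qpochhammer_cdiff.
apply: (@cdiff_comp _ (fun x => qpochhammer x p) (fun x => p * x^-1)).
  by apply: cdiffM; [exact: cdiff_cst|exact: cdiffV].
exact: qpochhammer_cdiff.
Qed.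

Lemma theta_neq0 p x : cmod p < 1 -> p != 0 -> x != 0 ->
  (forall k : int, x != p ^ k) -> theta x p != 0.
Proof.
move=> p1 p0 x0 H; rewrite /theta mulf_neq0//.
  apply: qpochhammer_neq0 => // j; apply: contra (H (- j%:Z)) => /eqP E.
  by rewrite -exprnN -[X in _ == X]mul1r -E mulfK// expf_neq0.
apply: qpochhammer_neq0 => // j; apply: contra (H j.+1) => /eqP E.
by rewrite -exprnP exprS -[eqbLHS]mul1r -E; apply/eqP; field.
Qed.

Lemma poch_double n q x : poch q (n + n) x = poch (q ^+ 2) n x * poch (q ^+ 2) n (q * x).
Proof.
elim: n => [|n IH]; first by rewrite !poch0 mulr1.
rewrite addSn addnS !pochS IH -!exprM addnn -mul2n.
rewrite [q ^+ (2 * n).+1]exprS; ring.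
Qed.

Lemma poch_sqr n q x : poch (q ^+ 2) n (x ^+ 2) = poch q n x * poch q n (- x).
Proof.
elim: n => [|n IH]; first by rewrite !poch0 mulr1.
by rewrite !pochS IH -exprM mulnC exprM; ring.
Qed.

Lemma cmod_sqr_lt1 p : cmod p < 1 -> cmod (p ^+ 2) < 1.
Proof. by move=> p1; rewrite cmodX exprn_ilt1 ?cmod_ge0. Qed.

Lemma qpochhammer_double q x : cmod q < 1 ->
  qpochhammer x q = qpochhammer x (q ^+ 2) * qpochhammer (q * x) (q ^+ 2).
Proof.
move=> q1; have q21 := cmod_sqr_lt1 q1.
have h := @clim_comp R _ _ (fun n => n + n)%N (fun n => leq_addr n n) (poch_clim q1 x).
apply: clim_unique h _.
apply: clim_ext (climM (poch_clim q21 x) (poch_clim q21 (q * x))) => n.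
by rewrite /= poch_double.
Qed.

Lemma qpochhammer_sqr q x : cmod q < 1 ->
  qpochhammer (x ^+ 2) (q ^+ 2) = qpochhammer x q * qpochhammer (- x) q.
Proof.
move=> q1; apply: clim_unique (poch_clim (cmod_sqr_lt1 q1) _) _.
apply: clim_ext (climM (poch_clim q1 x) (poch_clim q1 (- x))) => n.
by rewrite poch_sqr.
Qed.

(** The even and the odd powers of [p] give products of nome [p ^+ 2]; those with
    a square argument split further by [1 - x ^+ 2 = (1 - x) * (1 + x)]. *)
Lemma theta_sqr p x : cmod p < 1 -> p != 0 -> x != 0 ->
  theta (x ^+ 2) p = theta x p * theta (- x) p * theta (p * x ^+ 2) (p ^+ 2).
Proof.
move=> p1 p0 x0; rewrite /theta.
rewrite (qpochhammer_double (x ^+ 2) p1) (qpochhammer_double (p / x ^+ 2) p1).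
rewrite (_ : p * (p / x ^+ 2) = (p / x) ^+ 2); last by field.
rewrite !qpochhammer_sqr//.
rewrite (_ : p ^+ 2 / (p * x ^+ 2) = p / x ^+ 2); last by field; rewrite p0 x0.
rewrite (_ : p / - x = - (p / x)); last by rewrite invrN mulrN.
move: (qpochhammer x p) (qpochhammer (- x) p) (qpochhammer (p / x) p)
  (qpochhammer (- (p / x)) p) (qpochhammer (p * x ^+ 2) (p ^+ 2))
  (qpochhammer (p / x ^+ 2) (p ^+ 2)) => x1 x2 x3 x4 x5 x6.
by ring.
Qed.

Lemma expz_between (r : R) (j : int) : 0 < r -> r < 1 ->
  ~ (1 < r ^ j < r^-1).
Proof.
move=> r0 r1; case: j => j /andP[].
  by rewrite -exprnP => h; have := exprn_ile1 j (ltW r0) (ltW r1); lra.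
rewrite NegzE -exprnN => _; rewrite ltf_pV2 ?posrE ?exprn_gt0//.
by rewrite exprS ltNge ler_piMr ?exprn_ile1 ?ltW.
Qed.

(** The quotient of two solutions [t] of [V * t ^+ n = r ^ k] cannot be too close
    to [1], so some interval to the right of [1] contains at most one solution, and
    a smaller one contains none. *)
Lemma avoid_powers (r V : R) n : 0 < r -> r < 1 -> 0 < V -> (0 < n)%N ->
  exists2 d : R, 0 < d &
    forall t, 1 < t -> t < 1 + d -> forall k : int, V * t ^+ n != r ^ k.
Proof.
move=> r0 r1 V0 n0.
have L0 : 0 < - ln r by rewrite oppr_gt0 ln_lt0// r0.
have n0' : 0 < n%:R :> R by rewrite ltr0n.
pose d := - ln r / (2 * n%:R).
have d0 : 0 < d by rewrite divr_gt0// mulr_gt0.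
have dn t : 1 < t -> t < 1 + d -> t ^+ n < r^-1.
  move=> t1 td; apply: (@le_lt_trans _ _ (expR d ^+ n)).
    rewrite lerXn2r ?nnegrE ?expR_ge0//; first lra.
    by rewrite (le_trans (ltW td))// expR_ge1Dx.
  rewrite -expRM_natl -[r in ltRHS]lnK ?posrE// -expRN ltr_expR /d.
  rewrite (_ : n%:R * _ = - ln r / 2); last by field; rewrite gt_eqF.
  lra.
have uniq t1 t2 (k1 k2 : int) : 1 < t1 -> t1 < t2 -> t2 < 1 + d ->
    V * t1 ^+ n = r ^ k1 -> V * t2 ^+ n = r ^ k2 -> False.
  move=> t11 t12 t2d E1 E2; apply: (@expz_between r (k2 - k1)) => //.
  have t10 : 0 < t1 by lra.
  have rr : r != 0 by rewrite gt_eqF.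
  have Ek : r ^ (k2 - k1) = (t2 / t1) ^+ n.
    rewrite expfzDr// -invr_expz -E1 -E2 expr_div_n.
    by field; rewrite expf_neq0 ?gt_eqF.
  rewrite Ek; apply/andP; split.
    by rewrite exprn_egt1 ?lt0n_neq0// ltr_pdivlMr// mul1r.
  apply: le_lt_trans (dn t2 _ t2d); last by lra.
  rewrite lerXn2r ?nnegrE ?divr_ge0//; [lra|lra|lra|].
  by rewrite ler_pdivrMr// ler_peMr; lra.
have [[t0 [t01 [t0d [k0 E0]]]]|H] := pselect (exists t, 1 < t /\ t < 1 + d /\
    exists k : int, V * t ^+ n = r ^ k).
  exists (t0 - 1) => [|t t1 td k]; first by rewrite subr_gt0.
  by apply/negP => /eqP E; apply: (uniq t t0 k k0) => //; lra.
exists d => // t t1 td k; apply/negP => /eqP E; apply: H.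
by exists t; split=> //; split=> //; exists k.
Qed.

(** A nonconstant monomial curve meets the zeros of theta, which are powers of
    [p], in isolated points, hence not at parameters slightly larger than [1]. *)
Lemma theta_curve_neq0 p (v : R[i]) (w : int) : 0 < cmod p -> cmod p < 1 ->
  v != 0 -> w != 0 -> exists2 d : R, 0 < d &
    forall t : R, 1 < t -> t < 1 + d -> theta (v * t%:C ^ w) p != 0.
Proof.
move=> p0 p1 v0 w0; have pn0 : p != 0 by rewrite -cmod_gt0.
have V0 : 0 < cmod v by rewrite cmod_gt0.
have tn0 (t : R) : 1 < t -> t%:C != 0 :> R[i].
  by move=> t1; rewrite -cmod_gt0 cmodr normr_gt0 gt_eqF// (lt_trans ltr01).
have [d d0 Hd] : exists2 d : R, 0 < d &
    forall t, 1 < t -> t < 1 + d -> forall k : int, cmod v * t ^ w != cmod p ^ k.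
  case: w w0 => n n0; first by apply: avoid_powers => //; rewrite lt0n.
  have [|d d0 Hd] := @avoid_powers (cmod p) (cmod v)^-1 n.+1 p0 p1 _ isT.
    by rewrite invr_gt0.
  exists d => // t t1 td k; apply: contra (Hd t t1 td (- k)) => /eqP E.
  by rewrite -invr_expz -E NegzE -exprnN invfM invrK.
exists d => // t t1 td; apply: theta_neq0 => //.
  by rewrite mulf_neq0// expfz_neq0// tn0.
move=> k; apply: contra (Hd t t1 td k) => /eqP E.
by rewrite -cmodXz -E cmodM cmodXz cmodr gtr0_norm// (lt_trans ltr01).
Qed.
End Theta.

(** * Generic parameters and the A-type determinant *)

Section RightNeighbourhood.
Variable R : realType.
Implicit Types (Q S : R -> Prop).

(** Generic parameters are reached along curves whose parameter decreases to [1]. *)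
Definition rnear1 Q := exists2 d : R, 0 < d & forall t, 1 < t -> t < 1 + d -> Q t.

Lemma rnear1_true Q : (forall t, 1 < t -> Q t) -> rnear1 Q.
Proof. by move=> H; exists 1 => // t t1 _; exact: H. Qed.

Lemma rnear1_and Q S : rnear1 Q -> rnear1 S -> rnear1 (fun t => Q t /\ S t).
Proof.
move=> [d d0 Hd] [c c0 Hc]; exists (Num.min d c); first by rewrite lt_min d0.
move=> t t1 td; have dc : t - 1 < Num.min d c by rewrite ltrBlDl.
by move: dc; rewrite lt_min => /andP[? ?]; split; [apply: Hd|apply: Hc]; lra.
Qed.

Lemma rnear1_mono Q S : (forall t, 1 < t -> Q t -> S t) -> rnear1 Q -> rnear1 S.
Proof. by move=> QS [d d0 Hd]; exists d => // t t1 td; apply: QS => //; exact: Hd. Qed.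

Lemma rnear1_all n (Q : nat -> R -> Prop) :
  (forall i, (i < n)%N -> rnear1 (Q i)) ->
  rnear1 (fun t => forall i, (i < n)%N -> Q i t).
Proof.
elim: n => [|n IH] H; first exact: rnear1_true.
have h1 := IH (fun i ni => H i (leq_trans ni (leqnSn n))).
apply: rnear1_mono (rnear1_and h1 (H n (ltnSn n))) => t t1 [h h'] i.
by rewrite ltnS leq_eqVlt => /predU1P[->//|]; exact: h.
Qed.

Lemma ccont_rnear1 (F : R[i] -> R[i]) : ccont F 1 ->
  rnear1 (fun t => F t%:C = 0) -> F 1 = 0.
Proof.
move=> cF [d d0 Hd]; apply: eq0_cmod_le => e e0.
have [c c0 Hc] := cF e e0.
pose t := 1 + Num.min c d / 2.
have m0 : 0 < Num.min c d by rewrite lt_min c0.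
have mc : Num.min c d <= c by rewrite ge_min lexx.
have md : Num.min c d <= d by rewrite ge_min lexx orbT.
have := Hc t%:C; rewrite Hd ?/t; [|lra|lra].
rewrite sub0r cmodN => h; apply/ltW/h.
rewrite -[X in _ - X](rmorph1 (real_complex R)) -rmorphB cmodr ger0_norm; lra.
Qed.
End RightNeighbourhood.

Section TypeA.
Variables (R : realType) (p : R[i]).
Hypothesis p0 : p != 0.
Variable th : R[i] -> R[i].
Hypothesis th_holo : pholo th.
Hypothesis th_p : forall x : R[i], x != 0 -> th (p * x) = - x^-1 * th x.
Hypothesis th_1 : th 1 = 0.
Hypothesis th_inv : forall x : R[i], x != 0 -> th x^-1 = - x^-1 * th x.
Hypothesis th_curve : forall (v : R[i]) (w : int), v != 0 -> w != 0 ->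
  rnear1 (fun t : R => th (v * t%:C ^ w) != 0).

Let qp := qper p.
Let qp_th := qper_th th_holo th_p.

Lemma ccont_th (f : R[i] -> R[i]) z : ccont f z -> f z != 0 ->
  ccont (fun w => th (f w)) z.
Proof. by move=> cf fz; apply: (ccont_comp cf); apply/cdiff_ccont/th_holo. Qed.

Definition matA n (P : nat -> R[i] -> R[i]) (a x : nat -> R[i]) : 'M[R[i]]_n :=
  \matrix_(i < n, j < n) (P j (x i) * \prod_(j.+1 <= k < n) th (a k * x i)).

Definition crossA n (a x : nat -> R[i]) : R[i] :=
  \prod_(j < n) \prod_(i < j) (a j * x j * th (x i / x j)).

Lemma crossAS n a x :
  crossA n.+1 a x = crossA n a x * \prod_(i < n) (a n * x n * th (x i / x n)).
Proof. by rewrite /crossA big_ord_recr. Qed.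

Lemma prod_oppV (I : Type) (s : seq I) (F : I -> R[i]) :
  \prod_(k <- s) - (F k)^-1 = (-1) ^+ size s / \prod_(k <- s) F k.
Proof.
elim: s => [|k s IH]; first by rewrite !big_nil expr0 divr1.
by rewrite !big_cons IH /= exprS invfM; ring.
Qed.

Lemma det_scale_rows n (c : 'I_n -> R[i]) (M : 'M[R[i]]_n) :
  \det (\matrix_(i, j) (c i * M i j)) = \prod_i c i * \det M.
Proof.
have -> : \matrix_(i, j) (c i * M i j) = diag_mx (\row_i c i) *m M.
  by apply/matrixP => i j; rewrite mul_diag_mx !mxE.
by rewrite det_mulmx det_diag; congr (_ * _); apply: eq_bigr => i _; rewrite mxE.
Qed.

Lemma cofactor_max n (M : 'M[R[i]]_n.+1) :
  cofactor M ord_max ord_max =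
  \det (\matrix_(i < n, j < n) M (widen_ord (leqnSn n) i) (widen_ord (leqnSn n) j)).
Proof.
rewrite /cofactor addnn -signr_odd odd_double expr0 mul1r.
congr (\det _); apply/matrixP => i j; rewrite !mxE.
by congr (M _ _); apply/val_inj; rewrite /= /bump leqNgt ltn_ord.
Qed.

Definition upd (x : nat -> R[i]) n z : nat -> R[i] := fun i => if i == n then z else x i.

Lemma upd_eq x n z : upd x n z n = z. Proof. by rewrite /upd eqxx. Qed.
Lemma upd_neq x n z i : i != n -> upd x n z i = x i.
Proof. by rewrite /upd => /negbTE ->. Qed.
Lemma upd_lt x n z i : (i < n)%N -> upd x n z i = x i.
Proof. by move=> ni; rewrite upd_neq// ltn_eqF. Qed.

Section Step.
Variables (n : nat) (t : R[i]) (P : nat -> R[i] -> R[i]) (a x : nat -> R[i]).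
Hypotheses (t0 : t != 0) (a0 : forall k, a k != 0) (x0 : forall k, x k != 0).
Hypothesis hP : forall j, (j < n.+1)%N ->
  qp j.+1 ((-1) ^+ j.+1 / (t / \prod_(j.+1 <= k < n.+1) a k)) (P j).

Let an := a n.
Let X := \prod_(i < n) x i.
Let D z := \det (matA n.+1 P a (upd x n z)).
Let E z := th (t * X * z) * \prod_(i < n) (z * th (x i / z)).

Let X0 : X != 0. Proof. by apply/prodf_neq0 => i _. Qed.

Lemma matA_entry_qper j : (j < n.+1)%N -> qp n.+1 ((-1) ^+ n.+1 / t)
  (fun z => P j z * \prod_(j.+1 <= k < n.+1) th (a k * z)).
Proof.
move=> jn; have := qperM (hP jn) (@qper_prod _ _ _ (index_iota j.+1 n.+1) predT
  (fun=> 1%N) (fun k => - (a k)^-1) (fun k z => th (a k * z))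
  (fun k _ => qp_th (a0 k))).
rewrite sum_nat_const_nat muln1 subSS addSn subnKC//; congr (qper _ _ _ _).
rewrite prod_oppV size_iota.
have A0 : \prod_(j.+1 <= k < n.+1) a k != 0.
  by rewrite prodf_seq_neq0; apply/allP => k _; exact/implyP.
rewrite -[in RHS](subnKC jn) exprD subSS.
by field; rewrite t0 A0.
Qed.

Lemma detA_qper : qp n.+1 ((-1) ^+ n.+1 / t) D.
Proof.
pose cof (j : 'I_n.+1) := cofactor (matA n.+1 P a x) ord_max j.
apply: (@qper_ext _ p _ _ (fun z => \sum_(j < n.+1) cof j *
   (P j z * \prod_(j.+1 <= k < n.+1) th (a k * z)))) => [z|].
  rewrite /D (expand_det_row _ ord_max); apply: eq_bigr => j _.
  rewrite mxE upd_eq; apply: etrans (mulrC _ _) _; congr (_ * _).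
  rewrite /cof /cofactor.
  congr (_ * \det _); apply/matrixP => i k; rewrite !mxE upd_neq//.
  by rewrite eq_sym neq_lift.
by apply: qper_sum => j; apply: qperZ; apply: matA_entry_qper.
Qed.

Lemma EA_qper : qp n.+1 ((-1) ^+ n.+1 / t) E.
Proof.
have tX0 : t * X != 0 by rewrite mulf_neq0.
split=> [z z0|z z0].
  apply: cdiffM; first exact: (qp_th tX0).1.
  apply: cdiff_prod => i _; apply: cdiffM; first exact: cdiff_id.
  apply: (@cdiff_comp _ th (fun z => x i / z)).
    by apply: cdiffM; [exact: cdiff_cst|exact: cdiffV].
  by apply: th_holo; rewrite mulf_neq0 ?invr_neq0.
have EE y : y != 0 ->
    E y = th (t * X * y) * \prod_(i < n) (- x i * th ((x i)^-1 * y)).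
  move=> y0; congr (_ * _); apply: eq_bigr => i _.
  have -> : x i / y = ((x i)^-1 * y)^-1 by rewrite invfM invrK mulrC.
  have xi := x0 i; rewrite th_inv ?mulf_neq0 ?invr_neq0//.
  by field; rewrite y0 xi.
rewrite !EE ?mulf_neq0//.
have := qperM (qp_th tX0) (@qper_prod _ _ _ (index_enum 'I_n) predT
  (fun=> 1%N) (fun i => - (x i)^-1^-1) (fun i z => - x i * th ((x i)^-1 * z)) _).
rewrite sum1_card card_ord => -[i _|_ ->//].
  by apply: qperZ; apply: qp_th; rewrite invr_neq0.
rewrite add1n; congr (_ * _ * _); rewrite prodrN card_ord.
under eq_bigr do rewrite invrK.
by rewrite -/X exprS; field; rewrite t0 X0.
Qed.

(** Every entry of the last row but the last contains the factor [th 1]. *)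
Lemma detA_at_inv : D an^-1 =
  P n an^-1 * (\prod_(i < n) th (an * x i) * \det (matA n P a x)).
Proof.
rewrite /D (expand_det_row _ ord_max) big_ord_recr /= big1 ?add0r => [|j _].
  rewrite mxE /= upd_eq big_geq// mulr1 cofactor_max -det_scale_rows.
  congr (_ * \det _); apply/matrixP => i j; rewrite !mxE /= upd_lt//.
  by rewrite big_nat_recr//= mulrA mulrC.
rewrite mxE /= upd_eq big_nat_recr//= mulfV ?a0// th_1.
by rewrite !mulr0 mul0r.
Qed.

Hypothesis gen_t : th (t * X / an) != 0.
Hypothesis gen_a : forall i, (i < n)%N -> th (x i * an) != 0.
Hypothesis gen_x : forall i j, (i < n)%N -> (j < n)%N -> i != j ->
  th (x i / x j) != 0.

(** As functions of [z] both sides have the same multiplier; both vanish at the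
    [x i], and they agree at [an^-1]. *)
Lemma detA_prop z : z != 0 -> D z * E an^-1 = D an^-1 * E z.
Proof.
move=> z0; apply/eqP; rewrite -subr_eq0; apply/eqP.
pose y (i : 'I_n.+1) := upd x n an^-1 i.
have an0 : an != 0 by exact: a0.
have y0 i : y i != 0 by rewrite /y /upd; case: ifP; rewrite ?invr_neq0.
apply: (@qper_zeros _ p p0 th th_holo th_p th_1 n.+1 t y
  (fun z => D z * E an^-1 - D an^-1 * E z)) => //.
- rewrite big_ord_recr /= /y upd_eq mulrA.
  by under eq_bigr => i _ do rewrite upd_lt//=.
- have th_inv0 v : v != 0 -> th v != 0 -> th v^-1 != 0.
    by move=> v0 h; rewrite th_inv// mulf_neq0// oppr_eq0 invr_neq0.
  move=> i j ij; rewrite /y /upd; case: ifPn => /eqP ni; case: ifPn => /eqP nj.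
  + by move: ij; rewrite -val_eqE /= ni nj eqxx.
  + rewrite -[X in th X]invrK; apply: th_inv0.
      by rewrite !(invr_neq0, mulf_neq0).
    rewrite invfM !invrK mulrC; apply: gen_a.
    by rewrite ltn_neqAle -ltnS ltn_ord andbT; apply/eqP.
  + rewrite invrK; apply: gen_a.
    by rewrite ltn_neqAle -ltnS ltn_ord andbT; apply/eqP.
  + by apply: gen_x => //; rewrite ltn_neqAle -ltnS ltn_ord andbT; apply/eqP.
- apply: qperB; last exact: qperZ EA_qper.
  by apply: qper_ext (qperZ (E an^-1) detA_qper) => w; rewrite mulrC.
- move=> i; rewrite /y /upd; case: ifPn => [_|/eqP ni].
    by rewrite subrr.
  have ni' : (i < n)%N by rewrite ltn_neqAle -ltnS ltn_ord andbT; apply/eqP.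
  have -> : D (x i) = 0.
    apply: (@determinant_alternate _ _ _ i ord_max) => [|j].
      by rewrite -val_eqE /= ltn_eqF.
    by rewrite !mxE upd_eq upd_lt.
  have -> : E (x i) = 0.
    rewrite /E (bigD1 (Ordinal ni'))//= divff// th_1.
    by rewrite mulr0 mul0r mulr0.
  by rewrite mul0r mulr0 subrr.
Qed.

Lemma detA_generic : th (t / \prod_(k < n.+1) a k) * \det (matA n P a x) =
    \prod_(i < n) P i (a i)^-1 * th (t / an * X) * crossA n a x ->
  th (t / \prod_(k < n.+1) a k) * \det (matA n.+1 P a x) =
    \prod_(i < n.+1) P i (a i)^-1 * th (t * \prod_(i < n.+1) x i) * crossA n.+1 a x.
Proof.
move=> IH; have := detA_prop (x0 n); rewrite detA_at_inv.
have -> : D (x n) = \det (matA n.+1 P a x).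
  congr (\det _); apply/matrixP => i j; rewrite !mxE.
  by rewrite /upd; case: eqP => // ->.
rewrite crossAS !big_ord_recr /= -/an -/X.
have -> : E an^-1 = th (t * X / an) * (an^-1 ^+ n * \prod_(i < n) th (an * x i)).
  rewrite /E big_split /= prodr_const card_ord; congr (_ * (_ * _)).
  by apply: eq_bigr => i _; rewrite invrK mulrC.
have -> : E (x n) = th (t * (X * x n)) * \prod_(i < n) (x n * th (x i / x n)).
  by rewrite /E mulrA.
have -> : \prod_(i < n) (an * x n * th (x i / x n)) =
    an ^+ n * \prod_(i < n) (x n * th (x i / x n)).
  under eq_bigr do rewrite -mulrA.
  by rewrite big_split /= prodr_const card_ord.
have T0 : \prod_(i < n) th (an * x i) != 0.
  by apply/prodf_neq0 => i _; rewrite mulrC gen_a.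
have an0 : an ^+ n != 0 by rewrite expf_neq0 ?a0.
move: IH T0 gen_t; rewrite big_ord_recr /= -/an [t / an * X]mulrAC exprVn.
set G := th (t * X / an); set T := \prod_(i < n) th (an * x i).
set B := th (t / _); set W := \prod_(i < n) (x n * _).
set dA := \det (matA n P a x); set d := \det _; set S := th (t * _).
set Q := \prod_(i < n) _; set cr := crossA n a x.
move=> IH T0 G0 H.
apply: (mulIf (mulf_neq0 (mulf_neq0 G0 T0) (invr_neq0 an0))) => /=.
transitivity (B * (d * (G * (an ^- n * T)))); first by ring.
rewrite H; transitivity ((B * dA) * P n an^-1 * T * S * W); first by ring.
by rewrite IH; field.
Qed.
End Step.

Lemma rnear1_exprz (v : R[i]) (w : nat) : v != 0 -> (0 < w)%N ->
  rnear1 (fun t : R => th (v * t%:C ^+ w) != 0).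
Proof. by move=> v0 w0; apply: (th_curve (w := w%:Z)) => //; rewrite eqz_nat lt0n_neq0. Qed.

(** The A-type determinant, by induction on the size: as a function of the
    last variable it lies in a multiplier space and vanishes at the other
    variables, and at the last [(a k)^-1] it reduces to a smaller one. This
    needs generic variables; the rest follows by continuity. *)
Lemma detA n (t : R[i]) (P : nat -> R[i] -> R[i]) (a x : nat -> R[i]) :
  t != 0 -> (forall k, a k != 0) -> (forall k, x k != 0) ->
  (forall j, (j < n)%N ->
    qp j.+1 ((-1) ^+ j.+1 / (t / \prod_(j.+1 <= k < n) a k)) (P j)) ->
  th (t / \prod_(k < n) a k) != 0 ->
  th (t / \prod_(k < n) a k) * \det (matA n P a x) =
    \prod_(i < n) P i (a i)^-1 * th (t * \prod_(i < n) x i) * crossA n a x.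
Proof.
elim: n t x => [|n IH] t x t0 a0 x0 hP tA.
  by rewrite /crossA !big_ord0 divr1 det_mx00 !mulr1 mul1r.
(* The exponents are distinct, so no quotient of two variables is constant. *)
pose xx (z : R[i]) i := x i * z ^+ i.+1.
have gen (y : nat -> R[i]) : (forall k, y k != 0) -> th (t * \prod_(i < n) y i / a n) != 0 ->
    (forall i, (i < n)%N -> th (y i * a n) != 0) ->
    (forall i j, (i < n)%N -> (j < n)%N -> i != j -> th (y i / y j) != 0) ->
  th (t / \prod_(k < n.+1) a k) * \det (matA n.+1 P a y) =
    \prod_(i < n.+1) P i (a i)^-1 * th (t * \prod_(i < n.+1) y i) * crossA n.+1 a y.
  move=> y0 g1 g2 g3; apply: (@detA_generic n t P a y t0 a0 y0 hP) => //.
  have E : t / \prod_(k < n.+1) a k = t / a n / \prod_(k < n) a k.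
    by rewrite big_ord_recr /= invfM; ring.
  rewrite E; apply: IH => //; first by rewrite mulf_neq0 ?invr_neq0.
    move=> j jn; have := hP j (leq_trans jn (leqnSn n)).
    rewrite (_ : t / \prod_(j.+1 <= k < n.+1) a k =
      t / a n / \prod_(j.+1 <= k < n) a k)//.
    by rewrite big_nat_recr//= invfM; ring.
  by rewrite -E.
pose F z := th (t / \prod_(k < n.+1) a k) * \det (matA n.+1 P a (xx z)) -
  \prod_(i < n.+1) P i (a i)^-1 * th (t * \prod_(i < n.+1) xx z i) *
  crossA n.+1 a (xx z).
have xx1 : xx 1 = x by apply/funext => i; rewrite /xx expr1n mulr1.
suff : F 1 = 0 by move=> /eqP; rewrite subr_eq0 xx1 => /eqP.
have cxx i : ccont (fun z => xx z i) 1.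
  by apply: ccontM; [exact: ccont_cst|apply: ccontX; exact: ccont_id].
have nxx i : xx 1 i != 0 by rewrite xx1.
apply: ccont_rnear1.
  apply: ccontB.
    apply: ccontM; first exact: ccont_cst.
    apply: (@ccont_det _ _ (fun z => matA n.+1 P a (xx z))) => i j.
    apply: (@ccont_ext _ (fun z => P j (xx z i) *
      \prod_(j.+1 <= k < n.+1) th (a k * xx z i))) => [z|]; first by rewrite mxE.
    apply: ccontM.
      apply: (@ccont_comp _ (P j) (fun z => xx z i)) => //.
      by apply/cdiff_ccont/(hP j (ltn_ord j)).1.
    apply: ccont_prod => k _; apply: ccont_th; last by rewrite mulf_neq0.
    by apply: ccontM => //; exact: ccont_cst.
  apply: ccontM; first apply: ccontM; first exact: ccont_cst.
    apply: ccont_th.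
      by apply: ccontM; [exact: ccont_cst|apply: ccont_prod].
    by rewrite mulf_neq0//; apply/prodf_neq0.
  apply: ccont_prod => j _; apply: ccont_prod => i _; apply: ccontM.
    by apply: ccontM => //; exact: ccont_cst.
  apply: ccont_th; last by rewrite mulf_neq0 ?invr_neq0.
  by apply: ccontM => //; exact: ccont_inv.
have nt (s : R) : 1 < s -> s%:C != 0 :> R[i].
  by move=> s1; rewrite -cmod_gt0 cmodr normr_gt0 gt_eqF// (lt_trans ltr01).
have h1 : rnear1 (fun s : R => th (t * \prod_(i < n) xx s%:C i / a n) != 0).
  pose w := (\sum_(i < n) i.+1)%N.
  have E s : t * \prod_(i < n) xx s i / a n =
      t * (\prod_(i < n) x i) / a n * s ^+ w.
    by rewrite /xx big_split /= prodrXr -/w; ring.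
  have X0 : \prod_(i < n) x i != 0 by apply/prodf_neq0.
  case: (posnP n) => [n0|n0].
    apply: rnear1_true => s _; move: tA; rewrite big_ord_recr /= n0 !big_ord0.
    by rewrite mulr1 mul1r.
  apply: rnear1_mono (rnear1_exprz (v := t * (\prod_(i < n) x i) / a n) (w := w) _ _).
  - by move=> s _; rewrite E.
  - by rewrite !mulf_neq0 ?invr_neq0.
  - by rewrite /w; case: (n) n0 => // m _; rewrite big_ord_recl.
have h2 : rnear1 (fun s : R => forall i, (i < n)%N -> th (xx s%:C i * a n) != 0).
  apply: rnear1_all => i _.
  apply: rnear1_mono (rnear1_exprz (v := x i * a n) (w := i.+1) _ _) => //.
    by move=> s _; rewrite /xx mulrAC.
  by rewrite mulf_neq0.
have h3 : rnear1 (fun s : R => forall i, (i < n)%N -> forall j, (j < n)%N ->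
    i != j -> th (xx s%:C i / xx s%:C j) != 0).
  apply: rnear1_all => i _; apply: rnear1_all => j _.
  have [<-|ij] := eqVneq i j; first by apply: rnear1_true.
  apply: rnear1_mono (th_curve (v := x i / x j) (w := i%:Z - j%:Z) _ _).
  - move=> s s1 + _; congr (th _ != 0); rewrite expfzDr ?nt// -invr_expz -!exprnP.
    have sn := nt _ s1; have xj := x0 j.
    have : s%:C ^+ j != 0 :> R[i] by rewrite expf_neq0.
    rewrite /xx !exprS; move: (s%:C ^+ i) (s%:C ^+ j) => u v v0.
    by field; rewrite xj v0 sn.
  - by rewrite mulf_neq0 ?invr_neq0.
  - by rewrite subr_eq0 eqz_nat.
apply: rnear1_mono (rnear1_and h1 (rnear1_and h2 h3)) => s s1 [g1 [g2 g3]].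
have xs0 k : xx s%:C k != 0 by rewrite /xx mulf_neq0// expf_neq0// nt.
have g3' i j : (i < n)%N -> (j < n)%N -> i != j -> th (xx s%:C i / xx s%:C j) != 0.
  by move=> ni nj; exact: g3.
by rewrite /F (gen _ xs0 g1 g2 g3') subrr.
Qed.
End TypeA.

(** * Theta functions with an inversion symmetry *)

Section TypeC.
Variables (R : realType) (p : R[i]).
Hypothesis p0 : p != 0.
Variable th : R[i] -> R[i].
Hypothesis th_holo : pholo th.
Hypothesis th_p : forall x : R[i], x != 0 -> th (p * x) = - x^-1 * th x.
Hypothesis th_1 : th 1 = 0.
Hypothesis th_N1 : th (-1) != 0.
Hypothesis th_inv : forall x : R[i], x != 0 -> th x^-1 = - x^-1 * th x.
Variable ph : R[i] -> R[i].
Hypothesis ph_holo : pholo ph.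
Hypothesis ph_p : forall x : R[i], x != 0 -> ph (p * x) = - (p * x ^+ 2)^-1 * ph x.
Hypothesis ph_inv : forall x : R[i], x != 0 -> ph x^-1 = ph x.
Hypothesis th_sqr : forall x : R[i], x != 0 -> th (x ^+ 2) = th x * th (- x) * ph x.

Let qp := qper p.
Let qp_th := qper_th th_holo th_p.

(** The symmetry classes, under inversion, of the entries of the determinant
    and of the cross factors of its value. *)
Definition odd_theta m (f : R[i] -> R[i]) :=
  qp m.*2.+1 (p ^- m) f /\ forall z, z != 0 -> f z^-1 = - z^-1 * f z.

Definition even_theta m (f : R[i] -> R[i]) :=
  qp m.*2 (p ^- m) f /\ forall z, z != 0 -> f z^-1 = f z.

Lemma even_theta_cst (c : R[i]) : even_theta 0 (fun=> c).
Proof. by split=> //; rewrite invr1; exact: qper_cst. Qed.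

Lemma even_thetaM m1 m2 f g : even_theta m1 f -> even_theta m2 g ->
  even_theta (m1 + m2) (fun z => f z * g z).
Proof.
move=> [qf If] [qg Ig]; split=> [|z z0]; last by rewrite If// Ig.
by rewrite doubleD exprD invfM; exact: qperM.
Qed.

Lemma odd_even_thetaM m1 m2 f g : odd_theta m1 f -> even_theta m2 g ->
  odd_theta (m1 + m2) (fun z => f z * g z).
Proof.
move=> [qf If] [qg Ig]; split=> [|z z0]; last by rewrite If// Ig// mulrA.
by rewrite doubleD -addSn exprD invfM; exact: qperM.
Qed.

Lemma even_theta_prod (I : Type) (r : seq I) (m : I -> nat) (F : I -> R[i] -> R[i]) :
  (forall i, even_theta (m i) (F i)) ->
  even_theta (\sum_(i <- r) m i) (fun z => \prod_(i <- r) F i z).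
Proof.
move=> hF; elim: r => [|i r IH].
  rewrite big_nil (_ : (fun=> _) = fun=> 1); first exact: even_theta_cst.
  by apply/funext => z; rewrite big_nil.
rewrite big_cons (_ : (fun z => _) = fun z => F i z * \prod_(j <- r) F j z).
  exact: even_thetaM.
by apply/funext => z; rewrite big_cons.
Qed.

Lemma odd_thetaZ m (c : R[i]) f : odd_theta m f -> odd_theta m (fun z => c * f z).
Proof.
move=> [qf If]; split=> [|z z0]; first exact: qperZ.
by rewrite If// mulrCA.
Qed.

Lemma odd_thetaB m f g : odd_theta m f -> odd_theta m g ->
  odd_theta m (fun z => f z - g z).
Proof.
move=> [qf If] [qg Ig]; split=> [|z z0]; first exact: qperB.
by rewrite If// Ig// mulrBr.
Qed.

Lemma odd_theta_sum m (I : Type) (r : seq I) (F : I -> R[i] -> R[i]) :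
  (forall i, odd_theta m (F i)) -> odd_theta m (fun z => \sum_(i <- r) F i z).
Proof.
move=> hF; split=> [|z z0]; first by apply: qper_sum => i; exact: (hF i).1.
by rewrite mulr_sumr; apply: eq_bigr => i _; exact: (hF i).2.
Qed.

(** Inversion exchanges the two terms up to the factor [- z^-1], and the exponent
    [2m+1] is the one for which both terms have the same multiplier. *)
Lemma odd_theta_antisym m f : qp m.*2.+1 (p ^- m) f ->
  odd_theta m (fun z => f z - z * f z^-1).
Proof.
move=> [hf Ef]; split; last first.
  by move=> z z0; rewrite invrK; field.
apply: qperB => //; split.
  by apply: pholoM; [move=> w _; exact: cdiff_id|exact: pholo_inv].
move=> z z0; have pz0 : p * z != 0 by rewrite mulf_neq0.
have := Ef (p * z)^-1; rewrite invr_neq0// => /(_ isT).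
rewrite (_ : p * (p * z)^-1 = z^-1); last by field; rewrite z0 p0.
move=> ->; rewrite exprVn invrK -mul2n !exprS exprMn !mul2n -addnn !exprD.
have zm : z ^+ m != 0 by rewrite expf_neq0.
have pm : p ^+ m != 0 by rewrite expf_neq0.
by field; rewrite z0 zm pm.
Qed.

Lemma th_expp (k : nat) (z : R[i]) : z != 0 -> th z != 0 -> th (p ^+ k * z) != 0.
Proof.
move=> z0 tz; elim: k => [|k IH]; first by rewrite expr0 mul1r.
have pz0 : p ^+ k * z != 0 by rewrite mulf_neq0// expf_neq0.
by rewrite exprS -mulrA th_p// mulf_neq0// oppr_eq0 invr_neq0.
Qed.

Lemma th_inv_neq0 (z : R[i]) : z != 0 -> th z != 0 -> th z^-1 != 0.
Proof. by move=> z0 h; rewrite th_inv// mulf_neq0// oppr_eq0 invr_neq0. Qed.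

Definition generic n (x : nat -> R[i]) :=
  forall i, (i < n)%N -> th (x i) != 0 /\
  forall j, (j < n)%N -> th (x i * x j) != 0 /\ (i != j -> th (x i / x j) != 0).

(* [1], the [x i] and their inverses *)
Let point n (x : nat -> R[i]) (k : 'I_n + 'I_n + 'I_1) : R[i] :=
  match k with inl (inl i) => x i | inl (inr i) => (x i)^-1 | inr _ => 1 end.

(* the enumeration of these points by an ordinal, as [qper_zeros] expects *)
Let decode n (k : 'I_(n + n + 1)) : 'I_n + 'I_n + 'I_1 :=
  match fintype.split k with inl l => inl (fintype.split l) | inr u => inr u end.

Let decode_inj n : injective (@decode n).
Proof.
pose encode (k : 'I_n + 'I_n + 'I_1) : 'I_(n + n + 1) :=
  unsplit (match k with inl l => inl (unsplit l) | inr u => inr u end).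
apply: (can_inj (g := encode)) => k; rewrite /encode /decode.
case E: (fintype.split k) => [l|u]; first by rewrite splitK -E splitK.
by rewrite -E splitK.
Qed.

(** An odd theta function vanishes at [1], and at [z^-1] whenever it vanishes
    at [z]. This makes [2n+1] zeros with product [1], which are generic for the
    norm [- p ^+ n] because [-1] is not a power of [p]. *)
Lemma odd_theta_zeros n (x : nat -> R[i]) f : (forall k, x k != 0) ->
  generic n x -> odd_theta n f -> (forall i, (i < n)%N -> f (x i) = 0) ->
  forall z, z != 0 -> f z = 0.
Proof.
move=> x0 gx [qf If] fx.
have f1 : f 1 = 0.
  have := If 1 (oner_neq0 _); rewrite invr1 mulN1r => /eqP.
  by rewrite -addr_eq0 -mulr2n mulrn_eq0 /= => /eqP.
have nn : (n + n + 1 = n.*2.+1)%N by rewrite addn1 addnn.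
pose y (k : 'I_(n + n + 1)) := point x (decode k).
have pt0 k : point x k != 0 by case: k => [[i|i]|u] /=; rewrite ?invr_neq0 ?oner_neq0.
have prod_y : \prod_k y k = 1.
  rewrite big_split_ord big_split_ord big_ord1 /= /y /decode.
  rewrite (unsplitK (inr ord0)) /= mulr1.
  have -> : \prod_(i < n) point x
      match fintype.split (lshift 1 (lshift n i)) with
      | inl l => inl (fintype.split l) | inr u => inr u end = \prod_(i < n) x i.
    by apply: eq_bigr => i _; rewrite (unsplitK (inl (lshift n i))) (unsplitK (inl i)).
  have -> : \prod_(i < n) point x
      match fintype.split (lshift 1 (rshift n i)) with
      | inl l => inl (fintype.split l) | inr u => inr u end = \prod_(i < n) (x i)^-1.
    by apply: eq_bigr => i _; rewrite (unsplitK (inl (rshift n i))) (unsplitK (inr i)).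
  by rewrite prodfV divff//; apply/prodf_neq0.
have pn0 : p ^+ n != 0 by rewrite expf_neq0.
apply: (@qper_zeros _ p p0 th th_holo th_p th_1 (n + n + 1) (- p ^+ n) y).
- by rewrite addn1.
- by rewrite oppr_eq0.
- by move=> k; exact: pt0.
- by rewrite prod_y mulr1 -mulrN1; apply: th_expp; rewrite // oppr_eq0 oner_neq0.
- move=> k l kl; rewrite /y.
  have : decode k != decode l by apply: contra kl => /eqP/decode_inj ->.
  move: (decode k) (decode l) => {kl}.
  have V i : (i < n)%N -> th (x i)^-1 != 0.
    by move=> ni; apply: th_inv_neq0 => //; have [] := gx i ni.
  have xx i j : (i < n)%N -> (j < n)%N -> th (x i * x j) != 0.
    by move=> ni nj; have [_ /(_ j nj)[]] := gx i ni.
  have dx i j : (i < n)%N -> (j < n)%N -> i != j -> th (x i / x j) != 0.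
    by move=> ni nj; have [_ /(_ j nj)[]] := gx i ni.
  move=> [[i|i]|u] [[j|j]|v] /= ne.
  + by apply: dx => //; apply: contra ne => /eqP/val_inj ->.
  + by rewrite invrK; apply: xx.
  + by rewrite divr1; have [] := gx i (ltn_ord i).
  + by rewrite -invfM; apply: th_inv_neq0; rewrite ?mulf_neq0//; apply: xx.
  + rewrite invrK mulrC; apply: dx => //.
    by apply: contra ne => /eqP/val_inj ->.
  + by rewrite divr1; apply: V.
  + by rewrite mul1r; apply: V.
  + by rewrite invrK mul1r; have [] := gx j (ltn_ord j).
  + by move: ne; rewrite (ord1 u) (ord1 v) eqxx.
- rewrite (_ : (-1) ^+ _ / _ = p ^- n); first by rewrite nn.
  rewrite nn exprS -signr_odd odd_double expr0 mulr1.
  by field.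
- move=> k; rewrite /y; case: (decode k) => [[i|i]|u] /=; first exact: fx.
    by rewrite If// fx// mulr0.
  exact: f1.
Qed.

Definition crossC n (x : nat -> R[i]) : R[i] :=
  \prod_(j < n) \prod_(i < j) ((x i)^-1 * (th (x i * x j) * th (x i / x j))).

Definition weylC n (x : nat -> R[i]) : R[i] :=
  \prod_(i < n) (th (x i) * ph (x i)) * crossC n x.

Lemma th_divp (w : R[i]) : w != 0 -> th (w / p) = - (w / p) * th w.
Proof.
move=> w0; have wp : w / p != 0 by rewrite mulf_neq0// invr_neq0.
have -> : th w = - (w / p)^-1 * th (w / p) by rewrite -th_p// mulrC divfK.
by rewrite mulrA mulrNN divff// mul1r.
Qed.

Lemma cross_even_r (a : R[i]) : a != 0 ->
  even_theta 1 (fun z => a^-1 * (th (a * z) * th (a / z))).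
Proof.
move=> a0; split; last by move=> z z0; rewrite invrK [th (a / z) * _]mulrC.
apply: qperZ; split.
  apply: pholoM; first exact: (qp_th a0).1.
  by apply: (@pholo_inv _ (fun w => th (a * w))); exact: (qp_th a0).1.
move=> z z0; have az : a * z != 0 by rewrite mulf_neq0.
have azV : a / z != 0 by rewrite mulf_neq0// invr_neq0.
rewrite (mulrCA a p) th_p// (_ : a / (p * z) = a / z / p).
  by rewrite th_divp//; field; rewrite z0 a0 p0.
by rewrite invfM; ring.
Qed.

Lemma cross_even_l (b : R[i]) : b != 0 ->
  even_theta 1 (fun z => z^-1 * (th (z * b) * th (z / b))).
Proof.
move=> b0; have E z : z != 0 -> z^-1 * (th (z * b) * th (z / b)) =
    - (b^-1 * (th (b * z) * th (b / z))).
  move=> z0; have bz : b / z != 0 by rewrite mulf_neq0// invr_neq0.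
  rewrite (_ : z / b = (b / z)^-1) ?th_inv//; last by rewrite invfM invrK mulrC.
  by rewrite [z * b]mulrC; field; rewrite z0 b0.
have [[h1 h2] h3] := cross_even_r b0; split; last first.
  by move=> z z0; rewrite !E ?invr_neq0// h3.
split.
  apply: pholoM; first by move=> z z0; apply: cdiffV.
  apply: pholoM => z z0.
    have := (qp_th b0).1 z z0; apply: cdiff_ext => w; by rewrite mulrC.
  have bV : b^-1 != 0 by rewrite invr_neq0.
  have := (qp_th bV).1 z z0; apply: cdiff_ext => w; by rewrite mulrC.
by move=> z z0; rewrite !E ?mulf_neq0// h2// mulrN.
Qed.

(** The number of cross factors in which the variable of index [k] occurs. *)
Lemma count_pairs n k : (k < n)%N ->
  (\sum_(j < n) \sum_(i < j) ((i == k :> nat) + (j == k :> nat)) = n.-1)%N.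
Proof.
elim: n => // n IH; rewrite ltnS leq_eqVlt => /predU1P[->|kn].
  rewrite big_ord_recr /= big1 => [|j _]; last first.
    by rewrite big1// => i _; rewrite !ltn_eqF// (ltn_trans (ltn_ord i)).
  rewrite add0n (eq_bigr (fun=> 1%N)) => [|i _]; first by rewrite sum1_card card_ord.
  by rewrite eqxx ltn_eqF.
rewrite big_ord_recr /= IH//= (eq_bigr (fun i : 'I_n => (i == k :> nat) : nat)).
  rewrite (bigD1 (Ordinal kn))//= eqxx big1 => [|i ik].
    by rewrite addn0 addn1 prednK// (leq_trans _ kn).
  by move: ik; rewrite -val_eqE /= => /negbTE ->.
by move=> i _; rewrite (gtn_eqF kn) addn0.
Qed.

Lemma weylC_odd n k (x : nat -> R[i]) : (k < n)%N -> (forall i, x i != 0) ->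
  odd_theta n (fun z => weylC n (upd x k z)).
Proof.
move=> kn x0.
have diag : odd_theta 1 (fun z => th z * ph z).
  split=> [|z z0]; last by rewrite th_inv// ph_inv// mulrA.
  split=> [|z z0]; first exact: pholoM.
  by rewrite th_p// ph_p//; field; rewrite z0 p0.
have cross : even_theta n.-1 (fun z => crossC n (upd x k z)).
  rewrite -(count_pairs kn); apply: even_theta_prod => j.
  apply: even_theta_prod => i.
  have ji : (i == j :> nat) = false by rewrite ltn_eqF.
  rewrite /upd; have [ik|ik] := eqVneq (i : nat) k.
    by rewrite -ik eq_sym ji; apply: cross_even_l.
  have [jk|jk] := eqVneq (j : nat) k; first exact: cross_even_r.
  exact: even_theta_cst.
have dk : odd_theta 1 (fun z => \prod_(i < n) (th (upd x k z i) * ph (upd x k z i))).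
  pose c := \prod_(i < n | i != Ordinal kn) (th (x i) * ph (x i)).
  rewrite (_ : (fun z => _) = fun z => c * (th z * ph z)); first exact: odd_thetaZ.
  apply/funext => z; rewrite (bigD1 (Ordinal kn))//= upd_eq mulrC; congr (_ * _).
  by apply: eq_bigr => i ik; rewrite upd_neq.
by have := odd_even_thetaM dk cross; rewrite add1n (ltn_predK kn).
Qed.
Section Exchange.
Variables (n : nat) (g : nat -> R[i] -> R[i]).
Hypothesis hg : forall j, (j < n)%N -> odd_theta n (g j).

Let D (x : nat -> R[i]) := \det (\matrix_(i < n, j < n) g j (x i)).

Lemma detC_odd k (x : nat -> R[i]) : (k < n)%N -> odd_theta n (fun z => D (upd x k z)).
Proof.
move=> kn; pose k' := Ordinal kn.
pose cof (j : 'I_n) := cofactor (\matrix_(i < n, j < n) g j (x i)) k' j.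
rewrite (_ : (fun z => _) = fun z => \sum_(j < n) cof j * g j z).
  by apply: odd_theta_sum => j; apply: odd_thetaZ; apply: hg.
apply/funext => z; rewrite /D (expand_det_row _ k'); apply: eq_bigr => j _.
rewrite mxE upd_eq; apply: etrans (mulrC _ _) _; congr (_ * _).
rewrite /cof /cofactor.
congr (_ * \det _); apply/matrixP => i l; rewrite !mxE upd_neq//.
by have := neq_lift k' i; rewrite -val_eqE eq_sym.
Qed.

Lemma crossC_eq0 (x : nat -> R[i]) i j : (i < j)%N -> (j < n)%N -> x i != 0 ->
  x i = x j -> crossC n x = 0.
Proof.
move=> ij jn xi E; rewrite /crossC (bigD1 (Ordinal jn))//= (bigD1 (Ordinal ij))//=.
by rewrite -E divff// th_1 !mulr0 !mul0r.
Qed.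

(** Both sides are odd theta functions of [z] that agree at every [x i]. *)
Lemma detC_exchange1 k (x : nat -> R[i]) z : (k < n)%N -> (forall i, x i != 0) ->
  generic n x -> z != 0 -> D (upd x k z) * weylC n x = D x * weylC n (upd x k z).
Proof.
move=> kn x0 gx z0; apply/eqP; rewrite -subr_eq0; apply/eqP.
apply: (@odd_theta_zeros n x
  (fun z => D (upd x k z) * weylC n x - D x * weylC n (upd x k z))) => //.
  apply: odd_thetaB; last by apply: odd_thetaZ; apply: weylC_odd.
  have := odd_thetaZ (weylC n x) (@detC_odd k x kn).
  by congr odd_theta; apply/funext => w; rewrite mulrC.
move=> i ni; have [->|ik] := eqVneq i k.
  have -> : upd x k (x k) = x.
    by apply/funext => l; rewrite /upd; case: eqP => // ->.
  by rewrite subrr.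
have xx : upd x k (x i) i = upd x k (x i) k by rewrite upd_eq upd_neq.
have -> : D (upd x k (x i)) = 0.
  apply: (@determinant_alternate _ _ _ (Ordinal ni) (Ordinal kn)).
    by rewrite -val_eqE.
  by move=> j; rewrite !mxE /= xx.
have -> : weylC n (upd x k (x i)) = 0.
  rewrite /weylC; move: ik; rewrite neq_ltn => /orP[ik|ki].
    by rewrite (crossC_eq0 ik kn) ?mulr0// xx upd_eq.
  by rewrite (crossC_eq0 ki ni) ?mulr0// upd_eq.
by rewrite mul0r mulr0 subrr.
Qed.

Lemma weylC_neq0 (x : nat -> R[i]) : (forall i, x i != 0) -> generic n x ->
  weylC n x != 0.
Proof.
move=> x0 gx; rewrite /weylC mulf_neq0//.
  apply/prodf_neq0 => i _; have [ti /(_ i (ltn_ord i))[tii _]] := gx i (ltn_ord i).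
  move: tii; rewrite -expr2 th_sqr// mulf_eq0 negb_or => /andP[_ phi].
  by rewrite mulf_neq0.
apply/prodf_neq0 => j _; apply/prodf_neq0 => i _.
have ni := ltn_trans (ltn_ord i) (ltn_ord j).
have [_ /(_ j (ltn_ord j))[h1 h2]] := gx i ni.
by rewrite !mulf_neq0 ?invr_neq0// h2// ltn_eqF.
Qed.

Definition hybrid (x y : nat -> R[i]) k i := if (i < k)%N then x i else y i.

(** The variables of [y] are replaced by those of [x] one at a time; in each step
    the quotient of the determinant by [weylC] stays the same. *)
Lemma detC_exchange (x y : nat -> R[i]) : (forall i, x i != 0) ->
  (forall i, y i != 0) -> (forall k, (k <= n)%N -> generic n (hybrid x y k)) ->
  D x * weylC n y = D y * weylC n x.
Proof.
move=> x0 y0 gxy.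
have h0 k i : hybrid x y k i != 0 by rewrite /hybrid; case: ifP.
have D_ext u v : (forall i, (i < n)%N -> u i = v i) -> D u = D v.
  by move=> uv; congr (\det _); apply/matrixP => i j; rewrite !mxE uv.
have W_ext u v : (forall i, (i < n)%N -> u i = v i) -> weylC n u = weylC n v.
  move=> uv; rewrite /weylC /crossC; congr (_ * _).
    by apply: eq_bigr => i _; rewrite uv.
  apply: eq_bigr => j _; apply: eq_bigr => i _.
  by rewrite !uv// (ltn_trans (ltn_ord i)).
suff H k : (k <= n)%N ->
    D (hybrid x y k) * weylC n y = D y * weylC n (hybrid x y k).
  have hx i : (i < n)%N -> hybrid x y n i = x i by rewrite /hybrid => ->.
  by have := H n (leqnn n); rewrite (D_ext _ _ hx) (W_ext _ _ hx).
elim: k => [_|k IH kn].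
  have hy i : (i < n)%N -> hybrid x y 0 i = y i by [].
  by rewrite (D_ext _ _ hy) (W_ext _ _ hy).
have hS : hybrid x y k.+1 = upd (hybrid x y k) k (x k).
  apply/funext => i; rewrite /hybrid /upd ltnS leq_eqVlt.
  by case: eqP => // ->.
have := @detC_exchange1 k (hybrid x y k) (x k) kn (h0 k) (gxy k (ltnW kn)) (x0 k).
rewrite -hS => E; have W0 := weylC_neq0 (h0 k) (gxy k (ltnW kn)).
apply: (mulIf W0); rewrite mulrAC E mulrAC IH ?(ltnW kn)//.
by rewrite mulrAC.
Qed.
End Exchange.
End TypeC.

(** * The C-type determinant *)

Section TriangularProducts.
Variable F : fieldType.
Implicit Types (c : nat -> F) (s : nat -> nat -> F).

Lemma prod_sym_square n s : (forall i j, s i j = s j i) ->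
  \prod_(i < n) \prod_(k < n) s k i =
  \prod_(i < n) s i i * (\prod_(j < n) \prod_(i < j) s i j) ^+ 2.
Proof.
move=> sym; elim: n => [|n IH]; first by rewrite !big_ord0 expr1n mulr1.
rewrite big_ord_recr /= (eq_bigr (fun i : 'I_n => \prod_(k < n) s k i * s n i)).
  rewrite big_split /= IH !big_ord_recr /=.
  have -> : \prod_(i < n) s n i = \prod_(i < n) s i n by apply: eq_bigr => i _.
  by ring.
by move=> i _; rewrite big_ord_recr.
Qed.

Lemma prod_triangle_exchange n c : (forall k, c k != 0) ->
  (\prod_(j < n) \prod_(i < j) c j) * \prod_(i < n) c i =
  \prod_(i < n) c i ^+ n * \prod_(j < n) \prod_(i < j) (c i)^-1.
Proof.
move=> c0; elim: n => [|n IH]; first by rewrite !big_ord0.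
have P0 : \prod_(i < n) c i != 0 by apply/prodf_neq0.
rewrite !big_ord_recr /= prodr_const card_ord prodfV.
have -> : \prod_(i < n) c i ^+ n.+1 = \prod_(i < n) c i ^+ n * \prod_(i < n) c i.
  by rewrite -big_split; apply: eq_bigr => i _; rewrite exprSr.
by rewrite mulrACA IH exprSr; field.
Qed.
End TriangularProducts.

Section TypeCDeterminant.
Variables (R : realType) (p : R[i]).
Hypothesis p0 : p != 0.
Variable th : R[i] -> R[i].
Hypothesis th_holo : pholo th.
Hypothesis th_p : forall x : R[i], x != 0 -> th (p * x) = - x^-1 * th x.
Hypothesis th_1 : th 1 = 0.
Hypothesis th_N1 : th (-1) != 0.
Hypothesis th_inv : forall x : R[i], x != 0 -> th x^-1 = - x^-1 * th x.
Hypothesis th_curve : forall (v : R[i]) (w : int), v != 0 -> w != 0 ->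
  rnear1 (fun t : R => th (v * t%:C ^ w) != 0).
Variable ph : R[i] -> R[i].
Hypothesis ph_holo : pholo ph.
Hypothesis ph_p : forall x : R[i], x != 0 -> ph (p * x) = - (p * x ^+ 2)^-1 * ph x.
Hypothesis ph_inv : forall x : R[i], x != 0 -> ph x^-1 = ph x.
Hypothesis th_sqr : forall x : R[i], x != 0 -> th (x ^+ 2) = th x * th (- x) * ph x.

Let qp_th := qper_th th_holo th_p.

(** On the left, the factors [th (c k * c i)] with [k < i] and with [i < k] are
    equal in pairs, and those with [k = i] split by [th_sqr]; the powers of the
    [c i] balance by [prod_triangle_exchange]. *)
Lemma weylC_at_inv n (c : nat -> R[i]) : (forall k, c k != 0) ->
  \prod_(i < n) (- (c i)^-1 * (c i) ^- n * \prod_(k < n.+1) th (c k * c i)) *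
  th (- (c n)^-1) * (\prod_(j < n) \prod_(i < j) (c j * th (c i / c j))) =
  (\prod_(k < n.+1) c k)^-1 * \prod_(i < n.+1) th (- c i) *
  (\prod_(j < n.+1) \prod_(i < j) th (c i * c j)) *
  weylC th ph n (fun i => (c i)^-1).
Proof.
move=> c0; rewrite -invrN th_inv ?oppr_eq0// invrN opprK.
rewrite /weylC /crossC.
have -> : \prod_(i < n) (th (c i)^-1 * ph (c i)^-1) =
    \prod_(i < n) - (c i)^-1 * (\prod_(i < n) th (c i) * \prod_(i < n) ph (c i)).
  rewrite -!big_split; apply: eq_bigr => i _ /=.
  by rewrite th_inv// ph_inv// mulrA.
have -> : \prod_(j < n) \prod_(i < j)
      ((c i)^-1^-1 * (th ((c i)^-1 * (c j)^-1) * th ((c i)^-1 / (c j)^-1))) =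
    \prod_(j < n) \prod_(i < j) (c i)^-1 *
    (\prod_(j < n) \prod_(i < j) th (c i * c j) *
     \prod_(j < n) \prod_(i < j) th (c i / c j)).
  rewrite -!big_split; apply: eq_bigr => j _; rewrite -!big_split.
  apply: eq_bigr => i _ /=; rewrite !invrK -invfM th_inv ?mulf_neq0//.
  rewrite (_ : (c i)^-1 * c j = (c i / c j)^-1); last by rewrite invfM invrK mulrC.
  rewrite th_inv; last by rewrite mulf_neq0 ?invr_neq0.
  by have ci := c0 i; have cj := c0 j; field; rewrite ci cj.
have -> : \prod_(j < n) \prod_(i < j) (c j * th (c i / c j)) =
    \prod_(j < n) \prod_(i < j) c j * \prod_(j < n) \prod_(i < j) th (c i / c j).
  by rewrite -!big_split; apply: eq_bigr => j _; rewrite -!big_split.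
have -> : \prod_(i < n) (- (c i)^-1 * (c i) ^- n * \prod_(k < n.+1) th (c k * c i)) =
    \prod_(i < n) - (c i)^-1 * (\prod_(i < n) (c i) ^+ n)^-1 *
    (\prod_(i < n) th (c i * c i) *
     (\prod_(j < n) \prod_(i < j) th (c i * c j)) ^+ 2 *
     \prod_(i < n) th (c i * c n)).
  rewrite -(prod_sym_square n (s := fun i j => th (c i * c j))); last first.
    by move=> i j; rewrite mulrC.
  rewrite -prodfV -!big_split; apply: eq_bigr => i _ /=.
  by rewrite big_ord_recr /= [c n * _]mulrC.
have -> : \prod_(i < n) th (c i * c i) =
    \prod_(i < n) th (c i) * \prod_(i < n) th (- c i) * \prod_(i < n) ph (c i).
  by rewrite -!big_split; apply: eq_bigr => i _ /=; rewrite -expr2 th_sqr.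
rewrite !big_ord_recr /=; have := prod_triangle_exchange n c0.
have : \prod_(i < n) c i ^+ n != 0 by apply/prodf_neq0 => i _; rewrite expf_neq0.
have : \prod_(i < n) c i != 0 by apply/prodf_neq0.
have cn := c0 n.
set C := \prod_(i < n) c i; set Cn := \prod_(i < n) c i ^+ n.
set Q := \prod_(j < n) \prod_(i < j) c j.
set q := \prod_(j < n) \prod_(i < j) (c i)^-1 => C0 Cn0 E.
have -> : q = Q * C / Cn by rewrite E mulrC mulKf.
move: (\prod_(i < n) - (c i)^-1) (\prod_(i < n) th (c i)) => A1 A2.
move: (\prod_(i < n) th (- c i)) (\prod_(i < n) ph (c i)) => A3 A4.
move: (\prod_(j < n) \prod_(i < j) th (c i * c j)) => A5.
move: (\prod_(j < n) \prod_(i < j) th (c i / c j)) => A6.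
move: (\prod_(i < n) th (c i * c n)) (th (- c n)) => A7 A8.
by field; rewrite cn Cn0 C0.
Qed.

Definition entryC n (c : nat -> R[i]) (P : nat -> R[i] -> R[i]) (a : nat -> R[i]) j z :=
  z ^- n * (\prod_(k < n.+1) th (c k * z)) * P j z *
  \prod_(j.+1 <= k < n) th (a k * z).

Definition matC n c P a (x : nat -> R[i]) : 'M[R[i]]_n :=
  \matrix_(i < n, j < n)
    (entryC n c P a j (x i) - x i * entryC n c P a j (x i)^-1).

Section Fixed.
Variables (n : nat) (P : nat -> R[i] -> R[i]) (a : nat -> R[i]) (C : R[i]).
Hypotheses (C0 : C != 0) (a0 : forall k, a k != 0).
Let t := - C^-1.
Hypothesis hP : forall j, (j < n)%N ->
  qper p j.+1 ((-1) ^+ j.+1 / (t / \prod_(j.+1 <= k < n) a k)) (P j).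
Let A := \prod_(k < n) a k.
Hypothesis tA : th (- (C * A)) != 0.

Let A0 : A != 0. Proof. by apply/prodf_neq0. Qed.
Let t0 : t != 0. Proof. by rewrite oppr_eq0 invr_neq0. Qed.

Let tAE : th (t / A) = (C * A)^-1 * th (- (C * A)).
Proof.
have -> : t / A = (- (C * A))^-1 by rewrite /t invrN invfM mulNr.
by rewrite th_inv ?oppr_eq0 ?mulf_neq0// invrN opprK.
Qed.

Lemma entryC_qper (c : nat -> R[i]) j : (forall k, c k != 0) -> \prod_(k < n.+1) c k = C ->
  (j < n)%N -> qper p n.*2.+1 (p ^- n) (entryC n c P a j).
Proof.
move=> c0 cC jn.
have h1 : qper p 0 (p ^- n) (fun z => z ^- n).
  split=> [z z0|z z0]; last by rewrite exprMn invfM invr1 mulr1.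
  by apply: cdiff_inv; [apply: cdiffX; exact: cdiff_id|rewrite expf_neq0].
have h2 := @qper_prod _ p _ (index_enum 'I_n.+1) predT (fun=> 1%N)
  (fun k => - (c k)^-1) (fun (k : 'I_n.+1) z => th (c k * z)) (fun k _ => qp_th (c0 k)).
have h3 : qper p n ((-1) ^+ n / t) (fun z => P j z * \prod_(j.+1 <= k < n) th (a k * z)).
  by move: hP jn; case: (n) => // m hPm jm; exact: matA_entry_qper.
have := qperM (qperM h1 h2) h3.
rewrite sum1_card card_ord prod_oppV cC add0n addSn addnn.
rewrite (_ : _ * _ * _ = p ^- n).
  by apply: qper_ext => z; rewrite /entryC mulrA.
rewrite (_ : size _ = n.+1); last by rewrite /index_enum -enumT size_enum_ord.
have pn0 : p ^+ n != 0 by rewrite expf_neq0.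
rewrite exprS /t; have := sqrr_sign R[i] n; rewrite expr2.
move: ((-1) ^+ n) => e ee.
transitivity (e * e * p ^- n); last by rewrite ee mul1r.
by field; rewrite pn0 C0.
Qed.

(** At [(c i)^-1] the first of the two terms of each entry contains [th 1]. *)
Lemma detC_at_inv (c : nat -> R[i]) : (forall k, c k != 0) ->
  \det (matC n c P a (fun i => (c i)^-1)) =
  \prod_(i < n) (- (c i)^-1 * (c i) ^- n * \prod_(k < n.+1) th (c k * c i)) *
  \det (matA th n P a c).
Proof.
move=> c0; rewrite -det_scale_rows; congr (\det _); apply/matrixP => i j.
rewrite !mxE invrK /entryC.
rewrite (bigD1 (widen_ord (leqnSn n) i))//= mulfV// th_1 !(mul0r, mulr0) sub0r.
by ring.
Qed.

Lemma detC_generic (c x : nat -> R[i]) : (forall k, c k != 0) -> \prod_(k < n.+1) c k = C ->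
  (forall i, x i != 0) ->
  (forall k, (k <= n)%N -> generic th n (hybrid x (fun i => (c i)^-1) k)) ->
  \det (matC n c P a x) =
  A / th (- (C * A)) * \prod_(i < n) P i (a i)^-1 * \prod_(i < n.+1) th (- c i) *
  (\prod_(j < n.+1) \prod_(i < j) th (c i * c j)) *
  ((\prod_(j < n) \prod_(i < j) a j) * weylC th ph n x).
Proof.
move=> c0 cC x0 gx.
have y0 i : (c i)^-1 != 0 by rewrite invr_neq0.
have W0 := weylC_neq0 th_sqr y0 (gx 0%N (leq0n n)).
have := @detC_exchange R p p0 th th_holo th_p th_1 th_N1 th_inv ph ph_holo ph_p
  ph_inv th_sqr n (fun j z => entryC n c P a j z - z * entryC n c P a j z^-1)
  (fun j jn => odd_theta_antisym p0 (entryC_qper c0 cC jn)) x _ x0 y0 gx.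
rewrite /= -/(matC n c P a x) -/(matC n c P a (fun i => (c i)^-1)).
rewrite detC_at_inv//.
have := detA p0 th_holo th_p th_1 th_inv th_curve t0 a0 c0 hP.
rewrite -/A tAE mulf_neq0 ?invr_neq0 ?mulf_neq0// => /(_ isT).
have -> : t * \prod_(i < n) c i = - (c n)^-1.
  rewrite /t -cC big_ord_recr /=.
  have : \prod_(i < n) c i != 0 by apply/prodf_neq0.
  move: (\prod_(i < n) c i) => B B0; have cn := c0 n.
  by field; rewrite cn B0.
have -> : crossA th n a c = (\prod_(j < n) \prod_(i < j) a j) *
    \prod_(j < n) \prod_(i < j) (c j * th (c i / c j)).
  rewrite /crossA -big_split; apply: eq_bigr => j _; rewrite -big_split.
  by apply: eq_bigr => i _; rewrite /= mulrA.
have := weylC_at_inv n c0; rewrite cC.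
set L := \prod_(i < n) (- (c i)^-1 * (c i) ^- n * \prod_(k < n.+1) th (c k * c i)).
set cc := \prod_(j < n) \prod_(i < j) (c j * th (c i / c j)).
set N := \prod_(i < n.+1) th (- c i).
set M := \prod_(j < n.+1) \prod_(i < j) th (c i * c j).
set Wy := weylC _ _ _ _ in W0 *; set Wx := weylC _ _ _ _.
set aa := \prod_(j < n) \prod_(i < j) a j; set Q := \prod_(i < n) P i (a i)^-1.
set dA := \det (matA _ _ _ _ _); set dx := \det _.
have T0 := tA; set T := th (- (C * A)) in T0 *; set s := th (- (c n)^-1).
move=> K HA HX.
have E : L * dA = A / T * Q * aa * N * M * Wy.
  have -> : L * dA = C * A / T * L * ((C * A)^-1 * T * dA).
    by have CA := mulf_neq0 C0 A0; field; rewrite A0 C0 T0.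
  rewrite HA; transitivity (C * A / T * Q * aa * (L * s * cc)); first by ring.
  by rewrite K; field; rewrite C0 T0.
apply: (mulIf W0); rewrite HX E; ring.
Qed.

(** The general case, as a limit along a curve on which the product of the
    [c k], and with it the functions [P j], stay fixed. *)
Lemma detC (c x : nat -> R[i]) : (forall k, c k != 0) -> \prod_(k < n.+1) c k = C ->
  (forall i, x i != 0) ->
  \det (matC n c P a x) =
  A / th (- (C * A)) * \prod_(i < n) P i (a i)^-1 * \prod_(i < n.+1) th (- c i) *
  (\prod_(j < n.+1) \prod_(i < j) th (c i * c j)) *
  ((\prod_(j < n) \prod_(i < j) a j) * weylC th ph n x).
Proof.
move=> c0 cC x0.
pose e := (\sum_(k < n) (n + k).+1)%N.
(* The exponents of the [xx z i] are positive, those of the [(cc z i)^-1] are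
   negative and larger in modulus, and all are distinct: no variable, no product
   and no quotient of two variables of a hybrid is constant in [z]. *)
pose xx (z : R[i]) i := x i * z ^+ i.+1.
pose cc (z : R[i]) k := c k * (if (k < n)%N then z ^+ (n + k).+1 else z ^- e).
pose Lh z := \det (matC n (cc z) P a (xx z)).
pose Rh z := A / th (- (C * A)) * \prod_(i < n) P i (a i)^-1 *
  \prod_(i < n.+1) th (- cc z i) *
  (\prod_(j < n.+1) \prod_(i < j) th (cc z i * cc z j)) *
  ((\prod_(j < n) \prod_(i < j) a j) * weylC th ph n (xx z)).
have xx1 : xx 1 = x by apply/funext => i; rewrite /xx expr1n mulr1.
have cc1 : cc 1 = c.
  by apply/funext => k; rewrite /cc !expr1n invr1; case: ifP; rewrite mulr1.
suff : Lh 1 - Rh 1 = 0 by move=> /eqP; rewrite subr_eq0 /Lh /Rh xx1 cc1 => /eqP.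
have nxx i : xx 1 i != 0 by rewrite xx1.
have ncc k : cc 1 k != 0 by rewrite cc1.
have cxx i : ccont (fun z => xx z i) 1.
  by apply: ccontM; [exact: ccont_cst|apply: ccontX; exact: ccont_id].
have ccc k : ccont (fun z => cc z k) 1.
  apply: ccontM; first exact: ccont_cst.
  case: (k < n)%N; first by apply: ccontX; exact: ccont_id.
  apply: ccont_inv; first by apply: ccontX; exact: ccont_id.
  by rewrite expr1n oner_neq0.
have cth f : ccont f 1 -> f 1 != 0 -> ccont (fun w => th (f w)) 1.
  exact: ccont_th.
have centry j f : (j < n)%N -> ccont f 1 -> f 1 != 0 ->
    ccont (fun z => entryC n (cc z) P a j (f z)) 1.
  move=> jn cf f0; rewrite /entryC; apply: ccontM; last first.
    apply: ccont_prod => k _; apply: cth; last by rewrite mulf_neq0.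
    by apply: ccontM => //; exact: ccont_cst.
  apply: ccontM; last first.
    by apply: (ccont_comp cf); apply/cdiff_ccont/(hP jn).1.
  apply: ccontM; last first.
    by apply: ccont_prod => k _; apply: cth; [exact: ccontM|rewrite mulf_neq0].
  by apply: ccont_inv; [exact: ccontX|rewrite expf_neq0].
apply: (@ccont_rnear1 _ (fun z => Lh z - Rh z)).
  apply: ccontB.
    apply: (@ccont_det _ _ (fun z => matC n (cc z) P a (xx z))) => i j.
    apply: (@ccont_ext _ (fun z => entryC n (cc z) P a j (xx z i) -
      xx z i * entryC n (cc z) P a j (xx z i)^-1)) => [z|]; first by rewrite mxE.
    apply: ccontB; first exact: centry.
    apply: ccontM => //; apply: centry; rewrite ?invr_neq0//.
    exact: ccont_inv.
  apply: ccontM; last first.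
    apply: ccontM; first exact: ccont_cst.
    apply: ccontM.
      apply: ccont_prod => i _; apply: ccontM; first exact: cth.
      by apply: (ccont_comp (cxx i)); apply/cdiff_ccont/ph_holo.
    apply: ccont_prod => j _; apply: ccont_prod => i _.
    apply: ccontM; first exact: ccont_inv.
    apply: ccontM; apply: cth; rewrite ?mulf_neq0 ?invr_neq0//; apply: ccontM => //.
    exact: ccont_inv.
  apply: ccontM; last first.
    apply: ccont_prod => j _; apply: ccont_prod => i _.
    by apply: cth; [exact: ccontM|rewrite mulf_neq0].
  apply: ccontM; first exact: ccont_cst.
  apply: ccont_prod => i _; apply: cth; last by rewrite oppr_eq0.
  exact: ccontN.
have nt (s : R) : 1 < s -> s%:C != 0 :> R[i].
  by move=> s1; rewrite -cmod_gt0 cmodr normr_gt0 gt_eqF// (lt_trans ltr01).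
pose v (b : bool) i := if b then x i else (c i)^-1.
pose w (b : bool) i : int := if b then i.+1%:Z else - (n + i).+1%:Z.
have v0 b i : v b i != 0 by rewrite /v; case: b; rewrite ?invr_neq0.
have near_bool (Q : bool -> R -> Prop) : (forall b, rnear1 (Q b)) ->
    rnear1 (fun s => forall b, Q b s).
  move=> H; apply: rnear1_mono (rnear1_and (H true) (H false)) => s _ [? ?].
  by case.
have g1 : rnear1 (fun s => forall i, (i < n)%N -> forall b,
    th (v b i * s%:C ^ w b i) != 0).
  apply: rnear1_all => i ni; apply: (near_bool _) => b; apply: th_curve => //.
  by case: b.
have g2 : rnear1 (fun s => forall i, (i < n)%N -> forall j, (j < n)%N ->
    forall b b', th (v b i * v b' j * s%:C ^ (w b i + w b' j)) != 0).
  apply: rnear1_all => i ni; apply: rnear1_all => j nj.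
  apply: (near_bool _) => b; apply: (near_bool _) => b'.
  apply: th_curve; first by rewrite mulf_neq0.
  by rewrite /w; case: b; case: b'; lia.
have g3 : rnear1 (fun s => forall i, (i < n)%N -> forall j, (j < n)%N ->
    forall b b', i != j -> th (v b i / v b' j * s%:C ^ (w b i - w b' j)) != 0).
  apply: rnear1_all => i ni; apply: rnear1_all => j nj.
  apply: (near_bool _) => b; apply: (near_bool _) => b'.
  have [->|ij] := eqVneq i j; first exact: rnear1_true.
  apply: rnear1_mono (th_curve (v := v b i / v b' j) (w := w b i - w b' j) _ _) => //.
    by rewrite mulf_neq0 ?invr_neq0.
  by move: ij; rewrite /w; case: b; case: b'; lia.
apply: rnear1_mono (rnear1_and g1 (rnear1_and g2 g3)) => s s1 [{}g1 [{}g2 {}g3]].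
have s0 := nt s s1.
suff -> : Lh s%:C = Rh s%:C by rewrite subrr.
apply: detC_generic.
- by move=> k; rewrite /cc mulf_neq0//; case: ifP; rewrite ?invr_neq0 ?expf_neq0.
- rewrite /cc big_split /= cC big_ord_recr /= ltnn.
  rewrite (eq_bigr (fun k : 'I_n => s%:C ^+ (n + k).+1)) => [|k _]; last by rewrite ltn_ord.
  by rewrite prodrXr -/e mulfV ?mulr1// expf_neq0.
- by move=> i; rewrite /xx mulf_neq0// expf_neq0.
move=> k _; pose b i := (i < k)%N.
have hE i : (i < n)%N -> hybrid (xx s%:C) (fun i => (cc s%:C i)^-1) k i =
    v (b i) i * s%:C ^ w (b i) i.
  move=> ni; rewrite /hybrid /v /w /b; case: ifP => _ //.
  by rewrite /cc ni invfM -exprnN.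
move=> i ni; split; first by rewrite hE// g1.
move=> j nj; rewrite !hE//; split.
  by rewrite mulrACA -expfzDr// g2.
move=> ij; rewrite invfM mulrACA invr_expz -expfzDr//.
by rewrite g3.
Qed.
End Fixed.
End TypeCDeterminant.

(** * From nat-indexed families to finite ones *)

Section Extension.
Variable F : fieldType.

(** The value [1] outside the family keeps all values nonzero. *)
Definition extend n (f : 'I_n -> F) (k : nat) : F :=
  if insub k is Some i then f i else 1.

Lemma extendE n (f : 'I_n -> F) (i : 'I_n) : extend f i = f i.
Proof. by rewrite /extend valK. Qed.

Lemma extend_neq0 n (f : 'I_n -> F) : (forall i, f i != 0) ->
  forall k, extend f k != 0.
Proof. by move=> f0 k; rewrite /extend; case: insub => [i|]; rewrite ?oner_neq0. Qed.

Lemma prod_triangle n (G : nat -> nat -> F) :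
  \prod_(i < n) \prod_(j < n | (i < j)%N) G i j =
  \prod_(j < n) \prod_(i < j) G i j.
Proof.
rewrite (exchange_big_dep xpredT)//=; apply: eq_bigr => j _.
by rewrite (big_ord_widen _ (fun i => G i j) (ltnW (ltn_ord j))).
Qed.
End Extension.

Theorem corollary4p11 (R : realType) (p : R[i]) (hp : 0 < `|p| < 1)
  (n : nat) (x a : 'I_n -> R[i]) (c : 'I_n.+1 -> R[i])
  (hx : forall i, x i != 0) (ha : forall i, a i != 0) (hc : forall k, c k != 0)
  (hden : theta (- ((\prod_(k < n.+1) c k) * \prod_(k < n) a k)) p != 0)
  (P : 'I_n -> R[i] -> R[i])
  (hP : forall j : 'I_n,
      A_theta_function p j.+1
        (- ((\prod_(k < n.+1) c k) * \prod_(k < n | (j < k)%N) a k)^-1) (P j)) :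
  \det (\matrix_(i < n, j < n)
     (x i ^- n * (\prod_(k < n.+1) theta (c k * x i) p) * P j (x i)
        * (\prod_(k < n | (j < k)%N) theta (a k * x i) p)
      - x i ^+ n.+1 * (\prod_(k < n.+1) theta (c k * (x i)^-1) p) * P j (x i)^-1
        * (\prod_(k < n | (j < k)%N) theta (a k * (x i)^-1) p)))
  = (\prod_(i < n) a i)
      / theta (- ((\prod_(k < n.+1) c k) * \prod_(k < n) a k)) p
    * (\prod_(i < n) P i (1 / a i))
    * (\prod_(i < n.+1) theta (- c i) p)
    * (\prod_(i < n.+1) \prod_(j < n.+1 | (i < j)%N) theta (c i * c j) p)
    * (\prod_(i < n) (theta (x i) p * theta (p * x i ^+ 2) (p ^+ 2)))
    * (\prod_(i < n) \prod_(j < n | (i < j)%N)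
         (a j * (x i)^-1 * (theta (x i * x j) p * theta (x i / x j) p))).
Proof.
have [pr0 p1] : 0 < cmod p /\ cmod p < 1.
  by move: hp; rewrite cmodE (ltcR 0) (ltcR _ 1) => /andP.
have p0 : p != 0 by rewrite -cmod_gt0.
have q1 := cmod_sqr_lt1 p1.
have q0 : p ^+ 2 != 0 by rewrite expf_neq0.
pose th z := theta z p; pose ph z := theta (p * z ^+ 2) (p ^+ 2).
have pz0 (z : R[i]) : z != 0 -> p * z ^+ 2 != 0.
  by move=> z0; rewrite mulf_neq0// expf_neq0.
have th_N1 : th (-1) != 0.
  have N0 : -1 != 0 :> R[i] by rewrite oppr_eq0 oner_neq0.
  apply: theta_neq0 => // k; apply/negP => /eqP E.
  have Ek : cmod p ^ k = cmod p ^ 0.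
    by rewrite expr0z -cmodXz -E cmodN cmod1.
  have k0 : k = 0 by apply: (ieexprIz pr0 _ Ek); rewrite lt_eqF.
  move: E; rewrite k0 expr0z => /eqP; rewrite eq_sym -addr_eq0 -mulr2n.
  by rewrite mulrn_eq0 oner_eq0.
have ph_holo : pholo ph.
  move=> z z0; apply: (@cdiff_comp _ (fun z => theta z (p ^+ 2)) (fun z => p * z ^+ 2)).
    by apply: cdiffM; [exact: cdiff_cst|apply: cdiffX; exact: cdiff_id].
  exact: (pholo_theta q1 q0 (pz0 _ z0)).
have ph_p z : z != 0 -> ph (p * z) = - (p * z ^+ 2)^-1 * ph z.
  move=> z0; rewrite /ph (_ : p * (p * z) ^+ 2 = p ^+ 2 * (p * z ^+ 2)); last by ring.
  exact: (theta_mulp q1 q0 (pz0 z z0)).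
have ph_inv z : z != 0 -> ph z^-1 = ph z.
  move=> z0; rewrite /ph (_ : p * z^-1 ^+ 2 = p ^+ 2 / (p * z ^+ 2)).
    exact: (theta_sym q0 (pz0 z z0)).
  by field; rewrite p0 z0.
pose C := \prod_(k < n.+1) c k.
have C0 : C != 0 by apply/prodf_neq0.
pose a' := extend a; pose x' := extend x; pose c' := extend c.
pose P' (j : nat) : R[i] -> R[i] := if insub j is Some i then P i else fun=> 0.
have P'E (j : 'I_n) : P' j = P j by rewrite /P' valK.
have tailE (G : R[i] -> R[i]) (j : nat) :
    \prod_(k < n | (j < k)%N) G (a k) = \prod_(j.+1 <= k < n) G (a' k).
  by rewrite big_geq_mkord; apply: eq_big => // k _; rewrite /a' extendE.
have hP' j : (j < n)%N -> qper p j.+1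
    ((-1) ^+ j.+1 / (- C^-1 / \prod_(j.+1 <= k < n) a' k)) (P' j).
  move=> jn; have [h1 h2] := hP (Ordinal jn); rewrite -(P'E (Ordinal jn)) /= in h1 h2.
  split=> [|z z0]; first exact: holomorphic_pholo.
  rewrite h2// (tailE id) -/C; congr (_ * _).
  have : \prod_(j.+1 <= k < n) a' k != 0.
    by rewrite prodf_seq_neq0; apply/allP => k _; apply/implyP => _; exact: extend_neq0.
  have : z ^+ j.+1 != 0 by rewrite expf_neq0.
  move: (z ^+ j.+1) (\prod_(j.+1 <= k < n) a' k) ((-1) ^+ j.+1) => w B e w0 B0.
  by field; rewrite w0 B0 C0.
have a0 := extend_neq0 ha; have x0 := extend_neq0 hx; have c0 := extend_neq0 hc.
have AE : \prod_(k < n) a' k = \prod_(k < n) a k.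
  by apply: eq_bigr => k _; rewrite /a' extendE.
have cC : \prod_(k < n.+1) c' k = C by apply: eq_bigr => k _; rewrite /c' extendE.
have tA : th (- (C * \prod_(k < n) a' k)) != 0 by rewrite AE; exact: hden.
have := @detC R p p0 th (pholo_theta p1 p0) (fun z => theta_mulp p1 p0) (theta_1 p1)
  th_N1 (fun z => theta_inv p1) (fun v w => theta_curve_neq0 pr0 p1) ph ph_holo
  ph_p ph_inv (fun z => theta_sqr p1 p0) n P' a' C C0 a0 hP' tA c' x' c0 cC x0.
rewrite AE => E; apply: etrans (etrans _ E) _.
  congr (\det _); apply/matrixP => i j; rewrite !mxE /entryC.
  have thcE z : \prod_(k < n.+1) theta (c k * z) p = \prod_(k < n.+1) th (c' k * z).
    by apply: eq_bigr => k _; rewrite /c' extendE.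
  rewrite !thcE !(tailE (fun w => theta (w * _) p)) P'E /x' extendE.
  rewrite exprVn invrK exprS -/th; congr (_ - _); ring.
have -> : \prod_(i < n) P' i (a' i)^-1 = \prod_(i < n) P i (1 / a i).
  by apply: eq_bigr => i _; rewrite P'E /a' extendE div1r.
have -> : \prod_(i < n.+1) th (- c' i) = \prod_(i < n.+1) theta (- c i) p.
  by apply: eq_bigr => i _; rewrite /c' extendE.
rewrite -(prod_triangle n.+1 (fun i j => th (c' i * c' j))).
have -> : \prod_(i < n.+1) \prod_(j < n.+1 | (i < j)%N) th (c' i * c' j) =
    \prod_(i < n.+1) \prod_(j < n.+1 | (i < j)%N) theta (c i * c j) p.
  by apply: eq_bigr => i _; apply: eq_bigr => j _; rewrite /c' !extendE.
rewrite -[RHS]mulrA; congr (_ * _); rewrite /weylC mulrCA; congr (_ * _).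
  by apply: eq_bigr => i _; rewrite /x' extendE.
rewrite /crossC -big_split /=.
rewrite (eq_bigr (fun j : 'I_n => \prod_(i < j)
  (a' j * (x' i)^-1 * (th (x' i * x' j) * th (x' i / x' j))))) => [|j _]; last first.
  by rewrite -big_split; apply: eq_bigr => i _ /=; rewrite mulrA.
rewrite -(prod_triangle n (fun i j =>
  a' j * (x' i)^-1 * (th (x' i * x' j) * th (x' i / x' j)))).
by apply: eq_bigr => i _; apply: eq_bigr => j _; rewrite /a' /x' !extendE.
Qed.
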